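(* For at least $87.5\%$ of the quadratic number fields $K$ with discriminant $8d$, where $d$ is an odd positive square-free integer, one has $\zeta_K'(1/2) \neq 0$. That is, writing $K_d = \mathbb{Q}(\sqrt{2d})$ (the quadratic field of discriminant $8d$), $$\liminf_{x\to\infty} \frac{\#\{d \leq x : d \text{ odd, positive, square-free},\ \zeta_{K_d}'(1/2) \neq 0\}}{\#\{d \leq x : d \text{ odd, positive, square-free}\}} \geq \frac{7}{8}.$$
   Context: For a number field $K$, $\zeta_K(s)$ denotes the Dedekind zeta function of $K$, i.e. the meromorphic continuation to $\mathbb{C}$ (holomorphic except for a simple pole at $s=1$) of $\sum_{I \neq 0} N(I)^{-s}$, $\Re(s)>1$, the sum being over the nonzero ideals of the ring of integers of $K$. $\zeta_K'$ denotes its derivative in $s$. For $d$ odd, positive and square-free, there is exactly one quadratic field of discriminant $8d$, namely $\mathbb{Q}(\sqrt{2d})$. The result is deduced from the following known theorem of Soundararajan, with the phrase ''at least $87.5\%$'' understood in the same lower-density sense: for at least $87.5\%$ of the odd square-free integers $d \geq 0$, $L(1/2,\chi_{8d}) \neq 0$, where $\chi_{8d}(n) = \left(\frac{8d}{n}\right)$ is the Kronecker symbol and $L(s,\chi_{8d})$ is the analytic continuation of $\sum_{n\ge1} \chi_{8d}(n) n^{-s}$. *)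

(* Defs.v *)
Set Warnings "-notation-overridden,-notation-incompatible-prefix,-ambiguous-paths".
From HB Require Import structures.
From mathcomp Require Export all_boot all_order all_algebra all_field.
From mathcomp Require Export finmap.
From mathcomp Require Export all_classical all_reals all_analysis.
From mathcomp Require Export complex.

Set Implicit Arguments.
Unset Strict Implicit.
Unset Printing Implicit Defensive.

Import Order.TTheory GRing.Theory Num.Theory.
Import numFieldNormedType.Exports.

Local Open Scope classical_set_scope.
Local Open Scope ring_scope.

(* R[i]^o is R[i] as a normed module over itself, so that [derivable f s 1]
   and [derive1 f s] refer to differentiation in a complex variable. *)
Notation CC R := (R[i]^o).

(* n ^ s for an integer n > 0. *)
Definition natcpow (R : realType) (n : nat) (s : CC R) : CC R :=
  let t := complex.Im s * ln n%:R in
  (n%:R `^ complex.Re s)%:C%C * Complex (cos t) (sin t).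

(* Convergence along the finite subsets of D ordered by inclusion, i.e.
   unordered (equivalently, absolute) summation over D. *)
Definition has_sum (R : realType) (T : choiceType) (D : set T)
    (f : T -> CC R) (l : CC R) : Prop :=
  forall e : R, 0 < e ->
    exists2 A : {fset T}, [set` A] `<=` D &
      forall B : {fset T}, [set` A] `<=` [set` B] -> [set` B] `<=` D ->
        `|\sum_(i <- B) f i - l| < e%:C%C.

Section NumberField.
Variable K : fieldExtType rat.

Definition ring_of_integers : set K :=
  [set x | integralOver (intr : int -> K) x].

Definition is_ideal (I : set K) : Prop :=
  [/\ I `<=` ring_of_integers, I 0,
      forall x y, I x -> I y -> I (x + y) &
      forall a x, ring_of_integers a -> I x -> I (a * x)].

Definition nonzero_ideals : set (set K) :=
  [set I | is_ideal I /\ I <> [set 0]].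

(* The number of cosets x + I with x in the ring of integers. *)
Definition ideal_norm (I : set K) : nat :=
  #|` fset_set [set [set x + y | y in I] | x in ring_of_integers] |.

Definition is_dedekind_zeta (R : realType) (f : CC R -> CC R) : Prop :=
  [/\ forall s, s != 1 -> derivable f s 1,
      exists2 r : CC R, r != 0 & (s - 1) * f s @[s --> (1 : CC R)^'] --> r &
      forall s, 1 < complex.Re s ->
        has_sum nonzero_ideals (fun I => natcpow (ideal_norm I) (- s)) (f s)].

(* By the identity theorem at most one function satisfies is_dedekind_zeta, up
   to its irrelevant value at the pole 1. *)
Definition dedekind_zeta (R : realType) : CC R -> CC R :=
  xget (fun=> 0) [set f | is_dedekind_zeta f].

End NumberField.
Arguments dedekind_zeta K {R}.

Definition is_dirichletL (R : realType) (chi : nat -> int)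
    (f : CC R -> CC R) : Prop :=
  (forall s, derivable f s 1) /\
  (forall s, 1 < complex.Re s ->
    series (fun n => (chi n.+1)%:~R * natcpow n.+1 (- s) : CC R) @ \oo --> f s).

Definition dirichletL (R : realType) (chi : nat -> int) : CC R -> CC R :=
  xget (fun=> 0) [set f | is_dirichletL chi f].

(* For p an odd prime; 'F_p is then the field of integers modulo p. *)
Definition legendre (a : int) (p : nat) : int :=
  if (p%:Z %| a)%Z then 0
  else if [exists x : 'F_p, x ^+ 2 == a%:~R] then 1 else -1.

Definition kronecker_prime (a : int) (p : nat) : int :=
  if p == 2%N then
    if (2 %| a)%Z then 0
    else if ((a %% 8)%Z == 1) || ((a %% 8)%Z == 7) then 1 else -1
  else legendre a p.

(* The Kronecker symbol (a / n) for n > 0. *)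
Definition kronecker (a : int) (n : nat) : int :=
  \prod_(p <- primes n) kronecker_prime a p ^+ logn p n.

(* The number field generated over rat by the square root of n. *)
Definition Qsqrt (n : nat) : fieldExtType rat :=
  tag (num_field_exists [:: sqrtC (n%:R : algC)]).

Definition squarefree (n : nat) : bool :=
  (0 < n)%N && all (fun p => ~~ (p ^ 2 %| n)%N) (primes n).

Definition count_odd_squarefree (R : realType) (P : set nat) (x : R) : nat :=
  #|` fset_set [set d : nat | [/\ d%:R <= x, odd d, squarefree d & P d]] |.

(* liminf, as x -> +oo, of the proportion of the odd positive square-free
   integers d <= x that satisfy P. *)
Definition lower_density_odd_squarefree (R : realType) (P : set nat) : \bar R :=
  limf_einf (fun x : R => ((count_odd_squarefree P x)%:R
                           / (count_odd_squarefree setT x)%:R)%:E) +oo%R.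

(* Main.v *)
(* Write zeta_K(s) = zeta(s) L(s, chi) for K = Q(sqrt(2d)) and chi = chi_{8d}.
   If L(1/2) <> 0 and zeta_K'(1/2) = 0, then, since zeta(1/2) <> 0, L'/L at 1/2
   equals - zeta'/zeta at 1/2, which does not depend on d.  In the functional
   equation of L, however, d enters only through a factor c (8d)^s, so that two
   such d have the same conductor 8d.  Hence there is at most one exceptional
   d, and deleting one integer from Soundararajan's set does not change its
   lower density.

   The functional equation is needed for real s in (0, 1) only: it is the Mellin
   transform of
     tau * sum chi(n) exp(-n t) = sum chi(k) 2t / (t^2 + (2 pi k / 8d)^2),
   where tau is the Gauss sum.  No continuation of L beyond Re s > 0 has to be
   constructed, because [dirichletL] takes the value 0 unless one exists. *)
Set Warnings "-notation-overridden,-notation-incompatible-prefix,-ambiguous-paths".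
Require Import Defs.
From mathcomp Require Import ring lra zify measurable_realfun.
Import Order.TTheory GRing.Theory Num.Theory.
Import numFieldNormedType.Exports.
Local Open Scope classical_set_scope.
Local Open Scope ring_scope.
Set Implicit Arguments.
Unset Strict Implicit.
Unset Printing Implicit Defensive.

(** The default value 0 acts in opposite ways on the two functions. A nonzero value of [dirichletL]
    at 1/2 already supplies the continuation, but the default of [dedekind_zeta] has derivative 0
    and would count as exceptional. So for each d that matters a function meeting every clause of
    [is_dedekind_zeta] has to be produced: ideals are counted norm by norm and matched with the
    coefficients of zeta(s) L(s), the function (s - 1) zeta(s) is continued to all of C, and L(1) <>
    0 is proved because the residue has to be nonzero. For two exceptional integers d1, d2 the
    functional equations are multiplied crosswise. The integrals that stand for the Gamma factors
    and the powers of 2 pi cancel, and at 1/2 so do the two equal values of L'/L in the logarithmic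
    derivative; ln (8 d1) = ln (8 d2) remains. Thus only nonvanishing and independence of d matter,
    never the value of a constant. An identity on a real interval is enough because a complex
    derivative can be read off from real increments. *)

Local Notation re := complex.Re.
Local Notation im := complex.Im.
Local Notation cmod := ComplexField.Normc.normc.
Local Notation "x %:C" := (real_complex _ x) : ring_scope.

(** * Complex differentiability *)

Section Modulus.
Variable R : realType.
Implicit Types (z w : R[i]) (x y : R).

Lemma cmodE z : `|z| = (cmod z)%:C. Proof. by []. Qed.

Lemma cmod_ge0 z : 0 <= cmod z.
Proof. by rewrite -lecR -cmodE normr_ge0. Qed.

Lemma cmodM z w : cmod (z * w) = cmod z * cmod w.
Proof. exact: ComplexField.Normc.normcM. Qed.

Lemma cmodD z w : cmod (z + w) <= cmod z + cmod w.
Proof. exact: (@le_normcD R z w). Qed.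

Lemma cmodN z : cmod (- z) = cmod z.
Proof. exact: (@normcN R z). Qed.

Lemma cmodBC z w : cmod (z - w) = cmod (w - z).
Proof. by rewrite -cmodN opprB. Qed.

Lemma cmodB z w : cmod (z - w) <= cmod z + cmod w.
Proof. by rewrite -(cmodN w) cmodD. Qed.

Lemma cmod0 : cmod (0 : R[i]) = 0.
Proof. exact: ComplexField.Normc.normc0. Qed.

Lemma cmod1 : cmod (1 : R[i]) = 1.
Proof. exact: ComplexField.Normc.normc1. Qed.

Lemma cmod_eq0 z : (cmod z == 0) = (z == 0).
Proof.
apply/eqP/eqP => [|->]; [exact: ComplexField.Normc.eq0_normc | exact: cmod0].
Qed.

Lemma cmod_gt0 z : (0 < cmod z) = (z != 0).
Proof. by rewrite lt_neqAle cmod_ge0 andbT eq_sym cmod_eq0. Qed.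

Lemma cmodV z : cmod z^-1 = (cmod z)^-1.
Proof. exact: ComplexField.Normc.normcV. Qed.

Lemma cmod_real x : cmod (x%:C) = `|x|.
Proof. by rewrite /= expr0n /= addr0 sqrtr_sqr. Qed.

Lemma cmod_i : cmod ('i%C : R[i]) = 1.
Proof. by rewrite /= expr0n /= add0r expr1n sqrtr1. Qed.

Lemma cmod_nat n : cmod (n%:R : R[i]) = n%:R.
Proof.
have -> : (n%:R : R[i]) = (n%:R)%:C by rewrite rmorph_nat.
by rewrite cmod_real ger0_norm.
Qed.

Lemma re_le_cmod z : `|re z| <= cmod z.
Proof. by rewrite -lecR; apply: normc_ge_Re. Qed.

Lemma im_le_cmod z : `|im z| <= cmod z.
Proof.
have -> : im z = re (z * - 'i%C) by case: z => a b /=; ring.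
by rewrite (le_trans (re_le_cmod _)) // cmodM cmodN cmod_i mulr1.
Qed.

Lemma cmod_le_reim z : cmod z <= `|re z| + `|im z|.
Proof.
rewrite {1}(complexE z) (le_trans (cmodD _ _)) // cmodM cmod_i mul1r.
by rewrite !cmod_real.
Qed.

Lemma reD z w : re (z + w) = re z + re w. Proof. by case: z w => [? ?] [? ?]. Qed.
Lemma imD z w : im (z + w) = im z + im w. Proof. by case: z w => [? ?] [? ?]. Qed.
Lemma reN z : re (- z) = - re z. Proof. by case: z. Qed.
Lemma imN z : im (- z) = - im z. Proof. by case: z. Qed.
Lemma reB z w : re (z - w) = re z - re w. Proof. by rewrite reD reN. Qed.
Lemma imB z w : im (z - w) = im z - im w. Proof. by rewrite imD imN. Qed.
Lemma reM z w : re (z * w) = re z * re w - im z * im w.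
Proof. by case: z w => [? ?] [? ?]. Qed.
Lemma imM z w : im (z * w) = re z * im w + im z * re w.
Proof. by case: z w => [? ?] [? ?]. Qed.

Lemma complex_ext z w : re z = re w -> im z = im w -> z = w.
Proof. by case: z w => [a b] [c d] /= -> ->. Qed.

Lemma cmod_sum (I : Type) (r : seq I) (P : pred I) (F : I -> R[i]) :
  cmod (\sum_(i <- r | P i) F i) <= \sum_(i <- r | P i) cmod (F i).
Proof.
elim/big_rec2: _ => [|i x y _ h]; first by rewrite cmod0.
by rewrite (le_trans (cmodD _ _)) // lerD2l.
Qed.

Lemma cmodB_ge z w : cmod z - cmod w <= cmod (z - w).
Proof. by rewrite lerBlDr (le_trans _ (cmodD _ _)) // subrK. Qed.
End Modulus.

Lemma gt0_complex (R : realType) (z : R[i]) : 0 < z -> z = (re z)%:C /\ 0 < re z.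
Proof. by rewrite ltcE /= => /andP[/eqP]; case: z => a b /= ->. Qed.

Section Derivative.

(** A form of differentiability without division, proved over any [numFieldType] so that it serves
    both R ([is_deriveP]) and R[i] ([cderP]). *)
Lemma is_derive_epsP (K : numFieldType) (f : K -> K) (z l : K) :
  is_derive (z : K^o) 1 (f : K^o -> K^o) l <->
  forall e : K, 0 < e -> exists2 d : K, 0 < d &
    forall h, `|h| < d -> `|f (z + h) - f z - l * h| <= e * `|h|.
Proof.
set q := fun h : K => h^-1 *: ((f : K^o -> K^o) (h *: (1:K^o) + z) - f z) : K^o.
split.
- case=> dv dl e e0.
  have : q h @[h --> 0^'] --> (l : K^o) by rewrite -dl; exact: dv.
  move=> /cvgrPdist_lt /(_ e e0) /nbhs_ballP [d /= d0 H].
  exists d => // h hd; have [->|h0] := eqVneq h 0.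
    by rewrite addr0 subrr mulr0 subr0 normr0 mulr0.
  have /= := H h; rewrite -ball_normE /= sub0r normrN => /(_ hd h0).
  rewrite /q /= /GRing.scale /= mulr1 (addrC h) => {}H.
  rewrite -ler_pdivrMr ?normr_gt0 // -normfV -normrM.
  by rewrite (le_trans _ (ltW H)) // distrC mulrBl mulfK // (mulrC _ h^-1).
- move=> H.
  have hl : q h @[h --> 0^'] --> (l : K^o).
    apply/cvgrPdist_le => e e0; have [d d0 {}H] := H e e0.
    apply/nbhs_ballP; exists d => //= h.
    rewrite -ball_normE /= sub0r normrN => hd h0.
    have {}H := H h hd.
    rewrite /q /= /GRing.scale /= mulr1 (addrC h).
    rewrite -ler_pdivrMr ?normr_gt0 // -normfV -normrM in H.
    by rewrite (le_trans _ H) // distrC mulrBl mulfK // (mulrC _ h^-1).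
  by split; [apply/cvg_ex; exists l|apply: cvg_lim => //; exact: norm_hausdorff].
Qed.

Variable R : realType.
Implicit Types (f g : R[i] -> R[i]) (z w l : R[i]).

(** Tolerances are real and the increment is not divided by h, so all estimates stay in the linear
    order of R and h = 0 is no special case. *)
Definition cder f z l := forall e : R, 0 < e -> exists2 d : R, 0 < d &
  forall h, cmod h < d -> cmod (f (z + h) - f z - l * h) <= e * cmod h.

Lemma cderP f z l : is_derive (z : CC R) 1 (f : CC R -> CC R) l <-> cder f z l.
Proof.
split=> [/is_derive_epsP H e e0|H].
  have [|d d0 {}H] := H e%:C; first by rewrite ltcR.
  have [d1 d2] := gt0_complex d0.
  exists (re d) => // h hd.
  by rewrite -lecR rmorphM -!cmodE; apply: H; rewrite d1 cmodE ltcR.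
apply/is_derive_epsP => e /gt0_complex[e1 e0].
have [d d0 {}H] := H _ e0; exists d%:C => [|h]; first by rewrite ltcR.
rewrite cmodE ltcR => /H; have -> : e * `|h| = (re e * cmod h)%:C.
  by rewrite rmorphM {1}e1.
by rewrite -lecR.
Qed.

Lemma derivable_cder f z : derivable (f : CC R -> CC R) z 1 -> cder f z ('D_1 (f : CC R -> CC R) z).
Proof. by move=> /derivableP h; apply/cderP. Qed.

Lemma cder_derivable f z l : cder f z l -> derivable (f : CC R -> CC R) z 1.
Proof. by move=> /cderP[]. Qed.

Lemma cder_derive f z l : cder f z l -> derive1 (f : CC R -> CC R) z = l.
Proof. by move=> /cderP[_ <-]; rewrite derive1E. Qed.

Lemma cder_cst c z : cder (fun=> c) z 0.
Proof. by apply/cderP; exact: is_derive_cst. Qed.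

Lemma cder_id z : cder id z 1.
Proof. by apply/cderP; exact: is_derive_id. Qed.

Lemma cderD f g z a b : cder f z a -> cder g z b ->
  cder (fun w => f w + g w) z (a + b).
Proof. by move=> /cderP ? /cderP ?; apply/cderP; exact: is_deriveD. Qed.

Lemma cderN f z a : cder f z a -> cder (fun w => - f w) z (- a).
Proof. by move=> /cderP ?; apply/cderP; exact: is_deriveN. Qed.

Lemma cderB f g z a b : cder f z a -> cder g z b ->
  cder (fun w => f w - g w) z (a - b).
Proof. by move=> ? ?; apply: cderD => //; exact: cderN. Qed.

Lemma cderM f g z a b : cder f z a -> cder g z b ->
  cder (fun w => f w * g w) z (f z * b + g z * a).
Proof. by move=> /cderP ? /cderP ?; apply/cderP; exact: is_deriveM. Qed.

Lemma cder_lip f z l : cder f z l -> exists2 d : R, 0 < d &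
  forall h, cmod h < d -> cmod (f (z + h) - f z) <= (cmod l + 1) * cmod h.
Proof.
move=> /(_ 1 ltr01)[d d0 H]; exists d => // h /H {}H.
have -> : f (z + h) - f z = (f (z + h) - f z - l * h) + l * h by ring.
by rewrite (le_trans (cmodD _ _)) // mulrDl addrC cmodM lerD2l.
Qed.

Lemma cder_comp f g z a b : cder f z a -> cder g (f z) b ->
  cder (fun w => g (f w)) z (b * a).
Proof.
move=> hf hg e e0; have a1 : 0 < cmod a + 1 by rewrite ltr_wpDl ?cmod_ge0.
have b1 : 0 < cmod b + 1 by rewrite ltr_wpDl ?cmod_ge0.
have [d1 d10 H1] := cder_lip hf.
have [|d2 d20 H2] := hg (e / 2 / (cmod a + 1)); first by rewrite !divr_gt0.
have [|d3 d30 H3] := hf (e / 2 / (cmod b + 1)); first by rewrite !divr_gt0.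
exists (Num.min d1 (Num.min (d2 / (cmod a + 1)) d3)) => [|h].
  by rewrite !lt_min d10 d30 divr_gt0.
rewrite !lt_min => /andP[h1 /andP[h2 h3]].
set k := f (z + h) - f z; have k1 : cmod k <= (cmod a + 1) * cmod h by exact: H1.
have kd : cmod k < d2.
  by rewrite (le_lt_trans k1) // mulrC -ltr_pdivlMr.
have {}H2 := H2 k kd; have {}H3 := H3 h h3.
have -> : g (f (z + h)) - g (f z) - b * a * h =
  (g (f z + k) - g (f z) - b * k) + b * (f (z + h) - f z - a * h).
  by rewrite {1}/k addrCA subrr addr0 /k; ring.
rewrite (le_trans (cmodD _ _)) // cmodM [leRHS](_ : _ = e / 2 * cmod h + e / 2 * cmod h); last by field.
rewrite lerD // ?(le_trans H2) //.
  have c0 : 0 <= e / 2 / (cmod a + 1) by rewrite !divr_ge0 // ltW.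
  by rewrite (le_trans (ler_wpM2l c0 k1)) // mulrA divfK // lt0r_neq0.
rewrite (le_trans (ler_wpM2l (cmod_ge0 _) H3)) //.
rewrite (_ : _ * _ = (cmod b / (cmod b + 1)) * (e / 2 * cmod h)); last by field; rewrite lt0r_neq0.
have c0 : 0 <= e / 2 * cmod h by rewrite mulr_ge0 ?cmod_ge0 // divr_ge0 // ltW.
by rewrite ler_piMl // ler_pdivrMr // mul1r lerDl.
Qed.

Lemma cder_sum (I : Type) (r : seq I) (F : I -> R[i] -> R[i]) (dF : I -> R[i]) z :
  (forall i, cder (F i) z (dF i)) ->
  cder (fun w => \sum_(i <- r) F i w) z (\sum_(i <- r) dF i).
Proof.
move=> h; elim: r => [|i r IH].
  rewrite big_nil; have -> : (fun w => \sum_(i <- [::]) F i w) = fun=> 0.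
    by apply/funext => w; rewrite big_nil.
  exact: cder_cst.
rewrite big_cons; have -> : (fun w => \sum_(i <- i :: r) F i w) =
  fun w => F i w + \sum_(i <- r) F i w by apply/funext => w; rewrite big_cons.
exact: cderD.
Qed.

Lemma cder_near f g z l (d : R) : 0 < d ->
  (forall w, cmod (w - z) < d -> f w = g w) -> cder f z l -> cder g z l.
Proof.
move=> d0 fg H e e0; have [d' d'0 {}H] := H e e0.
exists (Num.min d d') => [|h]; rewrite !lt_min ?d0 // => /andP[h1 h2].
rewrite -!fg ?subrr ?cmod0 ?H //.
by rewrite (_ : z + h - z = h) //; ring.
Qed.

Lemma cder_inv z : z != 0 -> cder (fun w => w^-1) z (- z^-1 ^+ 2).
Proof.
move=> z0; apply/cderP.
have := @is_derive_eq _ _ _ _ _ _ _ _ (derivableP (@derivableV (CC R) (CC R) id z 1 z0 (@derivable_id _ _ _ _))).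
apply; rewrite deriveV // derive_id /GRing.scale /= mulr1.
by rewrite exprVn.
Qed.

End Derivative.

Section RealVariable.
Variable R : realType.
Implicit Types (f : R[i] -> R[i]) (G g : R -> R[i]) (z w l : R[i]).

(** Paths in R[i] are differentiated by components, which makes the real mean value theorem and the
    fundamental theorem of calculus available. *)
Definition rderiv G (x : R) l :=
  is_derive x 1 (fun t => re (G t)) (re l) /\
  is_derive x 1 (fun t => im (G t)) (im l).

Lemma is_deriveP (h : R -> R) (x l : R) :
  is_derive x 1 h l <->
  forall e : R, 0 < e -> exists2 d : R, 0 < d &
    forall t, `|t| < d -> `|h (x + t) - h x - l * t| <= e * `|t|.
Proof. exact: is_derive_epsP. Qed.

Lemma rderiv_line f z v l (x : R) : cder f (z + v * x%:C) l ->
  rderiv (fun t => f (z + v * t%:C)) x (v * l).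
Proof.
move=> H; have v1 : 0 < cmod v + 1 by rewrite ltr_wpDl ?cmod_ge0.
have K e : 0 < e -> exists2 d : R, 0 < d & forall t : R, `|t| < d ->
    cmod (f (z + v * (x + t)%:C) - f (z + v * x%:C) - v * l * t%:C) <= e * `|t|.
  move=> e0; have [|d d0 {}H] := H (e / (cmod v + 1)); first by rewrite divr_gt0.
  exists (d / (cmod v + 1)) => [|t]; first by rewrite divr_gt0.
  rewrite ltr_pdivlMr // => td.
  have vt : cmod (v * t%:C) <= `|t| * (cmod v + 1).
    by rewrite cmodM cmod_real mulrC ler_wpM2l // lerDl.
  have {}H := H _ (le_lt_trans vt td).
  have -> : f (z + v * (x + t)%:C) - f (z + v * x%:C) - v * l * t%:C =
    f (z + v * x%:C + v * t%:C) - f (z + v * x%:C) - l * (v * t%:C).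
    by rewrite rmorphD mulrDr addrA; ring.
  rewrite (le_trans H) // mulrAC ler_pdivrMr // -mulrA.
  by rewrite ler_wpM2l // ltW.
move: (v * l) K => c K.
by split; apply/is_deriveP => e e0; have [d d0 {}K] := K e e0; exists d => // t /K;
  apply: le_trans; [apply: le_trans (re_le_cmod _)|apply: le_trans (im_le_cmod _)];
  rewrite (reB, imB) (reB, imB) (reM, imM) /= mulr0 ?subr0 ?add0r.
Qed.

Lemma rderivB G g x a b : rderiv G x a -> rderiv g x b ->
  rderiv (fun t => G t - g t) x (a - b).
Proof.
move=> [h1 h2] [h3 h4]; split.
  have -> : (fun t => re (G t - g t)) = (fun t => re (G t)) - (fun t => re (g t)).
    by apply/funext => t; rewrite reB.
  by rewrite reB; apply: is_deriveB.
have -> : (fun t => im (G t - g t)) = (fun t => im (G t)) - (fun t => im (g t)).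
  by apply/funext => t; rewrite imB.
by rewrite imB; apply: is_deriveB.
Qed.

Lemma mean_value_ineq (h dh : R -> R) (a b M : R) : a <= b ->
  (forall x, a <= x <= b -> is_derive x 1 h (dh x)) ->
  (forall x, a <= x <= b -> `|dh x| <= M) -> `|h b - h a| <= M * (b - a).
Proof.
move=> ab hd hM.
have [||c] := @MVT_segment R h dh a b ab.
- by move=> x; rewrite in_itv /= => /andP[/ltW ax /ltW xb]; apply: hd; rewrite ax.
- apply: derivable_within_continuous => x; rewrite in_itv /= => xab.
  by have [] := hd x xab.
rewrite in_itv /= => cab ->.
by rewrite normrM (ger0_norm (_ : 0 <= b - a)) ?subr_ge0 // ler_wpM2r ?subr_ge0 // hM.
Qed.

(** The mean value theorem has no exact complex form; applying it to the real and the imaginary part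
    separately costs the factor 2, which then appears in all later Cauchy estimates. *)
Lemma rderiv_mean_value G g (a b M : R) : a <= b ->
  (forall x, a <= x <= b -> rderiv G x (g x)) ->
  (forall x, a <= x <= b -> cmod (g x) <= M) -> cmod (G b - G a) <= 2 * M * (b - a).
Proof.
move=> ab hd hM; rewrite (le_trans (cmod_le_reim _)) // reB imB.
have -> : 2 * M * (b - a) = M * (b - a) + M * (b - a) by ring.
apply: lerD; [apply: (@mean_value_ineq (fun t => re (G t)) (fun t => re (g t)))|
  apply: (@mean_value_ineq (fun t => im (G t)) (fun t => im (g t)))] => // x xab.
- by case: (hd x xab).
- exact: le_trans (re_le_cmod _) (hM _ xab).
- by case: (hd x xab).
- exact: le_trans (im_le_cmod _) (hM _ xab).
Qed.

Lemma primitive (f : R -> R) (a b : R) : a <= b ->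
  (forall x, a <= x <= b -> {for x, continuous f}) ->
  exists F : R -> R, forall x, a <= x <= b -> is_derive x 1 F (f x).
Proof.
(* Composing with the projection onto [a, b] makes f continuous on the whole line, and integrating
   from a - 1 makes every point of [a, b] interior, so the derivative is two-sided at the end points
   too. *)
move=> ab cf; pose k t := Num.max a (Num.min b t).
have kab t : a <= k t <= b.
  by rewrite /k le_max lexx /= ge_max ab /= ge_min lexx.
have kid t : a <= t <= b -> k t = t.
  by move=> /andP[h1 h2]; rewrite /k (min_idPr h2) (max_idPr h1).
have kc : continuous k.
  move=> x; apply: continuous_max; first exact: cst_continuous.
  by apply: continuous_min; [exact: cst_continuous|exact: cvg_id].
have fkc : continuous (f \o k).
  by move=> x; apply: continuous_comp; [exact: kc|exact: cf].
exists (fun x => \int[lebesgue_measure]_(t in [set` Interval (BLeft (a - 1)) (BRight x)]) (f \o k) t) => x xab.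
have [||||d1 d2] := @continuous_FTC1 R (f \o k) (BLeft (a - 1)) x (b + 1).
- by case/andP: xab => _ xb; rewrite ltr_pwDr.
- apply: continuous_compact_integrable; first exact: segment_compact.
  exact: continuous_subspaceT.
- rewrite /= lte_fin; case/andP: xab => ax _; lra.
- exact: fkc.
by split => //; rewrite -derive1E d2 /= kid.
Qed.

Definition rcont g (x : R) := forall e : R, 0 < e -> exists2 d : R, 0 < d &
  forall t, `|t - x| < d -> cmod (g t - g x) < e.

Lemma rderiv_primitive g (a b : R) : a <= b ->
  (forall x, a <= x <= b -> rcont g x) ->
  exists G, forall x, a <= x <= b -> rderiv G x (g x).
Proof.
move=> ab cg.
have [|F HF] := @primitive (fun t => re (g t)) a b ab.
  move=> x xab; apply/cvgrPdist_lt => e e0; have [d d0 H] := cg x xab e e0.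
  apply/nbhs_ballP; exists d => //= t; rewrite /ball /= distrC => /H.
  by apply: le_lt_trans; rewrite distrC -reB re_le_cmod.
have [|F' HF'] := @primitive (fun t => im (g t)) a b ab.
  move=> x xab; apply/cvgrPdist_lt => e e0; have [d d0 H] := cg x xab e e0.
  apply/nbhs_ballP; exists d => //= t; rewrite /ball /= distrC => /H.
  by apply: le_lt_trans; rewrite distrC -imB im_le_cmod.
by exists (fun t => Complex (F t) (F' t)) => x xab; split => /=; [exact: HF|exact: HF'].
Qed.

Lemma cder_rcont f z v l x : cder f (z + v * x%:C) l ->
  rcont (fun t => f (z + v * t%:C)) x.
Proof.
move=> /cder_lip[d d0 H] e e0.
have v1 : 0 < cmod v + 1 by rewrite ltr_wpDl ?cmod_ge0.
have l1 : 0 < cmod l + 1 by rewrite ltr_wpDl ?cmod_ge0.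
exists (Num.min (d / (cmod v + 1)) (e / (cmod l + 1) / (cmod v + 1))) => [|t].
  by rewrite lt_min !divr_gt0.
rewrite lt_min => /andP[]; rewrite !ltr_pdivlMr // => h1 h2.
have vt : cmod (v * (t - x)%:C) <= `|t - x| * (cmod v + 1).
  by rewrite cmodM cmod_real mulrC ler_wpM2l // lerDl.
have := H _ (le_lt_trans vt h1).
have -> : z + v * x%:C + v * (t - x)%:C = z + v * t%:C by rewrite rmorphB; ring.
move=> /le_lt_trans; apply; rewrite mulrC (le_lt_trans _ h2) // ler_wpM2r // ltW //.
Qed.

Lemma rderiv_h f (x y : R) l : cder f (Complex x y) l ->
  rderiv (fun t => f (Complex t y)) x l.
Proof.
have E t : Complex t y = Complex 0 y + 1 * t%:C by apply: complex_ext => /=; ring.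
rewrite E => /rderiv_line; rewrite mul1r.
by under [in X in X -> _]eq_fun do rewrite -E.
Qed.

Lemma rderiv_v f (x y : R) l : cder f (Complex x y) l ->
  rderiv (fun t => f (Complex x t)) y ('i%C * l).
Proof.
have E t : Complex x t = x%:C + 'i%C * t%:C by apply: complex_ext => /=; ring.
rewrite E => /rderiv_line.
by under [in X in X -> _]eq_fun do rewrite -E.
Qed.

Lemma rcont_h f (x y : R) l : cder f (Complex x y) l ->
  rcont (fun t => f (Complex t y)) x.
Proof.
have E t : Complex t y = Complex 0 y + 1 * t%:C by apply: complex_ext => /=; ring.
rewrite E => /cder_rcont.
by under [in X in X -> _]eq_fun do rewrite -E.
Qed.

Lemma rcont_v f (x y : R) l : cder f (Complex x y) l ->
  rcont (fun t => f (Complex x t)) y.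
Proof.
have E t : Complex x t = x%:C + 'i%C * t%:C by apply: complex_ext => /=; ring.
rewrite E => /cder_rcont.
by under [in X in X -> _]eq_fun do rewrite -E.
Qed.

Lemma nested_itv (a b : nat -> R) : (forall n, a n <= a n.+1) ->
  (forall n, b n.+1 <= b n) -> (forall n, a n <= b n) ->
  exists x, forall n, a n <= x <= b n.
Proof.
move=> ha hb hab.
have ia m n : (m <= n)%N -> a m <= a n by move=> /subnK <-; elim: (n - m)%N => [|k IH] //; rewrite addSn (le_trans IH).
have ib m n : (m <= n)%N -> b n <= b m by move=> /subnK <-; elim: (n - m)%N => [|k IH] //; rewrite addSn (le_trans _ IH).
have ab m n : a m <= b n.
  by rewrite (le_trans (ia _ _ (leq_maxl m n))) // (le_trans (hab _)) // ib // leq_maxr.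
exists (sup (range a)) => n; apply/andP; split.
  apply: ub_le_sup; last by exists n.
  by exists (b 0%N) => _ [m _ <-].
apply: ge_sup; first by exists (a 0%N), 0%N.
by move=> _ [m _ <-].
Qed.
End RealVariable.

(** * Goursat's theorem for rectangles *)

Section Goursat.
Variables (R : realType) (f : R[i] -> R[i]) (H V : R -> R -> R[i]).

(** The integral of f around the rectangle [a, b] x [c, d], expressed by primitives [H y] along
    horizontal and [V x] along vertical lines. No integral occurs, so additivity under subdivision
    is a ring identity. *)
Let Phi a b c d := H c b - H c a + 'i%C * (V b d - V b c)
  - (H d b - H d a) - 'i%C * (V a d - V a c).

Variables (x0 x1 y0 y1 : R).
Hypotheses (x01 : x0 <= x1) (y01 : y0 <= y1).
Hypothesis df : forall x y, x0 <= x <= x1 -> y0 <= y <= y1 ->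
  exists l, cder f (Complex x y) l.
Hypothesis dH : forall x y, x0 <= x <= x1 -> y0 <= y <= y1 ->
  rderiv (H y) x (f (Complex x y)).
Hypothesis dV : forall x y, x0 <= x <= x1 -> y0 <= y <= y1 ->
  rderiv (V x) y (f (Complex x y)).

(** Near u + i v the function f differs by at most e s from an affine function, s being the sum of
    the two sides. The affine function has the primitive P, so its boundary integral is 0; the four
    sides of the difference contribute 2 (e s) times their lengths. *)
Lemma goursat_local (u v : R) : x0 <= u <= x1 -> y0 <= v <= y1 ->
  forall e, 0 < e -> exists2 dl : R, 0 < dl & forall a b c d,
    x0 <= a -> a <= u <= b -> b <= x1 -> y0 <= c -> c <= v <= d -> d <= y1 ->
    (b - a) + (d - c) < dl ->
    cmod (Phi a b c d) <= 4 * e * ((b - a) + (d - c)) ^+ 2.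
Proof.
move=> hu hv e e0; have [l hl] := df hu hv; have [dl dl0 {}hl] := hl e e0.
exists dl => // a b c d xa /andP[au ub] bx yc /andP[cv vd] dy small.
set s := b - a + (d - c).
pose z0 := Complex u v.
pose g z := f z0 + l * (z - z0).
pose P z := f z0 * z + l * ((z - z0) * (z - z0) * 2^-1).
have dP z : cder P z (g z).
  have := cderD (cderM (cder_cst (f z0) z) (cder_id z))
    (cderM (cder_cst l z) (cderM (cderM (cderB (cder_id z) (cder_cst z0 z))
      (cderB (cder_id z) (cder_cst z0 z))) (cder_cst (2^-1) z))).
  by set q := (X in cder _ _ X -> _); have -> : q = g z by rewrite /q /g; field.
have fg x y : a <= x <= b -> c <= y <= d -> cmod (f (Complex x y) - g (Complex x y)) <= e * s.
  move=> /andP[ax xb] /andP[cy yd].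
  have hs : cmod (Complex x y - z0) <= s.
    by rewrite (le_trans (cmod_le_reim _)) // /s reB imB /=; apply: lerD; rewrite ler_norml;
      apply/andP; split; lra.
  have := hl _ (le_lt_trans hs small).
  rewrite (_ : z0 + (Complex x y - z0) = Complex x y); last by ring.
  rewrite (_ : f (Complex x y) - f z0 - _ = f (Complex x y) - g (Complex x y)); last by rewrite /g; ring.
  move=> /le_trans; apply; apply: ler_wpM2l => //; exact: ltW.
have ab : a <= b by lra.
have cd : c <= d by lra.
have hH y : c <= y <= d -> cmod (H y b - H y a - (P (Complex b y) - P (Complex a y))) <= 2 * (e * s) * (b - a).
  move=> hy; rewrite (_ : _ - _ = (H y b - P (Complex b y)) - (H y a - P (Complex a y))); last by ring.
  apply: (@rderiv_mean_value R (fun t => H y t - P (Complex t y))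
    (fun t => f (Complex t y) - g (Complex t y))) => // x hx.
    apply: rderivB; last by apply: rderiv_h; exact: dP.
    by apply: dH; move: hx hy => /andP[? ?] /andP[? ?]; apply/andP; split; lra.
  exact: fg.
have hV x : a <= x <= b -> cmod ('i%C * (V x d - V x c) - (P (Complex x d) - P (Complex x c))) <= 2 * (e * s) * (d - c).
  move=> hx; rewrite (_ : _ - _ = 'i%C * ((V x d - (- 'i%C) * P (Complex x d)) - (V x c - (- 'i%C) * P (Complex x c)))); last first.
    have : ('i%C : R[i]) ^+ 2 = -1 := sqr_i R; move: ('i%C) => j j2.
    have -> : - (P (Complex x d) - P (Complex x c)) = j ^+ 2 * (P (Complex x d) - P (Complex x c)).
      by rewrite j2 mulN1r.
    by ring.
  rewrite cmodM cmod_i mul1r.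
  apply: (@rderiv_mean_value R (fun t => V x t - (- 'i%C) * P (Complex x t))
    (fun t => f (Complex x t) - g (Complex x t))) => // y hy.
    apply: rderivB; first by apply: dV; move: hx hy => /andP[? ?] /andP[? ?]; apply/andP; split; lra.
    have := rderiv_v (cderM (cder_cst (- 'i%C) _) (dP (Complex x y))).
    rewrite mulr0 addr0 mulrA mulrN -expr2 sqr_i opprK mul1r; exact.
  exact: fg.
have -> : Phi a b c d =
  (H c b - H c a - (P (Complex b c) - P (Complex a c)))
  + ('i%C * (V b d - V b c) - (P (Complex b d) - P (Complex b c)))
  - (H d b - H d a - (P (Complex b d) - P (Complex a d)))
  - ('i%C * (V a d - V a c) - (P (Complex a d) - P (Complex a c))).
  by rewrite /Phi; ring.
rewrite (le_trans (cmodB _ _)) // (_ : 4 * e * s ^+ 2 = 2 * (e * s) * (b - a) +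
  2 * (e * s) * (d - c) + 2 * (e * s) * (b - a) + 2 * (e * s) * (d - c)); last by rewrite /s; ring.
rewrite lerD ?hV ?lexx ?ab // (le_trans (cmodB _ _)) // lerD ?hH ?lexx ?cd //.
by rewrite (le_trans (cmodD _ _)) // lerD ?hV ?hH ?lexx ?ab ?cd.
Qed.

Let X n := (x1 - x0) / 2 ^+ n.
Let Y n := (y1 - y0) / 2 ^+ n.
Let F n (p : R * R) := cmod (Phi p.1 (p.1 + X n) p.2 (p.2 + Y n)).
Let quad n (p : R * R) (i j : bool) :=
  (p.1 + (if i then X n.+1 else 0), p.2 + (if j then Y n.+1 else 0)).
(** Picks a quadrant that carries at least a quarter of the boundary integral. The last branch needs
    no test: if all four failed, [Phi_split] would be violated. *)
Let step n p := let good i j := F n p <= 4 * F n.+1 (quad n p i j) in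
  if good false false then quad n p false false
  else if good false true then quad n p false true
  else if good true false then quad n p true false else quad n p true true.

Let XS n : X n = X n.+1 + X n.+1.
Proof. by rewrite /X exprS; field; rewrite expf_neq0. Qed.
Let YS n : Y n = Y n.+1 + Y n.+1.
Proof. by rewrite /Y exprS; field; rewrite expf_neq0. Qed.

Let Phi_split n p : F n p <= F n.+1 (quad n p false false) + F n.+1 (quad n p false true)
  + F n.+1 (quad n p true false) + F n.+1 (quad n p true true).
Proof.
rewrite /F /quad /= !addr0; case: p => a c /=; set x := a + X n.+1; set y := c + Y n.+1.
have -> : a + X n = x + X n.+1 by rewrite XS addrA.
have -> : c + Y n = y + Y n.+1 by rewrite YS addrA.
move: (x + _) (y + _) => b d.
have -> : Phi a b c d = Phi a x c y + Phi a x y d + Phi x b c y + Phi x b y d.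
  by rewrite /Phi; ring.
by do 2!(rewrite (le_trans (cmodD _ _)) // lerD2r); exact: cmodD.
Qed.

Let step_good n p : F n p <= 4 * F n.+1 (step n p).
Proof.
rewrite /step; case: ifP => // h1; case: ifP => // h2; case: ifP => // h3.
rewrite leNgt; apply/negP => h4; have := Phi_split n p.
move/negbT: h1; move/negbT: h2; move/negbT: h3; rewrite -!ltNge => *; lra.
Qed.

Let p := fix p n := if n is m.+1 then step m (p m) else (x0, y0).

Let stepE n q : exists i j, step n q = quad n q i j.
Proof.
by rewrite /step; case: ifP => _; [|case: ifP => _; [|case: ifP => _]];
  do 2 eexists; reflexivity.
Qed.

Let X0 n : 0 <= X n. Proof. by rewrite /X divr_ge0 ?subr_ge0 ?exprn_ge0. Qed.
Let Y0 n : 0 <= Y n. Proof. by rewrite /Y divr_ge0 ?subr_ge0 ?exprn_ge0. Qed.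

Let p_mono n : [/\ (p n).1 <= (p n.+1).1, (p n.+1).1 + X n.+1 <= (p n).1 + X n,
  (p n).2 <= (p n.+1).2 & (p n.+1).2 + Y n.+1 <= (p n).2 + Y n].
Proof.
rewrite /=; have [i [j ->]] := stepE n (p n); rewrite /quad /= (XS n) (YS n).
have := X0 n.+1; have := Y0 n.+1.
by case: i; case: j => ? ?; split; lra.
Qed.

Let F0 n : F 0 (p 0%N) <= 4 ^+ n * F n (p n).
Proof.
elim: n => [|n IH]; first by rewrite expr0 mul1r.
by rewrite (le_trans IH) // exprSr -mulrA ler_wpM2l ?exprn_ge0 //; exact: step_good.
Qed.

Theorem goursat : Phi x0 x1 y0 y1 = 0.
Proof.
have [u hu] : exists u, forall n, (p n).1 <= u <= (p n).1 + X n.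
  by apply: nested_itv => n; [case: (p_mono n)|case: (p_mono n)|rewrite lerDl].
have [v hv] : exists v, forall n, (p n).2 <= v <= (p n).2 + Y n.
  by apply: nested_itv => n; [case: (p_mono n)|case: (p_mono n)|rewrite lerDl].
have XE : x0 + X 0 = x1 by rewrite /X expr0 divr1 addrC subrK.
have YE : y0 + Y 0 = y1 by rewrite /Y expr0 divr1 addrC subrK.
have bnd n : [/\ x0 <= (p n).1, (p n).1 + X n <= x1, y0 <= (p n).2 & (p n).2 + Y n <= y1].
  elim: n => [|n [h1 h2 h3 h4]]; first by rewrite XE YE.
  by case: (p_mono n) => h5 h6 h7 h8; split; lra.
apply/eqP; rewrite -cmod_eq0 eq_le cmod_ge0 andbT.
set S := (x1 - x0) + (y1 - y0).
have S0 : 0 <= S by rewrite addr_ge0 ?subr_ge0.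
apply/ler_addgt0Pr => e e0; rewrite add0r.
(* The growth 4^n of [F0] is balanced by the squared size S^2 / 4^n of the n-th rectangle, so this
   tolerance yields e (S / (S + 1))^2. The summand 1 covers a rectangle reduced to a point. *)
have k0 : 0 < e / (4 * (S + 1) ^+ 2) by rewrite divr_gt0 ?mulr_gt0 ?exprn_gt0 // ltr_wpDl.
have [||dl dl0 K] := goursat_local (u := u) (v := v) _ _ k0.
- by have := hu 0%N; rewrite XE.
- by have := hv 0%N; rewrite YE.
have [n nS] : exists n, S / 2 ^+ n < dl.
  have [n hn] : exists n : nat, S / dl < n%:R.
    by exists (Num.bound (S / dl)); apply: archi_boundP; rewrite divr_ge0 // ltW.
  exists n; rewrite ltr_pdivrMr ?exprn_gt0 // mulrC -ltr_pdivrMr // (lt_le_trans hn) //.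
  by rewrite -natrX ler_nat ltnW // ltn_expl.
have {K} := K (p n).1 ((p n).1 + X n) (p n).2 ((p n).2 + Y n).
have -> : (p n).1 + X n - (p n).1 + ((p n).2 + Y n - (p n).2) = S / 2 ^+ n.
  by rewrite /X /Y /S mulrDl; ring.
have [b1 b2 b3 b4] := bnd n.
move=> /(_ b1 (hu n) b2 b3 (hv n) b4 nS) K.
have := F0 n; rewrite {1}/F /= XE YE => /le_trans; apply.
rewrite (le_trans (ler_wpM2l _ K)) ?exprn_ge0 //.
have -> : 4 ^+ n * (4 * (e / (4 * (S + 1) ^+ 2)) * (S / 2 ^+ n) ^+ 2) = e * (S / (S + 1)) ^+ 2.
  rewrite (_ : 4 ^+ n = 2 ^+ n ^+ 2 :> R); last by rewrite -exprM mulnC exprM expr2 -natrM.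
  by field; rewrite expf_neq0 //= gt_eqF // ltr_wpDl.
apply: ler_piMr; first exact: ltW.
apply: exprn_ile1; first exact: divr_ge0 S0 (addr_ge0 S0 ler01).
by rewrite ler_pdivrMr ?ltr_wpDl // mul1r lerDl.
Qed.
End Goursat.

(** * The complex exponential *)

Section ComplexExp.
Variable R : realType.
Implicit Types (z w : R[i]).

Definition cexp z : R[i] := (expR (re z))%:C * Complex (cos (im z)) (sin (im z)).

Lemma cexpD z w : cexp (z + w) = cexp z * cexp w.
Proof.
rewrite /cexp reD imD expRD cosD sinD.
by apply: complex_ext => /=; ring.
Qed.

Lemma cexp0 : cexp 0 = 1.
Proof. by rewrite /cexp /= expR0 cos0 sin0 mul1r. Qed.

Lemma cmod_cexp z : cmod (cexp z) = expR (re z).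
Proof.
rewrite /cexp cmodM cmod_real ger0_norm ?expR_ge0 //.
by rewrite /= cos2Dsin2 sqrtr1 mulr1.
Qed.

Lemma cexp_neq0 z : cexp z != 0.
Proof. by rewrite -cmod_gt0 cmod_cexp expR_gt0. Qed.

Lemma cexpMn z n : cexp (n%:R * z) = cexp z ^+ n.
Proof.
elim: n => [|n IH]; first by rewrite mul0r cexp0.
by rewrite -natr1 mulrDl mul1r cexpD IH exprSr.
Qed.

Lemma cexp_real (x : R) : cexp x%:C = (expR x)%:C.
Proof. by rewrite /cexp /= cos0 sin0 mulr1. Qed.

Lemma cexp_i (t : R) : cexp ('i%C * t%:C) = Complex (cos t) (sin t).
Proof.
have -> : 'i%C * t%:C = Complex 0 t :> R[i] by apply: complex_ext => /=; ring.
by rewrite /cexp /= expR0 mul1r.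
Qed.

Lemma cder_cexp0 : cder cexp 0 1.
Proof.
move=> e e0.
have d1 := (iffLR (is_deriveP (@expR R) 0 1)) (is_derive_eq (is_derive_expR 0) (expR0 _)).
have d2 := (iffLR (is_deriveP (@cos R) 0 0)) (is_derive_eq (is_derive_cos 0) (etrans (congr1 _ (sin0 _)) (oppr0 _))).
have d3 := (iffLR (is_deriveP (@sin R) 0 1)) (is_derive_eq (is_derive_sin 0) (cos0 _)).
(* The two components of the error are bounded by four products, in total at most 6 q [cmod h], so e
   / 10 leaves room. *)
pose q := Num.min 1 (e / 10).
have q0 : 0 < q by rewrite lt_min ltr01 divr_gt0.
have q1 : q <= 1 by rewrite ge_min lexx.
have qe : 10 * q <= e by rewrite mulrC -ler_pdivlMr // ge_min lexx orbT.
have [a1 a10 A1] := d1 q q0; have [a2 a20 A2] := d2 q q0; have [a3 a30 A3] := d3 q q0.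
exists (Num.min (q / 2) (Num.min a1 (Num.min a2 a3))).
  by rewrite !lt_min a10 a20 a30 divr_gt0.
move=> h; rewrite !lt_min => /andP[h1 /andP[h2 /andP[h3 h4]]].
have ra := re_le_cmod h; have ia := im_le_cmod h.
have {}A1 := A1 (re h) (le_lt_trans ra h2).
have {}A2 := A2 (im h) (le_lt_trans ia h3).
have {}A3 := A3 (im h) (le_lt_trans ia h4).
rewrite add0r expR0 mul1r in A1; rewrite add0r cos0 mul0r subr0 in A2.
rewrite add0r sin0 mul1r subr0 in A3.
have -> : cexp (0 + h) - cexp 0 - 1 * h =
  Complex (expR (re h) * (cos (im h) - 1) + (expR (re h) - 1 - re h))
    (expR (re h) * (sin (im h) - im h) + (expR (re h) - 1) * im h).
  by rewrite add0r cexp0 mul1r /cexp; case: h {h1 h2 h3 h4 ra ia A1 A2 A3} => a b;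
    apply: complex_ext => /=; ring.
rewrite (le_trans (cmod_le_reim _)) //=.
set m := cmod h in h1 ra ia *; have m0 : 0 <= m by rewrite cmod_ge0.
move: (re h) (im h) ra ia A1 A2 A3 => a b ra ia A1 A2 A3.
set E := expR a in A1; set C := cos b in A2; set S := sin b in A3.
have B1 : `|E - 1 - a| <= q * m by rewrite (le_trans A1) // ler_wpM2l // ltW.
have B2 : `|C - 1| <= q * m by rewrite (le_trans A2) // ler_wpM2l // ltW.
have B3 : `|S - b| <= q * m by rewrite (le_trans A3) // ler_wpM2l // ltW.
have m1 : m <= 1 by rewrite (le_trans (ltW h1)) // ler_pdivrMr //; lra.
have qm : q * m <= m by rewrite ler_piMl.
have E1 : `|E - 1| <= q.
  rewrite (_ : E - 1 = (E - 1 - a) + a); last by ring.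
  rewrite (le_trans (ler_normD _ _)) //.
  have : m < q / 2 by []. lra.
have E2 : `|E| <= 2.
  rewrite (_ : E = (E - 1) + 1); last by ring.
  rewrite (le_trans (ler_normD _ _)) // normr1; lra.
  have e1 := ler_normD (E * (C - 1)) (E - 1 - a).
  have e2 := ler_normD (E * (S - b)) ((E - 1) * b).
  rewrite !normrM in e1 e2.
  have e3 : `|E| * `|C - 1| <= 2 * (q * m) by apply: ler_pM.
  have e4 : `|E| * `|S - b| <= 2 * (q * m) by apply: ler_pM.
  have e5 : `|E - 1| * `|b| <= q * m by apply: ler_pM.
  have e6 : 10 * (q * m) <= e * m by rewrite mulrA ler_wpM2r.
  have e7 : 0 <= q * m by rewrite mulr_ge0 // ltW.
  lra.
Qed.

Lemma cder_cexp z : cder cexp z (cexp z).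
Proof.
have := cder_comp (cderB (cder_id z) (cder_cst z z)) (_ : cder cexp (z - z) 1).
rewrite subrr => /(_ cder_cexp0) h.
have := cderM (cder_cst (cexp z) z) h; rewrite mulr0 addr0 mul1r subr0 mulr1.
congr (cder _ _ _); apply/funext => w; rewrite -cexpD; congr cexp; ring.
Qed.

Lemma cexp_2pi z : cexp (z + Complex 0 (pi *+ 2)) = cexp z.
Proof. by rewrite cexpD {2}/cexp /= expR0 cos2pi sin2pi mulr1 mulr1. Qed.

Lemma natcpowE n (s : CC R) : (0 < n)%N -> natcpow n s = cexp (s * (ln n%:R)%:C).
Proof.
move=> n0; rewrite /natcpow /cexp /powR ifF; last by rewrite pnatr_eq0; case: n n0.
by case: s => a b /=; rewrite !mulr0 subr0 add0r.
Qed.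
End ComplexExp.

(** * Maximum principle, Cauchy's estimate, uniform limits and the identity theorem *)

Section CircleMax.
Variables (R : realType) (f : R[i] -> R[i]) (c : R[i]) (r B : R).
Hypothesis r0 : 0 < r.
Hypothesis df : forall z, 0 < cmod (z - c) <= r -> exists l, cder f z l.
Hypothesis cf : forall e, 0 < e -> exists2 d : R, 0 < d &
  forall z, cmod (z - c) < d -> cmod (f z - f c) < e.
Hypothesis fB : forall z, cmod (z - c) = r -> cmod (f z) <= B.

Let k u := f (c + r%:C * cexp u).

Let cmod_k u : cmod (c + r%:C * cexp u - c) = r * expR (re u).
Proof. by rewrite addrC addKr cmodM cmod_cexp cmod_real ger0_norm // ltW. Qed.

Let dk u : re u <= 0 -> exists l, cder k u l.
Proof.
move=> hu; have [|l hl] := @df (c + r%:C * cexp u).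
  rewrite cmod_k mulr_gt0 ?expR_gt0 //= ler_piMr //; first exact: ltW.
  by rewrite -[leRHS]expR0 ler_expR.
have := cder_comp (cderD (cder_cst c u) (cderM (cder_cst r%:C u) (cder_cexp u))) hl.
by move=> h; eexists; exact: h.
Qed.

Let p2 : R := pi *+ 2.
Let p20 : 0 <= p2. Proof. by rewrite mulrn_wge0 // pi_ge0. Qed.

(** In the coordinate z = c + r exp u the punctured disc becomes the half-plane Re u <= 0 and [k]
    has period 2 pi i. In Goursat's theorem on [X, 0] x [0, 2 pi] the horizontal sides cancel, so
    the integral over the vertical side does not depend on X; for X towards -oo it approaches 2 pi
    f(c). Asking only for continuity at c admits difference quotients as f. *)
Lemma circle_max : cmod (f c) <= 2 * B.
Proof.
have /choice[V HV] : forall x : R, exists G : R -> R[i], x <= 0 ->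
    forall y, 0 <= y <= p2 -> rderiv G y (k (Complex x y)).
  move=> x; have [x0|x0] := leP x 0; last first.
    by exists (fun=> 0).
  have [|G HG] := @rderiv_primitive R (fun t => k (Complex x t)) 0 p2 p20.
    by move=> y _; have [|l hl] := @dk (Complex x y); [|exact: rcont_v hl].
  by exists G.
have inv X : X <= 0 -> V 0 p2 - V 0 0 = V X p2 - V X 0.
  move=> X0.
  have /choice[H HH] : forall y : R, exists G : R -> R[i],
      forall x, X <= x <= 0 -> rderiv G x (k (Complex x y)).
    move=> y; apply: (@rderiv_primitive R (fun t => k (Complex t y))) => // x /andP[_ x0].
    by have [|l hl] := @dk (Complex x y); [|exact: rcont_h hl].
  have := @goursat R k H V X 0 0 p2 X0 p20.
  have -> : H p2 0 - H p2 X = H 0 0 - H 0 X.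
    apply/eqP; rewrite -subr_eq0 -cmod_eq0 eq_le cmod_ge0 andbT.
    have -> : H p2 0 - H p2 X - (H 0 0 - H 0 X) = (H p2 0 - H 0 0) - (H p2 X - H 0 X) by ring.
    rewrite (le_trans (@rderiv_mean_value R (fun t => H p2 t - H 0 t) (fun=> 0) X 0 0 X0 _ _)) ?mulr0 ?mul0r //.
      move=> x hx; have := rderivB (HH p2 x hx) (HH 0 x hx).
      suff -> : k (Complex x p2) = k (Complex x 0) by rewrite subrr.
      rewrite /k -(cexp_2pi (Complex x 0)); congr (f (c + _ * cexp _)).
      by apply: complex_ext; rewrite /= ?addr0 ?add0r.
    by move=> x _; rewrite cmod0.
  move=> h; have {}h : 'i%C * (V 0 p2 - V 0 0) - 'i%C * (V X p2 - V X 0) = 0.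
    rewrite -[RHS]h; first by ring.
    - by move=> x y /andP[_ x0] _; exact: dk.
    - by move=> x y hx _; exact: HH.
    - by move=> x y /andP[_ x0] hy; exact: HV.
  apply/eqP; rewrite -subr_eq0; move/eqP: h; rewrite -mulrBr mulf_eq0 => /orP[|//].
  by rewrite -cmod_eq0 cmod_i oner_eq0.
have mean : V 0 p2 - V 0 0 = p2%:C * f c.
  apply/eqP; rewrite -subr_eq0 -cmod_eq0 eq_le cmod_ge0 andbT.
  apply/ler_addgt0Pr => e e0; rewrite add0r.
  have p21 : 0 < 2 * (p2 + 1) by rewrite mulr_gt0 // ltr_wpDl.
  have [|d d0 hd] := cf (e := e / (2 * (p2 + 1))); first by rewrite divr_gt0.
  (* Then r exp X <= d / 2, so the small circle lies where f is close to f(c). *)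
  pose X := Num.min 0 (ln (d / (2 * r))).
  have X0 : X <= 0 by rewrite ge_min lexx.
  rewrite (inv X X0).
  have -> : V X p2 - V X 0 - p2%:C * f c = (V X p2 - f c * p2%:C) - (V X 0 - f c * 0%:C) by ring.
  rewrite (le_trans (@rderiv_mean_value R (fun t => V X t - f c * t%:C)
    (fun t => k (Complex X t) - f c) 0 p2 (e / (2 * (p2 + 1))) p20 _ _)) //.
  - move=> y hy; apply: rderivB; first exact: HV.
    have := @rderiv_line R id 0 (f c) 1 y (cder_id _); rewrite mulr1.
    by congr rderiv; apply/funext => t; rewrite add0r.
  - move=> y hy; apply: ltW; apply: hd; rewrite cmod_k /=.
    rewrite (@le_lt_trans _ _ (r * (d / (2 * r)))) //.
      apply: ler_wpM2l; first exact: ltW.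
      rewrite -[leRHS]lnK ?posrE ?divr_gt0 ?mulr_gt0 //.
      by rewrite ler_expR ge_min lexx orbT.
    by rewrite (_ : r * _ = d / 2); [move: d0; lra | by field; rewrite gt_eqF].
  rewrite (_ : 2 * _ * _ = e * (p2 / (p2 + 1))); last first.
    have : p2 + 1 != 0 by rewrite gt_eqF // ltr_wpDl.
    by move: (p2) => q qn; field.
  apply: ler_piMr; first exact: ltW.
  by rewrite ler_pdivrMr ?ltr_wpDl // mul1r lerDl.
have := @rderiv_mean_value R (V 0) (fun t => k (Complex 0 t)) 0 p2 B p20 (HV 0 (lexx _)).
rewrite mean cmodM cmod_real ger0_norm // subr0 mulrC => h.
have pp : 0 < p2 by rewrite mulrn_wgt0 ?pi_gt0.
rewrite -(ler_pM2r pp) h // => y _; apply: fB.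
by rewrite cmod_k /= expR0 mulr1.
Qed.
End CircleMax.

Section Consequences.
Variable R : realType.
Implicit Types (f : R[i] -> R[i]) (z w l c : R[i]).

Lemma cmod_dist z w : `|cmod z - cmod w| <= cmod (w - z).
Proof.
have h1 := cmodB_ge z w; have h2 := cmodB_ge w z; rewrite cmodBC in h1.
by rewrite ler_norml; apply/andP; split; lra.
Qed.

Lemma cder_continuous f z l : cder f z l -> forall e, 0 < e ->
  exists2 d : R, 0 < d & forall w, cmod (w - z) < d -> cmod (f w - f z) < e.
Proof.
move=> /cder_lip[d d0 H] e e0; have l1 : 0 < cmod l + 1 by rewrite ltr_wpDl ?cmod_ge0.
exists (Num.min d (e / (cmod l + 1))) => [|w]; first by rewrite lt_min d0 divr_gt0.
rewrite lt_min => /andP[/H]; rewrite subrKC => h1; rewrite ltr_pdivlMr // => h2.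
by rewrite (le_lt_trans h1) // mulrC.
Qed.

(** [circle_max] for the difference quotient at c, completed by the derivative l: on the circle it
    is at most 2 B / r. *)
Lemma cauchy_deriv f c (r B : R) l : 0 < r ->
  (forall z, cmod (z - c) <= r -> exists l, cder f z l) ->
  (forall z, cmod (z - c) <= r -> cmod (f z) <= B) ->
  cder f c l -> cmod l <= 4 * B / r.
Proof.
move=> r0 df fB dc.
pose k z := if z == c then l else (f z - f c) / (z - c).
have kc : k c = l by rewrite /k eqxx.
rewrite (_ : 4 * B / r = 2 * (2 * B / r)); last by field; rewrite gt_eqF.
rewrite -{1}kc; apply: (@circle_max R k c r) => //.
- move=> z /andP[z0 zr]; have [lz hlz] := df z zr.
  have zc : z - c != 0 by rewrite -cmod_gt0.
  have h := cderM (cderB hlz (cder_cst (f c) z))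
    (cder_comp (cderB (cder_id z) (cder_cst c z)) (cder_inv zc)).
  eexists; apply: cder_near z0 _ h => w hw; rewrite /k ifF //.
  by apply/negP => /eqP wc; move: hw; rewrite wc cmodBC ltxx.
- move=> e e0; have [|d d0 H] := dc (e / 2); first by rewrite divr_gt0.
  exists d => // z zd; rewrite kc /k; case: eqP => [_|/eqP zc].
    by rewrite subrr cmod0.
  have zc0 : 0 < cmod (z - c) by rewrite cmod_gt0 subr_eq0.
  rewrite -(ltr_pM2r zc0) -cmodM mulrBl divfK ?subr_eq0 //.
  have := H _ zd; rewrite subrKC => /le_lt_trans; apply.
  by rewrite ltr_pM2r // ltr_pdivrMr // ltr_pMr // ltr1n.
- move=> z zr; rewrite /k ifF.
    rewrite cmodM cmodV zr ler_wpM2r ?invr_ge0 ?(ltW r0) //.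
    rewrite (le_trans (cmodB _ _)) // mulr_natl mulr2n lerD //; apply: fB.
      by rewrite zr.
    by rewrite subrr cmod0 ltW.
  by apply/negP => /eqP zc; move: zr r0; rewrite zc subrr cmod0 => <-; rewrite ltxx.
Qed.

Lemma holo_lipschitz f c (r B : R) h : 0 < r ->
  (forall z, cmod (z - c) <= 2 * r -> exists l, cder f z l) ->
  (forall z, cmod (z - c) <= 2 * r -> cmod (f z) <= B) ->
  cmod h <= r -> cmod (f (c + h) - f c) <= 8 * B / r * cmod h.
Proof.
move=> r0 df fB hr.
have /choice[df' H'] z : exists l, cmod (z - c) <= 2 * r -> cder f z l.
  have [hz|_] := leP (cmod (z - c)) (2 * r); last by exists 0.
  by have [l hl] := df z hz; exists l.
have cl (t : R) : 0 <= t <= 1 -> cmod (c + h * t%:C - c) <= r.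
  move=> /andP[t0 t1]; rewrite addrC addKr cmodM cmod_real ger0_norm //.
  by rewrite (le_trans _ hr) // ler_piMr ?cmod_ge0.
have {1}-> : h = h * 1%:C by rewrite mulr1.
have {2}-> : c = c + h * 0%:C by rewrite mulr0 addr0.
have -> : 8 * B / r * cmod h = 2 * (4 * B / r * cmod h) * (1 - 0) by field; rewrite gt_eqF.
apply: (@rderiv_mean_value R (fun t => f (c + h * t%:C)) (fun t => h * df' (c + h * t%:C))) => // t ht.
  by apply: rderiv_line; apply: H'; have := cl t ht; move: r0; lra.
rewrite cmodM mulrC ler_wpM2r ?cmod_ge0 //.
apply: (@cauchy_deriv f (c + h * t%:C)) => // [z hz|z hz|].
- apply: df; rewrite (_ : z - c = (z - (c + h * t%:C)) + (c + h * t%:C - c)); last by ring.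
  by rewrite (le_trans (cmodD _ _)) // mulr_natl mulr2n lerD // cl.
- apply: fB; rewrite (_ : z - c = (z - (c + h * t%:C)) + (c + h * t%:C - c)); last by ring.
  by rewrite (le_trans (cmodD _ _)) // mulr_natl mulr2n lerD // cl.
- by apply: H'; have := cl t ht; move: r0; lra.
Qed.

Lemma real_cauchy (u : nat -> R) :
  (forall e, 0 < e -> exists N : nat, forall n m, (N <= n)%N -> (N <= m)%N -> `|u n - u m| <= e) ->
  exists l : R, u @ \oo --> l.
Proof.
move=> H; suff : cvg (u @ \oo) by move=> /cvg_ex.
apply/cauchy_cvgP/cauchy_ballP => e e0.
have [N hN] := H (e / 2) (divr_gt0 e0 (ltr0Sn _ 1)).
exists (u @` [set n | (N <= n)%N], u @` [set n | (N <= n)%N]) => /=.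
  by split; exists N => // n /= hn; exists n.
move=> [x y] [/= [n hn <-] [m hm <-]]; rewrite /ball /=.
by rewrite (le_lt_trans (hN n m hn hm)) // ltr_pdivrMr // ltr_pMr // ltr1n.
Qed.

Lemma complex_cauchy (u : nat -> R[i]) :
  (forall e, 0 < e -> exists N : nat, forall n m, (N <= n)%N -> (N <= m)%N -> cmod (u n - u m) <= e) ->
  exists l, forall e, 0 < e -> exists N : nat, forall n, (N <= n)%N -> cmod (u n - l) <= e.
Proof.
move=> H.
have [|a ha] := @real_cauchy (fun n => re (u n)).
  move=> e /H[N hN]; exists N => n m hn hm.
  by rewrite -reB (le_trans (re_le_cmod _)) // hN.
have [|b hb] := @real_cauchy (fun n => im (u n)).
  move=> e /H[N hN]; exists N => n m hn hm.
  by rewrite -imB (le_trans (im_le_cmod _)) // hN.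
exists (Complex a b) => e e0; have e2 : 0 < e / 2 by rewrite divr_gt0.
have /cvgrPdist_le/(_ _ e2)[N1 _ h1] := ha.
have /cvgrPdist_le/(_ _ e2)[N2 _ h2] := hb.
exists (maxn N1 N2) => n; rewrite geq_max => /andP[/h1 /= k1 /h2 /= k2].
rewrite (le_trans (cmod_le_reim _)) // reB imB /= (splitr e) lerD // distrC //.
Qed.

(** Cauchy's estimate for the differences [F n - F m] shows that the derivatives at c converge, and
    [holo_lipschitz] bounds the increments of these differences uniformly in m. Letting m grow
    compares the increment of f with that of a single [F n]. *)
Lemma weierstrass (F : nat -> R[i] -> R[i]) f c (r : R) : 0 < r ->
  (forall n z, cmod (z - c) <= r -> exists l, cder (F n) z l) ->
  (forall e, 0 < e -> exists N : nat, forall n, (N <= n)%N ->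
     forall z, cmod (z - c) <= r -> cmod (F n z - f z) <= e) ->
  exists l, cder f c l.
Proof.
move=> r0 dF uF.
have cc : cmod (c - c) <= r by rewrite subrr cmod0 ltW.
have /choice[dc hdc] n : exists l, cder (F n) c l by exact: dF.
have uC e : 0 < e -> exists N : nat, forall n m, (N <= n)%N -> (N <= m)%N ->
    forall z, cmod (z - c) <= r -> cmod (F n z - F m z) <= e.
  move=> e0; have [|N hN] := uF (e / 2); first by rewrite divr_gt0.
  exists N => n m hn hm z hz; rewrite (_ : _ - _ = (F n z - f z) - (F m z - f z)); last by ring.
  by rewrite (le_trans (cmodB _ _)) // (splitr e) lerD // hN.
have dFB n m z : cmod (z - c) <= r -> exists l, cder (fun w => F n w - F m w) z l.
  move=> hz; have [l hl] := dF n z hz; have [k hk] := dF m z hz.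
  by exists (l - k); exact: cderB.
have [e e0|l hl] := @complex_cauchy dc.
  have [|N hN] := uC (e * r / 4); first by rewrite divr_gt0 // mulr_gt0.
  exists N => n m hn hm.
  have := @cauchy_deriv (fun w => F n w - F m w) c r (e * r / 4) (dc n - dc m) r0 (dFB n m) (hN n m hn hm) (cderB (hdc n) (hdc m)).
  by rewrite (_ : 4 * _ / r = e) //; field; rewrite gt_eqF.
exists l => e e0.
pose r2 := r / 2; have r20 : 0 < r2 by rewrite divr_gt0.
have r22 : 2 * r2 = r by rewrite /r2; field.
have e3 : 0 < e / 3 by rewrite divr_gt0.
have [N1 hN1] := hl _ e3.
have [|N2 hN2] := uC (e / 3 * r2 / 8); first by rewrite divr_gt0 // mulr_gt0.
pose n := maxn N1 N2.
have [d d0 hd] := hdc n _ e3.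
exists (Num.min d r2) => [|h]; first by rewrite lt_min d0.
rewrite lt_min => /andP[h1 /ltW h2].
have Lip m : (n <= m)%N -> cmod (F n (c + h) - F m (c + h) - (F n c - F m c)) <= e / 3 * cmod h.
  move=> nm; have nm2 : (N2 <= m)%N by rewrite (leq_trans _ nm) // leq_maxr.
  have := @holo_lipschitz (fun w => F n w - F m w) c r2 (e / 3 * r2 / 8) h r20.
  rewrite (_ : 8 * _ / r2 = e / 3); last by field; rewrite gt_eqF.
  by apply => //; rewrite r22 => z hz; [exact: dFB|apply: hN2 => //; exact: leq_maxr].
have lim : cmod (F n (c + h) - f (c + h) - (F n c - f c)) <= e / 3 * cmod h.
  apply/ler_addgt0Pr => k k0.
  have [|N3 hN3] := uF (k / 2); first by rewrite divr_gt0.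
  pose m := maxn n N3; have hm : (N3 <= m)%N by rewrite leq_maxr.
  rewrite (_ : _ - _ = (F n (c + h) - F m (c + h) - (F n c - F m c)) +
    ((F m (c + h) - f (c + h)) - (F m c - f c))); last by ring.
  rewrite (le_trans (cmodD _ _)) // lerD ?Lip ?leq_maxl //.
  rewrite (le_trans (cmodB _ _)) // (splitr k) lerD // hN3 //.
  by rewrite addrC addKr (le_trans h2) // /r2; move: r0; lra.
rewrite (_ : _ - _ = (F n (c + h) - F n c - dc n * h) + (dc n - l) * h -
  (F n (c + h) - f (c + h) - (F n c - f c))); last by ring.
rewrite (le_trans (cmodB _ _)) //.
have -> : e * cmod h = e / 3 * cmod h + e / 3 * cmod h + e / 3 * cmod h by field.
rewrite lerD // (le_trans (cmodD _ _)) // lerD ?hd // cmodM ler_wpM2r ?cmod_ge0 //.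
by apply: hN1; exact: leq_maxl.
Qed.

(** The angle runs over the compact interval [-pi, pi], where a maximum exists; [acos] recovers the
    angle of a given point up to the sign, which the imaginary part decides. *)
Lemma circle_bounded f c (r : R) : 0 < r ->
  (forall z, cmod (z - c) = r -> exists l, cder f z l) ->
  exists M, forall z, cmod (z - c) = r -> cmod (f z) <= M.
Proof.
move=> r0 df.
pose F (s : R) := f (c + r%:C * cexp ('i%C * s%:C)).
have on_circle s : cmod (c + r%:C * cexp ('i%C * s%:C) - c) = r.
  by rewrite addrC addKr cmodM cmod_real cmod_cexp /= !mul0r mulr0 subrr expR0 mulr1 ger0_norm // ltW.
have cF : continuous (fun s => cmod (F s)).
  move=> s; have [l hl] := df _ (on_circle s).
  have h := cder_comp (cderD (cder_cst c _) (cderM (cder_cst r%:C _) (cder_cexp ('i%C * s%:C)))) hl.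
  apply/cvgrPdist_lt => e e0.
  have E : 'i%C * s%:C = 0 + 'i%C * s%:C :> R[i] by rewrite add0r.
  rewrite E in h; have [d d0 {}h] := cder_rcont h e0.
  apply/nbhs_ballP; exists d => //= t; rewrite /ball /= distrC => /h; rewrite !add0r.
  by apply: le_lt_trans; exact: cmod_dist.
have [|s hs sM] := @EVT_max R (fun s => cmod (F s)) (- pi) pi _ (continuous_subspaceT cF).
  by rewrite (le_trans _ (pi_ge0 R)) // oppr_le0 pi_ge0.
exists (cmod (F s)) => z zr.
pose x := re (z - c) / r; pose y := im (z - c) / r.
have xy : x ^+ 2 + y ^+ 2 = 1.
  have := add_Re2_Im2 (z - c); rewrite cmodE zr -rmorphXn => /complexI h.
  by rewrite /x /y !exprMn -mulrDl h exprVn divff // expf_neq0 // gt_eqF.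
have x1 : -1 <= x <= 1.
  rewrite -ler_norml -[leRHS]normr1 -ler_sqr ?nnegrE // real_normK ?num_real // normr1 expr1n -xy.
  by rewrite lerDl sqr_ge0.
have ac := acosK x1; have a0 := acos_ge0 x1; have a1 := acos_lepi x1.
have ss : sin (acos x) = `|y| by rewrite sin_acos // -sqrtr_sqr -xy addrC addKr.
have key (t : R) : cos t = x -> sin t = y -> - pi <= t <= pi -> cmod (f z) <= cmod (F s).
  move=> ct st tp; have := sM t; rewrite in_itv /= => /(_ tp).
  rewrite (_ : F t = f z) // /F; congr f; rewrite -[RHS](subrK c) addrC; congr (_ + _).
  rewrite cexp_i ct st.
  by apply: complex_ext => /=; rewrite /x /y; field; rewrite gt_eqF.
have [y0|y0] := leP 0 y.
  apply: (key (acos x)) => //; first by rewrite ss ger0_norm.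
  by rewrite a1 andbT (le_trans _ a0) // oppr_le0 pi_ge0.
apply: (key (- acos x)); rewrite ?cosN ?sinN ?ss ?ltr0_norm ?opprK //.
by rewrite lerN2 a1 /= (le_trans _ (pi_ge0 R)) // oppr_le0.
Qed.

(** The radius (s - a) / 2 keeps the disc about c to the right of a. As c is less than (s - a) / 8
    to the left of s, a point of the circle outside the region of vanishing satisfies Re (z - c) < r
    / 4. *)
Lemma identity_step f (a s : R) : a < s ->
  (forall z, a < re z -> exists l, cder f z l) ->
  (forall z, s < re z -> f z = 0) ->
  forall z, s - (s - a) / 8 < re z -> f z = 0.
Proof.
move=> as_ df fs c hc; pose r := (s - a) / 2.
have r0 : 0 < r by rewrite divr_gt0 ?subr_gt0.
have rr : r%:C != 0 :> R[i] by rewrite -cmod_gt0 cmod_real normr_gt0 gt_eqF.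
have inside z : cmod (z - c) <= r -> a < re z.
  move=> hz; have := le_trans (re_le_cmod _) hz; rewrite ler_norml reB => /andP[h _].
  by move: h hc; rewrite /r; lra.
have [M hM] : exists M, forall z, cmod (z - c) = r -> cmod (f z) <= M.
  by apply: circle_bounded => // z hz; apply: df; apply: inside; rewrite hz.
(* exp (n E) is 1 at c and tends to 0 with n on the part of the circle of radius
   r about c where f may be nonzero. *)
pose E z := let w := (z - c) * r%:C^-1 in w + w * w * 2^-1.
(* For |w| = 1 and x = Re w one has Re (w + w^2 / 2) = x + x^2 - 1/2, convex in x, with the values
   -1/2 at x = -1 and -3/16 at x = 1/4. *)
pose q : R := 3 / 16.
have key n : cmod (f c) <= 2 * (`|M| * expR (- (n%:R * q))).
  pose g z := f z * cexp (n%:R * E z).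
  have -> : f c = g c by rewrite /g /E subrr !mul0r addr0 mulr0 cexp0 mulr1.
  have dg z : cmod (z - c) <= r -> exists l, cder g z l.
    move=> hz; have [l hl] := df z (inside z hz).
    have dw := cderM (cderB (cder_id z) (cder_cst c z)) (cder_cst (r%:C^-1) z).
    have dE := cderD dw (cderM (cderM dw dw) (cder_cst 2^-1 z)).
    eexists; apply: cderM hl (cder_comp (cderM (cder_cst n%:R z) dE) (cder_cexp _)).
  apply: (@circle_max R g c r) => //.
  - by move=> z /andP[_]; exact: dg.
  - have [|l hl] := dg c; first by rewrite subrr cmod0 ltW.
    exact: cder_continuous hl.
  - move=> z hz; rewrite /g cmodM; have [sz|zs] := ltP s (re z).
      by rewrite fs // cmod0 mul0r mulr_ge0 ?expR_ge0.
    apply: ler_pM; rewrite ?cmod_ge0 //; first exact: le_trans (hM z hz) (ler_norm _).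
    rewrite cmod_cexp ler_expR.
    pose w := (z - c) * r%:C^-1.
    have wE : z - c = r%:C * w by rewrite /w mulrC divfK.
    have w1 : re w ^+ 2 + im w ^+ 2 = 1.
      have := add_Re2_Im2 w; rewrite cmodE /w cmodM cmodV hz cmod_real ger0_norm ?ltW //.
      by rewrite divff ?gt_eqF // expr1n => /complexI.
    have xw : re (z - c) = r * re w by rewrite wE reM /= mul0r subr0.
    have x1 : re w < 1 / 4.
      rewrite -(ltr_pM2l r0) -xw reB; move: zs hc; rewrite /r; lra.
    have x0 : -1 <= re w.
      have : re w ^+ 2 <= 1 by rewrite -w1 lerDl sqr_ge0.
      move=> h; rewrite leNgt; apply/negP => h'; nra.
    have -> : re (n%:R * E z) = n%:R * (re w + re w ^+ 2 - 1 / 2).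
      rewrite (_ : n%:R = (n%:R)%:C :> R[i]); last by rewrite rmorph_nat.
      rewrite reM /= mul0r subr0; congr (_ * _).
      have -> : E z = w + w * w * (2^-1)%:C by rewrite /E fmorphV rmorph_nat.
      have h : im w * im w = 1 - re w ^+ 2 by rewrite -w1; ring.
      rewrite reD (reM (w * w)) (reM w w) h /=; by field.
    have hq : re w + re w ^+ 2 - 1 / 2 <= - q by rewrite /q; nra.
    by have := ler_wpM2l (ler0n R n) hq; rewrite mulrN.
apply/eqP; rewrite -cmod_eq0 eq_le cmod_ge0 andbT leNgt; apply/negP => f0.
have [n hn] : exists n : nat, 2 * `|M| / (cmod (f c) * q) < n%:R.
  exists (Num.bound (2 * `|M| / (cmod (f c) * q))); apply: archi_boundP.
  by rewrite divr_ge0 ?mulr_ge0 ?cmod_ge0 // /q; lra.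
have q0 : 0 < q by rewrite /q; lra.
have k := key n; rewrite expRN mulrA ler_pdivlMr ?expR_gt0 // in k.
have h3 : n%:R * q <= expR (n%:R * q) by rewrite (le_trans _ (expR_ge1Dx _)) // lerDr.
have h2 := le_trans (ler_wpM2l (cmod_ge0 (f c)) h3) k.
rewrite ltr_pdivrMr ?mulr_gt0 // mulrCA in hn.
by have := lt_le_trans hn h2; rewrite ltxx.
Qed.

(** Let s be the infimum of the abscissas beyond which the difference vanishes. If s > a, then
    [identity_step] at an abscissa within (s - a) / 16 of s reaches to the left of s. No power
    series is involved. *)
Lemma identity_halfplane f g (a b : R) :
  (forall z, a < re z -> exists l, cder f z l) ->
  (forall z, a < re z -> exists l, cder g z l) ->
  (forall z, b < re z -> f z = g z) ->
  forall z, a < re z -> f z = g z.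
Proof.
move=> df dg fg z az; apply/eqP; rewrite -subr_eq0; apply/eqP.
pose h z := f z - g z; rewrite -/(h z).
have dh w : a < re w -> exists l, cder h w l.
  by move=> aw; have [l hl] := df w aw; have [k hk] := dg w aw; exists (l - k); exact: cderB.
pose S := [set s | a < s /\ forall z, s < re z -> h z = 0].
have S0 : S (Num.max b (a + 1)).
  split; first by rewrite lt_max ltrDl ltr01 orbT.
  by move=> w; rewrite gt_max => /andP[/fg bw _]; rewrite /h bw subrr.
have hS : has_inf S by split; [exists (Num.max b (a + 1))|exists a => s [/ltW]].
pose s := inf S.
have as_ : a <= s by apply: lb_le_inf => [|x [/ltW]]; [exists (Num.max b (a + 1))|].
have [sa|sa] := ltP a s; last first.
  have [x [ax hx] xz] := inf_adherent (eps := re z - a) (eqbRL (subr_gt0 _ _) az) hS.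
  apply: hx; rewrite (lt_le_trans xz) // -/s; move: sa; lra.
exfalso; have e0 : 0 < (s - a) / 16 by rewrite divr_gt0 ?subr_gt0.
have [x [ax hx] xs] := inf_adherent e0 hS; rewrite -/s in xs.
have sx : s <= x by apply: ge_inf; [case: hS|].
have : s <= x - (x - a) / 8.
  apply: ge_inf; first by case: hS.
  by split; [lra|exact: identity_step].
lra.
Qed.
End Consequences.

(** * Series of holomorphic functions and powers n^-s *)

Section ComplexSeries.
Variable R : realType.
Implicit Types (z w s l c : R[i]) (a b u : nat -> R[i]).

Definition cconv a l := forall e : R, 0 < e ->
  exists N : nat, forall n, (N <= n)%N -> cmod (a n - l) <= e.

Lemma cconv_unique a l l' : cconv a l -> cconv a l' -> l = l'.
Proof.
move=> h h'; apply/eqP; rewrite -subr_eq0 -cmod_eq0 eq_le cmod_ge0 andbT.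
apply/ler_addgt0Pr => e e0; rewrite add0r.
have [|N hN] := h (e / 2); first by rewrite divr_gt0.
have [|M hM] := h' (e / 2); first by rewrite divr_gt0.
rewrite (_ : l - l' = (a (maxn N M) - l') - (a (maxn N M) - l)); last by ring.
by rewrite (le_trans (cmodB _ _)) // (splitr e) lerD ?hM ?hN ?leq_maxl ?leq_maxr.
Qed.

Lemma cconv_cst l : cconv (fun=> l) l.
Proof. by move=> e e0; exists 0%N => n _; rewrite subrr cmod0 ltW. Qed.

Lemma cconvD a b l l' : cconv a l -> cconv b l' -> cconv (fun n => a n + b n) (l + l').
Proof.
move=> h h' e e0.
have [|N hN] := h (e / 2); first by rewrite divr_gt0.
have [|M hM] := h' (e / 2); first by rewrite divr_gt0.
exists (maxn N M) => n; rewrite geq_max => /andP[/hN nN /hM nM].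
rewrite (_ : _ - _ = (a n - l) + (b n - l')); last by ring.
by rewrite (le_trans (cmodD _ _)) // (splitr e) lerD.
Qed.

Lemma cconvZ a k l : cconv a l -> cconv (fun n => k * a n) (k * l).
Proof.
move=> h e e0; have k1 : 0 < cmod k + 1 by rewrite ltr_wpDl ?cmod_ge0.
have [|N hN] := h (e / (cmod k + 1)); first by rewrite divr_gt0.
exists N => n /hN; rewrite ler_pdivlMr // => hn.
rewrite -mulrBr cmodM mulrC (le_trans _ hn) // ler_wpM2l ?cmod_ge0 // lerDl //.
Qed.

Lemma cconvB a b l l' : cconv a l -> cconv b l' -> cconv (fun n => a n - b n) (l - l').
Proof.
move=> h h'; rewrite -mulN1r; have := cconvD h (cconvZ (-1) h').
by under eq_fun do rewrite mulN1r.
Qed.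

Lemma cconv_bound a l (B : R) (N : nat) :
  (forall n, (N <= n)%N -> cmod (a n) <= B) -> cconv a l -> cmod l <= B.
Proof.
move=> hB h; apply/ler_addgt0Pr => e e0; have [M hM] := h e e0.
rewrite (_ : l = a (maxn N M) - (a (maxn N M) - l)); last by ring.
by rewrite (le_trans (cmodB _ _)) // lerD ?hB ?hM ?leq_maxl ?leq_maxr.
Qed.

Lemma cconvM a b l l' : cconv a l -> cconv b l' -> cconv (fun n => a n * b n) (l * l').
Proof.
move=> h h' e e0; have l1 : 0 < cmod l + 1 by rewrite ltr_wpDl ?cmod_ge0.
have l'1 : 0 < cmod l' + 1 by rewrite ltr_wpDl ?cmod_ge0.
have [N0 hN0] := h 1 ltr01.
have [|N hN] := h (e / 2 / (cmod l' + 1)); first by rewrite !divr_gt0.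
have [|M hM] := h' (e / 2 / (cmod l + 1)); first by rewrite !divr_gt0.
exists (maxn N0 (maxn N M)) => n; rewrite !geq_max => /andP[/hN0 n0 /andP[/hN nN /hM nM]].
have an : cmod (a n) <= cmod l + 1.
  by rewrite -[a n](subrK l) addrC (le_trans (cmodD _ _)) // lerD2l.
rewrite (_ : _ - _ = (b n - l') * a n + (a n - l) * l'); last by ring.
rewrite (le_trans (cmodD _ _)) // (splitr e) lerD // cmodM.
  by move: nM; rewrite ler_pdivlMr // => /(le_trans _); apply; rewrite ler_wpM2l ?cmod_ge0.
move: nN; rewrite ler_pdivlMr // => /(le_trans _); apply.
by rewrite ler_wpM2l ?cmod_ge0 // lerDl.
Qed.

Definition csum u : R[i] := xget 0 [set l | cconv (fun N => \sum_(i < N) u i) l].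

Lemma csumE u l : cconv (fun N => \sum_(i < N) u i) l -> csum u = l.
Proof.
move=> h; rewrite /csum; case: xgetP => [x -> hx|/(_ l)//].
exact: cconv_unique hx h.
Qed.

Lemma npow_cvg0 (d e : R) : 0 < d -> 0 < e ->
  exists N : nat, forall n, (N <= n)%N -> n.+1%:R `^ (- d) <= e.
Proof.
move=> d0 e0; exists (Num.bound (expR (- ln e / d))) => n hn.
have hb := archi_boundP (expR_ge0 (- ln e / d)).
have hn' : expR (- ln e / d) <= n.+1%:R.
  by rewrite (le_trans (ltW hb)) // ler_nat (leq_trans hn).
rewrite /powR pnatr_eq0 /= -[leRHS]lnK ?posrE // ler_expR mulNr lerNl mulrC -ler_pdivrMr //.
by rewrite -ler_expR lnK ?posrE.
Qed.

(** This telescoping bound takes the place of the integral test. It follows from exp t >= 1 + t and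
    ln (1 - 1/y) <= -1/y. *)
Lemma pseries_term (d : R) (i : nat) : 0 < d ->
  d * i.+2%:R `^ (- (1 + d)) <= i.+1%:R `^ (- d) - i.+2%:R `^ (- d).
Proof.
move=> d0; set x : R := i.+1%:R; set y : R := i.+2%:R.
have x0 : 0 < x by rewrite ltr0n.
have y0 : 0 < y by rewrite ltr0n.
have yx : y = x + 1 by rewrite /y -natr1.
have E t : (0 < t) -> t `^ (- d) = expR (- d * ln t) by move=> t0; rewrite /powR gt_eqF.
have -> : y `^ (- (1 + d)) = y `^ (- d) * y^-1.
  rewrite opprD addrC powRD; last by rewrite (gt_eqF y0) implybT.
  by rewrite -powR_inv1 // ltW.
have -> : x `^ (- d) = y `^ (- d) * expR (d * (ln y - ln x)).
  by rewrite !E // -expRD; congr expR; ring.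
rewrite mulrCA -[X in _ <= _ - X]mulr1 -mulrBr ler_wpM2l ?powR_ge0 //.
rewrite lerBrDl (le_trans _ (expR_ge1Dx _)) // lerD2l (ler_pM2l d0).
rewrite -ln_div ?posrE //.
have h : ln (x / y) <= - y^-1.
  have -> : x / y = 1 + - y^-1 by rewrite -{1}(addrK 1 x) -yx mulrBl divff ?gt_eqF // mul1r.
  by apply: le_ln1Dx; rewrite ltrN2 invf_lt1 // /y ltr1n.
have -> : ln (y / x) = - ln (x / y) by rewrite !ln_div ?posrE // opprB.
by rewrite lerNr.
Qed.

Lemma pseries_tail (d : R) (N k : nat) : 0 < d ->
  \sum_(N.+1 <= i < N.+1 + k) i.+1%:R `^ (- (1 + d)) <= N.+1%:R `^ (- d) / d.
Proof.
move=> d0; rewrite ler_pdivlMr // mulrC.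
apply: (@le_trans _ _ (N.+1%:R `^ (- d) - (N.+1 + k)%:R `^ (- d))); last first.
  by rewrite gerBl powR_ge0.
elim: k => [|k IH]; first by rewrite addn0 big_geq // mulr0 subrr.
rewrite addnS big_nat_recr ?leq_addr //= mulrDr.
have := pseries_term (N + k) d0; rewrite -addSn => h.
rewrite (le_trans (lerD IH h)) // [leRHS](_ : _ = N.+1%:R `^ (- d) - (N.+1 + k)%:R `^ (- d) + ((N.+1 + k)%:R `^ (- d) - (N.+1 + k).+1%:R `^ (- d))) //.
by ring.
Qed.

Lemma pseries_tail0 (d e : R) : 0 < d -> 0 < e -> exists N : nat,
  forall n m, (N <= n)%N -> \sum_(n <= i < m) i.+1%:R `^ (- (1 + d)) <= e.
Proof.
move=> d0 e0; have [|N hN] := npow_cvg0 d0 (e := e * d); first by rewrite mulr_gt0.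
exists N.+1 => n m hn; have [mn|/ltnW nm] := leqP m n; first by rewrite big_geq // ltW.
case: n hn nm => // n hn nm.
rewrite -(subnKC nm) (le_trans (pseries_tail _ _ d0)) // ler_pdivrMr //.
exact: hN.
Qed.

Section Mtest.
Variables (u : nat -> R[i] -> R[i]) (P : set R[i]) (K d : R).
Hypothesis d0 : 0 < d.
Hypothesis uK : forall n z, P z -> cmod (u n z) <= K * n.+1%:R `^ (- (1 + d)).

Lemma mtest_cauchy (e : R) : 0 < e -> exists N : nat, forall n m, (N <= n)%N -> (n <= m)%N ->
  forall z, P z -> cmod (\sum_(i < m) u i z - \sum_(i < n) u i z) <= e.
Proof.
move=> e0; have K1 : 0 < `|K| + 1 by rewrite ltr_wpDl.
have [|N hN] := pseries_tail0 d0 (e := e / (`|K| + 1)); first by rewrite divr_gt0.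
exists N => n m hn nm z hz.
rewrite -(big_mkord xpredT (fun i => u i z)) (big_cat_nat (leq0n n) nm) /= big_mkord addrAC subrr add0r.
rewrite (le_trans (cmod_sum _ _ _)) //.
apply: (@le_trans _ _ ((`|K| + 1) * \sum_(n <= i < m) i.+1%:R `^ (- (1 + d)))).
  rewrite mulr_sumr ler_sum // => i _; rewrite (le_trans (uK _ hz)) // ler_wpM2r ?powR_ge0 //.
  by rewrite (le_trans (ler_norm _)) // lerDl.
by rewrite mulrC -ler_pdivlMr // hN.
Qed.

Lemma mtest_unif (e : R) : 0 < e -> exists N : nat, forall n, (N <= n)%N ->
  forall z, P z -> cmod (\sum_(i < n) u i z - csum (u^~ z)) <= e.
Proof.
move=> e0; have [N hN] := mtest_cauchy e0; exists N => n hn z hz.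
have [f f0|l hl] := @complex_cauchy R (fun N => \sum_(i < N) u i z).
  have [M hM] := mtest_cauchy f0; exists M => p q hp hq.
  have [pq|/ltnW qp] := leqP p q; last exact: hM.
  by rewrite cmodBC hM.
rewrite (csumE hl).
have h := cconvB (cconv_cst (\sum_(i < n) u i z)) hl.
by apply: (cconv_bound (N := n)) h => m nm; rewrite cmodBC hN.
Qed.

Lemma mtest_conv z : P z -> cconv (fun N => \sum_(i < N) u i z) (csum (u^~ z)).
Proof. by move=> hz e /mtest_unif[N hN]; exists N => n /hN; apply. Qed.
End Mtest.

Lemma csum_holo (u : nat -> R[i] -> R[i]) c (r K d : R) : 0 < d -> 0 < r ->
  (forall n z, cmod (z - c) <= r -> exists l, cder (u n) z l) ->
  (forall n z, cmod (z - c) <= r -> cmod (u n z) <= K * n.+1%:R `^ (- (1 + d))) ->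
  exists l, cder (fun z => csum (u^~ z)) c l.
Proof.
move=> d0 r0 du uK.
apply: (weierstrass (F := fun N z => \sum_(i < N) u i z) r0).
  move=> n z hz; have /choice[l hl] i : exists l, cder (u i) z l by exact: du.
  by eexists; apply: cder_sum => i; exact: hl.
by move=> e; exact: mtest_unif d0 uK e.
Qed.

Definition npw (n : nat) s : R[i] := cexp (- s * (ln n%:R)%:C).

Lemma natcpow_npw n (s : CC R) : (0 < n)%N -> natcpow n (- s) = npw n s.
Proof. by move=> n0; rewrite natcpowE. Qed.

Lemma cder_npw n s : exists l, cder (npw n) s l.
Proof.
by eexists; apply: cder_comp (cderM (cderN (cder_id s)) (cder_cst _ s)) (cder_cexp _).
Qed.

Lemma cmod_npw n s : cmod (npw n.+1 s) = n.+1%:R `^ (- re s).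
Proof. by rewrite cmod_cexp /powR pnatr_eq0 /= reM reN /= mulr0 subr0. Qed.

Lemma npwD n s w : npw n (s + w) = npw n s * npw n w.
Proof. by rewrite /npw -cexpD; congr cexp; ring. Qed.

Lemma npw0 n : npw n 0 = 1.
Proof. by rewrite /npw oppr0 mul0r cexp0. Qed.

Lemma npw1 s : npw 1 s = 1.
Proof. by rewrite /npw ln1 mulr0 cexp0. Qed.

Lemma npwM m n s : (0 < m)%N -> (0 < n)%N -> npw (m * n) s = npw m s * npw n s.
Proof.
move=> m0 n0; rewrite /npw -cexpD natrM lnM ?posrE ?ltr0n // rmorphD.
by congr cexp; ring.
Qed.

Lemma npw_real n (x : R) : npw n.+1 x%:C = (n.+1%:R `^ (- x))%:C.
Proof.
have -> : npw n.+1 x%:C = cexp (- x * ln n.+1%:R)%:C by rewrite /npw rmorphM rmorphN.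
by rewrite cexp_real /powR pnatr_eq0.
Qed.

Lemma npw_nat n k : npw n.+1 k%:R = n.+1%:R ^- k.
Proof.
have -> : (k%:R : R[i]) = (k%:R)%:C by rewrite rmorph_nat.
rewrite npw_real powRN powR_mulrn // fmorphV rmorphXn /= rmorph_nat //.
Qed.
End ComplexSeries.

(** * The Riemann zeta function *)

Section BinomialSeries.
Variable R : realType.
Implicit Types (z w s l c : R[i]).

(* [bcoef k s] is the coefficient of x^k in (1 + x)^-s. *)
Fixpoint bcoef k s : R[i] :=
  if k is j.+1 then - s * bcoef j (s + 1) / j.+1%:R else 1.

(* [bcoef j.+1 s] divided by [s + j]; this removes the pole in
   [bcoef j.+1 s * zeta (s + j + 1)]. *)
Fixpoint bquot j s : R[i] :=
  if j is i.+1 then - s * bquot i (s + 1) / j.+1%:R else -1.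

Lemma bcoefS j s : bcoef j.+1 s = bquot j s * (s + j%:R).
Proof.
elim: j s => [|j IH] s; first by rewrite /= addr0 mulr1 divr1 mulN1r.
have -> : bcoef j.+2 s = - s * bcoef j.+1 (s + 1) / j.+2%:R by [].
by rewrite IH /= -(natr1 j) (addrC _ 1) -addrA addrA; ring.
Qed.

Lemma cder_shift (f : R[i] -> R[i]) s c : (exists l, cder f (s + c) l) ->
  exists l, cder (fun w => f (w + c)) s l.
Proof.
case=> l hl; exists (l * (1 + 0)).
exact: cder_comp (cderD (cder_id s) (cder_cst c s)) hl.
Qed.

Lemma cder_bcoef k s : exists l, cder (bcoef k) s l.
Proof.
elim: k s => [|k IH] s; first by exists 0; exact: cder_cst.
have [l hl] := cder_shift (IH (s + 1)).
by eexists; apply: cderM (cderM (cderN (cder_id s)) hl) (cder_cst _ s).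
Qed.

Lemma cder_bquot k s : exists l, cder (bquot k) s l.
Proof.
elim: k s => [|k IH] s; first by exists 0; exact: cder_cst.
have [l hl] := cder_shift (IH (s + 1)).
by eexists; apply: cderM (cderM (cderN (cder_id s)) hl) (cder_cst _ s).
Qed.

Lemma cderX z n : cder (fun w : R[i] => w ^+ n) z (n%:R * z ^+ n.-1).
Proof.
elim: n => [|n IH]; first by rewrite mul0r; exact: cder_cst.
have := cderM (cder_id z) IH.
have -> : id z * (n%:R * z ^+ n.-1) + z ^+ n * 1 = n.+1%:R * z ^+ n.+1.-1.
  case: n {IH} => [|n] /=; first by rewrite !expr0; ring.
  by rewrite exprS -[n.+2%:R]natr1; ring.
by congr (cder _ _ _); apply/funext => w; rewrite exprS.
Qed.

Definition btail m s (x : R) : R[i] :=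
  cexp (- s * (ln (1 + x))%:C) - \sum_(k < m) bcoef k s * x%:C ^+ k.

(** Bookkeeping for [btail_bound]: every integration brings the factor 2 of the mean value
    inequality and a factor |s| <= B, and moves s to s + 1, hence B to B + 1. *)
Fixpoint bbound m (B : R) : R :=
  if m is j.+1 then 2 * B * bbound j (B + 1) else expR B.

Lemma bbound_ge0 m B : 0 <= B -> 0 <= bbound m B.
Proof.
elim: m B => [|m IH] B B0 /=; first exact: expR_ge0.
by rewrite !mulr_ge0 // IH // addr_ge0.
Qed.

Lemma rderiv_comp (G : R -> R[i]) (g : R -> R) (x dg : R) l :
  is_derive x 1 g dg -> rderiv G (g x) l -> rderiv (fun t => G (g t)) x (dg%:C * l).
Proof.
move=> hg [h1 h2]; split.
  have := @is_derive1_comp R (fun t => re (G t)) g x (re l) dg h1 hg.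
  by rewrite reM /= mul0r subr0 mulrC.
have := @is_derive1_comp R (fun t => im (G t)) g x (im l) dg h2 hg.
by rewrite imM /= mul0r addr0 mulrC.
Qed.

Lemma rderiv_eq (F G : R -> R[i]) (x : R) l l' :
  rderiv F x l -> F =1 G -> l = l' -> rderiv G x l'.
Proof. by move=> h /funext <- <-. Qed.

(** The derivative of (1 + x)^-s is -s (1 + x)^-(s + 1). The coefficients are defined by a recursion
    through s + 1 precisely so that Taylor remainders obey the same rule. *)
Lemma rderiv_btail m s (x : R) : 0 <= x ->
  rderiv (btail m.+1 s) x (- s * btail m (s + 1) x).
Proof.
move=> x0; have x1 : 0 < 1 + x by rewrite ltr_pwDl.
have d1 : is_derive x 1 (fun t => ln (1 + t)) (1 + x)^-1.
  have h := @is_derive1_comp R (@ln R) (fun t => 1 + t) x ((1 + x)^-1) 1 (is_derive1_ln x1).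
  have := h _; rewrite mulr1; apply.
  have := @is_deriveD R R R (cst 1) id x 1 0 1 _ _; rewrite add0r; exact.
have d2 := rderiv_comp d1 (@rderiv_line R (@cexp R) 0 (- s) _ _ (cder_cexp _)).
have d3 : rderiv (fun t : R => \sum_(k < m.+1) bcoef k s * (0 + 1 * t%:C) ^+ k) x
    (1 * \sum_(k < m.+1) (bcoef k s * (k%:R * (0 + 1 * x%:C) ^+ k.-1) + (0 + 1 * x%:C) ^+ k * 0)).
  apply: (@rderiv_line R (fun z => \sum_(k < m.+1) bcoef k s * z ^+ k)).
  by apply: cder_sum => k; apply: cderM; [exact: cder_cst|exact: cderX].
apply: (rderiv_eq (rderivB d2 d3)).
  move=> t; rewrite /btail add0r; congr (_ - _).
  by apply: eq_bigr => k _; rewrite add0r mul1r.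
rewrite add0r mul1r add0r mul1r big_ord_recl /= mulr0 addr0 mul0r mulr0 add0r.
rewrite /btail mulrBr; congr (_ - _).
  rewrite mulrCA; congr (_ * _).
  have -> : ((1 + x)^-1)%:C = cexp (- 1 * (ln (1 + x))%:C).
    by rewrite mulN1r -rmorphN cexp_real expRN lnK ?posrE.
  by rewrite -cexpD; congr cexp; ring.
rewrite mulr_sumr; apply: eq_bigr => k _; rewrite /= mulr0 addr0 /bump /= add1n.
by field; rewrite nat1r pnatr_eq0.
Qed.

Lemma btail0 m s : btail m.+1 s 0 = 0.
Proof.
rewrite /btail addr0 ln1 mulr0 cexp0 big_ord_recl /= expr0 mulr1 big1 ?addr0 ?subrr // => k _.
by rewrite /= expr0n /= mulr0.
Qed.

Lemma btail_bound m s (x B : R) : 0 <= x <= 1 -> cmod s <= B ->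
  cmod (btail m s x) <= bbound m B * x ^+ m.
Proof.
elim: m s x B => [|m IH] s x B /andP[x0 x1] sB.
  rewrite /btail big_ord0 subr0 expr0 mulr1 cmod_cexp ler_expR.
  have lx : 0 <= ln (1 + x) <= 1.
    rewrite ln_ge0 ?lerDl //= (le_trans (le_ln1Dx _)) // (lt_le_trans _ x0) // ltrN10.
  rewrite (le_trans (ler_norm _)) // (le_trans (re_le_cmod _)) // cmodM cmodN cmod_real.
  by case/andP: lx => l0 l1; rewrite (ger0_norm l0) (le_trans _ sB) // ler_piMr ?cmod_ge0.
have B0 : 0 <= B := le_trans (cmod_ge0 _) sB.
rewrite -[btail _ _ _]subr0 -(btail0 m s).
have -> : bbound m.+1 B * x ^+ m.+1 = 2 * (B * (bbound m (B + 1) * x ^+ m)) * (x - 0).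
  by rewrite /= exprS; ring.
apply: (@rderiv_mean_value R _ (fun t => - s * btail m (s + 1) t)) => // t /andP[t0 tx].
  exact: rderiv_btail.
rewrite cmodM cmodN ler_pM ?cmod_ge0 //.
rewrite (le_trans (IH (s + 1) t (B + 1) _ _)) //.
- by rewrite t0 (le_trans tx).
- by rewrite (le_trans (cmodD _ _)) // cmod1 lerD2r.
- by rewrite ler_wpM2l ?bbound_ge0 ?addr_ge0 // lerXn2r ?nnegrE.
Qed.
Lemma bcoef1 s : bcoef 1 s = - s.
Proof. by rewrite /= mulr1 divr1. Qed.
End BinomialSeries.
Arguments bcoef : simpl never.
Arguments bquot : simpl never.

Section Zeta.
Variable R : realType.
Implicit Types (z w s l c : R[i]).

Definition zseries s : R[i] := csum (fun n => npw n.+1 s).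

(** With N = n + 1, this is N^-s - (N + 1)^-s plus the terms of order 1 to m - 1 of the expansion of
    (1 + 1/N)^-s. What is left is minus a Taylor remainder of size N^-(Re s + m). For m = 1 it is
    the plain difference used in summation by parts. *)
Definition zterm m n s : R[i] :=
  npw n.+1 s - npw n.+2 s + \sum_(1 <= k < m) bcoef k s * npw n.+1 (s + k%:R).

Lemma ztermE m n s : zterm m.+1 n s = - npw n.+1 s * btail m.+1 s n.+1%:R^-1.
Proof.
have n0 : 0 < n.+1%:R :> R by rewrite ltr0n.
have n2 : npw n.+2 s = npw n.+1 s * cexp (- s * (ln (1 + n.+1%:R^-1))%:C).
  rewrite /npw -cexpD -mulrDr -rmorphD -lnM ?posrE ?addr_gt0 ?invr_gt0 //.
  by congr (cexp (_ * (ln _)%:C)); rewrite mulrDr mulr1 divff ?gt_eqF // natr1.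
rewrite /zterm /btail -(big_mkord xpredT (fun k => bcoef k s * (n.+1%:R^-1)%:C ^+ k)) big_ltn //= expr0 mulr1.
rewrite n2 mulrBr mulrDr mulr_sumr.
have -> : \sum_(1 <= k < m.+1) bcoef k s * npw n.+1 (s + k%:R) =
   \sum_(1 <= k < m.+1) npw n.+1 s * (bcoef k s * (n.+1%:R^-1)%:C ^+ k).
  apply: eq_bigr => k _; rewrite npwD npw_nat.
  by rewrite fmorphV rmorph_nat -exprVn; ring.
under [in RHS]eq_bigr do rewrite mulNr; rewrite sumrN; ring.
Qed.

Lemma zterm_bound m n s (B : R) : cmod s <= B ->
  cmod (zterm m.+1 n s) <= bbound m.+1 B * n.+1%:R `^ (- (re s + m.+1%:R)).
Proof.
move=> sB; have n0 : 0 < n.+1%:R :> R by rewrite ltr0n.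
rewrite ztermE cmodM cmodN cmod_npw.
have hx : 0 <= (n.+1%:R^-1 : R) <= 1 by apply/andP; split; [rewrite invr_ge0 ltW | rewrite invf_le1 // ler1n].
rewrite (le_trans (ler_wpM2l (powR_ge0 _ _) (btail_bound m.+1 hx sB))) //.
rewrite mulrCA ler_wpM2l ?bbound_ge0 ?(le_trans (cmod_ge0 _) sB) //.
rewrite opprD powRD; last by rewrite (gt_eqF n0) implybT.
by rewrite (powRN _ m.+1%:R) powR_mulrn ?ler0n // exprVn.
Qed.

Lemma cder_zterm m n s : exists l, cder (zterm m n) s l.
Proof.
have [a ha] := cder_npw n.+1 s; have [b hb] := cder_npw n.+2 s.
have /choice[l hl] k : exists l, cder (fun w => bcoef k w * npw n.+1 (w + k%:R)) s l.
  have [c hc] := cder_bcoef k s.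
  have [d hd] := cder_shift (cder_npw n.+1 (s + k%:R)).
  by eexists; exact: cderM hc hd.
by eexists; apply: cderD (cderB ha hb) (cder_sum _ hl).
Qed.

Definition zrem m s := csum (zterm m ^~ s).

Lemma zterm_bound_disc m s : 1 < re s + m.+1%:R -> exists2 d : R, 0 < d &
  exists2 r, 0 < r & exists K, forall n z, cmod (z - s) <= r ->
    cmod (zterm m.+1 n z) <= K * n.+1%:R `^ (- (1 + d)).
Proof.
move=> hs; pose d := (re s + m.+1%:R - 1) / 2; have d0 : 0 < d by rewrite divr_gt0 ?subr_gt0.
exists d => //; exists d => //; exists (bbound m.+1 (cmod s + d)) => n z hz.
have zs : cmod z <= cmod s + d.
  by rewrite -(subrK s z) addrC (le_trans (cmodD _ _)) // lerD2l.
rewrite (le_trans (zterm_bound m n zs)) // ler_wpM2l ?bbound_ge0 ?addr_ge0 ?cmod_ge0 ?(ltW d0) //.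
apply: ler_powR; first by rewrite ler1n.
have := le_trans (re_le_cmod _) hz; rewrite reB ler_norml => /andP[h _].
rewrite lerN2; move: h; rewrite /d; lra.
Qed.

Lemma cder_zrem m s : 1 < re s + m.+1%:R -> exists l, cder (zrem m.+1) s l.
Proof.
move=> /zterm_bound_disc[d d0 [r r0 [K hK]]].
by apply: (csum_holo d0 r0 _ hK) => n z _; exact: cder_zterm.
Qed.

Lemma zrem_conv m s : 1 < re s + m.+1%:R ->
  cconv (fun N => \sum_(i < N) zterm m.+1 i s) (zrem m.+1 s).
Proof.
move=> /zterm_bound_disc[d d0 [r r0 [K hK]]].
by apply: (mtest_conv d0 hK); rewrite /= subrr cmod0 ltW.
Qed.

Lemma npw_bound_disc s : 1 < re s -> exists2 d : R, 0 < d & exists2 r, 0 < r &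
  forall n z, cmod (z - s) <= r -> cmod (npw n.+1 z) <= 1 * n.+1%:R `^ (- (1 + d)).
Proof.
move=> hs; pose d := (re s - 1) / 2; have d0 : 0 < d by rewrite divr_gt0 ?subr_gt0.
exists d => //; exists d => // n z hz; rewrite mul1r cmod_npw.
apply: ler_powR; first by rewrite ler1n.
have := le_trans (re_le_cmod _) hz; rewrite reB ler_norml => /andP[h _].
rewrite lerN2; move: h; rewrite /d; lra.
Qed.

Lemma zseries_conv s : 1 < re s -> cconv (fun N => \sum_(i < N) npw i.+1 s) (zseries s).
Proof.
move=> /npw_bound_disc[d d0 [r r0 hK]].
by apply: (mtest_conv d0 hK); rewrite /= subrr cmod0 ltW.
Qed.

Lemma cder_zseries s : 1 < re s -> exists l, cder zseries s l.
Proof.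
move=> /npw_bound_disc[d d0 [r r0 hK]].
by apply: (csum_holo d0 r0 _ hK) => n z _; exact: cder_npw.
Qed.

Lemma npw_to0 s : 0 < re s -> cconv (fun n => npw n.+1 s) 0.
Proof.
move=> s0 e e0; have [N hN] := npow_cvg0 s0 e0.
by exists N => n hn; rewrite subr0 cmod_npw hN.
Qed.

Lemma cconv_sum (I : Type) (r : seq I) (a : I -> nat -> R[i]) (l : I -> R[i]) :
  (forall i, cconv (a i) (l i)) ->
  cconv (fun n => \sum_(i <- r) a i n) (\sum_(i <- r) l i).
Proof.
move=> h; elim: r => [|i r IH].
  by rewrite big_nil; under eq_fun do rewrite big_nil; exact: cconv_cst.
by rewrite big_cons; under eq_fun do rewrite big_cons; exact: cconvD.
Qed.

(** Summed over n, the differences telescope to 1 and every correction becomes a value of zeta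
    further to the right; the other side converges in a larger half-plane, so this relation yields
    the continuation. *)
Lemma zremE m s : 0 < re s ->
  zrem m.+1 s = 1 + \sum_(1 <= k < m.+1) bcoef k s * zseries (s + k%:R).
Proof.
move=> s0; apply: csumE.
have T N : \sum_(i < N) zterm m.+1 i s = (1 - npw N.+1 s) +
    \sum_(1 <= k < m.+1) bcoef k s * \sum_(i < N) npw i.+1 (s + k%:R).
  rewrite /zterm big_split /=; congr (_ + _).
    elim: N => [|N IH]; first by rewrite big_ord0 npw1 subrr.
    by rewrite big_ord_recr /= IH; ring.
  by rewrite exchange_big /=; apply: eq_bigr => k _; rewrite mulr_sumr.
under eq_fun do rewrite T.
apply: cconvD.
  by have := cconvB (cconv_cst 1) (npw_to0 s0); rewrite subr0.
rewrite !big_add1 /= !big_mkord.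
under eq_fun do rewrite big_add1 /= big_mkord.
apply: cconv_sum => k; apply: cconvZ; apply: zseries_conv.
rewrite reD (_ : k.+1%:R = (k.+1%:R)%:C :> R[i]); last by rewrite rmorph_nat.
by rewrite /= -natr1 addrA ltrDr addrC ltr_wpDl.
Qed.

Lemma re_nat n : re (n%:R : R[i]) = n%:R.
Proof. by rewrite (_ : n%:R = (n%:R)%:C :> R[i]) // rmorph_nat. Qed.

Lemma zeta_halfplane m : exists A : R[i] -> R[i],
  (forall s, 1 - m%:R < re s -> exists l, cder A s l) /\
  (forall s, 1 < re s -> A s = (s - 1) * zseries s).
Proof.
elim: m => [|m [A [dA AE]]].
  exists (fun s => (s - 1) * zseries s); split=> // s; rewrite subr0 => /cder_zseries[l hl].
  by eexists; apply: cderM (cderB (cder_id s) (cder_cst 1 s)) hl.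
(* [zremE] at s - 1, solved for the term k = 1, which is -(s - 1) zeta(s). The other terms use A
   only at s + 1, ..., s + m, where it is already known. *)
exists (fun s => 1 + \sum_(j < m) bquot j.+1 (s - 1) * A (s - 1 + j.+2%:R) - zrem m.+2 (s - 1)).
split=> s hs.
  have [a ha] : exists l, cder (fun s => zrem m.+2 (s - 1)) s l.
    apply: cder_shift; apply: cder_zrem; rewrite reB /=.
    by move: hs; rewrite -!natr1; lra.
  have /choice[l hl] (j : 'I_m) : exists l, cder (fun s => bquot j.+1 (s - 1) * A (s - 1 + j.+2%:R)) s l.
    have [b hb] := cder_shift (cder_bquot j.+1 (s - 1)).
    have [c hc] : exists l, cder (fun s => A (s - 1 + j.+2%:R)) s l.
      have : exists l, cder A (s + (j.+2%:R - 1)) l.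
        apply: dA; rewrite reD reB re_nat /=.
        have : 0 <= j%:R :> R by [].
        by move: hs; rewrite -!natr1; lra.
      have -> : (fun w => A (w - 1 + j.+2%:R)) = fun w => A (w + (j.+2%:R - 1)).
        by apply/funext => w; congr A; ring.
      exact: cder_shift.
    by eexists; exact: cderM hb hc.
  by eexists; apply: cderB (cderD (cder_cst 1 s) (cder_sum _ hl)) ha.
rewrite zremE; last by rewrite reB /= subr_gt0.
rewrite big_ltn //; set t := s - 1.
have -> : \sum_(2 <= k < m.+2) bcoef k t * zseries (t + k%:R) =
    \sum_(j < m) bquot j.+1 t * A (t + j.+2%:R).
  rewrite !big_add1 /= big_mkord; apply: eq_bigr => j _.
  rewrite AE; last first.
    rewrite reD re_nat /t reB /= -!natr1.
    by have : 0 <= j%:R :> R by []; move: hs; lra.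
  rewrite bcoefS -mulrA; congr (_ * (_ * _)).
  by rewrite -[j.+2%:R]natr1; ring.
by rewrite bcoef1 /t subrK; ring.
Qed.

Lemma re_half : 0 < re (2^-1 : R[i]).
Proof. by rewrite (_ : 2^-1 = (2^-1)%:C :> R[i]) /= ?invr_gt0 // fmorphV rmorph_nat. Qed.

Lemma re_cconv_le (a : nat -> R[i]) l (B : R) :
  (forall n, re (a n) <= B) -> cconv a l -> re l <= B.
Proof.
move=> hB h; apply/ler_addgt0Pr => e e0; have [N hN] := h e e0.
have := le_trans (re_le_cmod _) (hN N (leqnn N)).
by rewrite reB ler_norml => /andP[h1 _]; have := hB N; lra.
Qed.

(** From sqrt(N + 1) - sqrt N = 1 / (sqrt(N + 1) + sqrt N) >= 1 / (2 sqrt(N + 1)). The bound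
    telescopes, so [zrem 2] has real part at most 1/2 at -1/2, and this excludes a zero of zeta at
    1/2. *)
Lemma zterm_half n : re (zterm 2 n (- 2^-1)%:C) <=
  2^-1 * n.+1%:R `^ (- 2^-1) - 2^-1 * n.+2%:R `^ (- 2^-1).
Proof.
have E k : k.+1%:R `^ (- 2^-1) = (Num.sqrt k.+1%:R)^-1 :> R by rewrite powRN powR12_sqrt.
have -> : re (zterm 2 n (- 2^-1)%:C) = Num.sqrt n.+1%:R - Num.sqrt n.+2%:R + 2^-1 * (Num.sqrt n.+1%:R)^-1.
  rewrite /zterm big_nat1 bcoef1 !npw_real !opprK !powR12_sqrt //.
  have -> : (- 2^-1)%:C + 1 = (2^-1)%:C :> R[i].
    by rewrite rmorphN fmorphV rmorph_nat; field.
  by rewrite npw_real E reD reM /=; ring.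
rewrite !E; set x := Num.sqrt n.+1%:R; set y := Num.sqrt n.+2%:R.
have x0 : 0 < x by rewrite sqrtr_gt0.
have y0 : 0 < y by rewrite sqrtr_gt0.
have xy : y ^+ 2 = x ^+ 2 + 1 by rewrite !sqr_sqrtr // natr1.
have yx : x <= y by rewrite ler_sqrt // ler_nat.
suff : (2 * y)^-1 <= y - x by rewrite invfM; lra.
rewrite -[X in X <= _]mul1r ler_pdivrMr ?mulr_gt0 //.
have h : (y - x) * (y + x) = 1.
  by transitivity (y ^+ 2 - x ^+ 2); [ring | rewrite xy; ring].
rewrite -[X in X <= _]h.
by rewrite ler_wpM2l ?subr_ge0 // mulr_natl mulr2n lerD2l.
Qed.

Lemma zeta_entire : exists A : R[i] -> R[i],
  [/\ forall s, exists l, cder A s l,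
      forall s, 1 < re s -> A s = (s - 1) * zseries s,
      A 1 = 1 & A 2^-1 != 0].
Proof.
have /choice[A HA] := zeta_halfplane.
have dA m := (HA m).1; have AE m := (HA m).2.
have agree m n s : (m <= n)%N -> 1 - m%:R < re s -> A m s = A n s.
  move=> mn; apply: (@identity_halfplane R (A m) (A n) (1 - m%:R) 1).
  - exact: dA.
  - move=> z hz; apply: dA; apply: le_lt_trans hz.
    by rewrite lerD2l lerN2 ler_nat.
  - by move=> z hz; rewrite !AE.
(* A half-plane that contains s; by [agree] the choice does not affect the value. Its successor also
   contains the unit disc about s, which differentiability requires. *)
pose M s := (Num.bound `|re s|).+1.
have MP s : - (M s)%:R < re s - 1.
  have := archi_boundP (normr_ge0 (re s)).
  have := ler_norm (- re s); rewrite normrN /M -natr1; lra.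
have AM m s : 1 - m%:R < re s -> A (M s) s = A m s.
  move=> hs; have [h|/ltnW h] := leqP (M s) m; last by rewrite (agree m (M s)).
  by apply: agree => //; have := MP s; lra.
have A1E s : 0 < re s -> 1 - zrem 2 (s - 1) = A 1%N s.
  apply: (@identity_halfplane R (fun s => 1 - zrem 2 (s - 1)) (A 1%N) 0 1).
  - move=> z hz; have [|l hl] := cder_shift (f := zrem 2) (s := z) (c := -1).
      by apply: cder_zrem; rewrite reD reN /=; move: hz; lra.
    by eexists; exact: cderB (cder_cst 1 z) hl.
  - by move=> z hz; apply: dA; rewrite subrr.
  - move=> z hz; rewrite AE // zremE ?reB ?subr_gt0 // big_nat1 bcoef1 subrK; ring.
exists (fun s => A (M s) s); split.
- move=> s; have [|l hl] := dA (M s).+1 s.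
    by have := MP s; rewrite -natr1; lra.
  exists l; apply: cder_near ltr01 _ hl => w hw; rewrite (AM (M s).+1) //.
  have := le_lt_trans (re_le_cmod _) hw; rewrite reB ltr_norml => /andP[h _].
  have := MP s; rewrite -natr1; lra.
- by move=> s hs; exact: AE.
(* In the form [1 - zrem 2 (s - 1)] the value at 1 is immediate, because every [zterm 2 i] vanishes
   at 0. *)
- rewrite (AM 1%N) ?subrr ?ltr01 // -(A1E 1) ?ltr01 // subrr /zrem (csumE (l := 0)) ?subr0 //.
  move=> e e0; exists 0%N => n _; rewrite subr0 big1 ?cmod0 ?ltW // => i _.
  by rewrite /zterm !npw0 subrr add0r big_nat1 bcoef1 oppr0 mul0r.
- rewrite (AM 1%N) ?subrr ?re_half // -(A1E 2^-1) ?re_half //.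
  have -> : 2^-1 - 1 = (- 2^-1)%:C :> R[i].
    by rewrite rmorphN fmorphV rmorph_nat; field.
  have h : re (zrem 2 (- 2^-1)%:C) <= 2^-1.
    apply: (@re_cconv_le (fun N => \sum_(i < N) zterm 2 i (- 2^-1)%:C)).
      move=> N; apply: (@le_trans _ _ (2^-1 - 2^-1 * N.+1%:R `^ (- 2^-1))).
        elim: N => [|N IH]; first by rewrite big_ord0 powR1 mulr1 subrr.
        rewrite big_ord_recr reD (le_trans (lerD IH (zterm_half N))) //; lra.
      by rewrite gerBl mulr_ge0 ?powR_ge0.
    by apply: zrem_conv; rewrite /=; lra.
  by apply/eqP => /(congr1 (@complex.Re R)); rewrite reB /=; lra.
Qed.
End Zeta.

(** * The quadratic character *)

Section Legendre.
Variables (p : nat).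
Hypotheses (p_pr : prime p) (p_odd : odd p).

Let pch := pchar_Fp p_pr.
Let p2 : (p == (p./2).*2.+1)%N.
Proof. by rewrite -[eqbLHS]odd_double_half p_odd. Qed.

Let pE : p.-1 = (p./2 * 2)%N.
Proof. by move/eqP: p2; lia. Qed.

(** As p > 2, the integers -1, 0, 1 stay distinct modulo p, so identities between symbols may be
    verified in any field of characteristic p. *)
Lemma pchar_neq (F : fieldType) (x y : int) : p \in [pchar F] ->
  x \in [:: -1; 0; 1] -> y \in [:: -1; 0; 1] -> x%:~R = y%:~R :> F -> x = y.
Proof.
move=> ch hx hy /eqP; rewrite -subr_eq0 -intrB -(dvdz_pcharf ch) => /dvdzP[k].
have p3 : (2 < p)%N by rewrite ltn_neqAle prime_gt1 // andbT; apply: contraTneq p_odd => <-.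
move=> xy; have h : k * p = 0 \/ (p%:Z <= k * p \/ k * p <= - p%:Z).
  have [->|[k1|k1]] : k = 0 \/ (1 <= k \/ k <= -1) by lia.
  - by left; rewrite mul0r.
  - by right; left; nia.
  - by right; right; nia.
move: hx hy h; rewrite -xy !inE => /or3P[]/eqP-> /or3P[]/eqP-> //; lia.
Qed.

Lemma Fp_fermat (x : 'F_p) : x ^+ p = x.
Proof. by have := expf_card x; rewrite card_Fp. Qed.

Lemma Fp_prim_root : exists z : 'F_p, (p.-1).-primitive_root z.
Proof.
have p1 := prime_gt1 p_pr.
pose rs := [seq x <- enum 'F_p | x != 0].
have : has (p.-1).-primitive_root rs.
  apply: cyclic.has_prim_root; first by rewrite -ltnS prednK // prime_gt0.
  - apply/allP => x; rewrite mem_filter mem_enum andbT => x0.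
    rewrite unity_rootE -(inj_eq (mulfI x0)) -exprS prednK ?prime_gt0 //.
    by rewrite Fp_fermat mulr1.
  - by rewrite filter_uniq // enum_uniq.
  - have -> : p.-1 = #|[predD1 'F_p & (0 : 'F_p)]|.
      by have := cardD1 (0 : 'F_p) 'F_p; rewrite card_Fp // inE add1n => {1}->.
    rewrite cardE.
    rewrite uniq_leq_size ?enum_uniq // => x.
    by rewrite mem_enum mem_filter mem_enum !inE andbT.
by case/hasP => z _ hz; exists z.
Qed.

Lemma legendre_val (a : int) : legendre a p \in [:: -1; 0; 1].
Proof. by rewrite /legendre; case: ifP => _; [|case: ifP => _]; rewrite !inE eqxx ?orbT. Qed.

Lemma legendre_euler_Fp (a : int) : (legendre a p)%:~R = a%:~R ^+ p./2 :> 'F_p.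
Proof.
have p1 := prime_gt1 p_pr; have [z hz] := Fp_prim_root.
have h0 : (0 < p./2)%N by rewrite half_gt0.
rewrite /legendre; case: ifPn => [|na].
  by rewrite (dvdz_pcharf pch) => /eqP ->; rewrite expr0n gtn_eqF.
have a0 : a%:~R != 0 :> 'F_p by rewrite -(dvdz_pcharf pch).
have aE : a%:~R ^+ p.-1 = 1 :> 'F_p.
  apply: (mulfI a0); rewrite -exprS prednK ?prime_gt0 //.
  by rewrite Fp_fermat mulr1.
case: ifPn => [/existsP[x /eqP xa]|/existsPn nx].
  rewrite -xa -exprM mulnC -pE; apply/esym.
  have x0 : x != 0 by apply: contraNneq a0 => x0; rewrite -xa x0 expr0n.
  apply: (mulfI x0); rewrite -exprS prednK ?prime_gt0 //.
  by rewrite Fp_fermat mulr1.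
have : (a%:~R ^+ p./2) ^+ 2 == 1 :> 'F_p by rewrite -exprM -pE aE.
rewrite sqrf_eq1 => /orP[/eqP h|/eqP -> //].
have [[i ilt] /= ai] := prim_rootP hz aE.
move/eqP: h; rewrite ai -exprM -(prim_order_dvd hz) pE mulnC dvdn_pmul2r // => /dvdnP[j ij].
by have /negP[] := nx (z ^+ j); rewrite -exprM ai ij.
Qed.

(** Euler's criterion carried to extensions of F_p; the proof of reciprocity needs it in an
    algebraic closure. *)
Lemma legendre_euler (F : fieldType) (a : int) : p \in [pchar F] ->
  (legendre a p)%:~R = a%:~R ^+ p./2 :> F.
Proof.
move=> ch; have /eqP := legendre_euler_Fp a.
rewrite -rmorphXn -subr_eq0 -rmorphB -(dvdz_pcharf pch) (dvdz_pcharf ch).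
by rewrite rmorphB subr_eq0 rmorphXn => /eqP.
Qed.

Lemma legendreM (a b : int) : legendre (a * b) p = legendre a p * legendre b p.
Proof.
apply: (pchar_neq pch); first exact: legendre_val.
  by move: (legendre_val a) (legendre_val b); rewrite !inE => /or3P[]/eqP-> /or3P[]/eqP->.
by rewrite rmorphM /= !legendre_euler_Fp rmorphM exprMn.
Qed.

Lemma legendre_eq0 (a : int) : (legendre a p == 0) = (p %| a)%Z.
Proof. by rewrite /legendre; case: ifP => //; case: ifP. Qed.

Lemma legendre_mod (m n : nat) : m = n %[mod p] -> legendre m p = legendre n p.
Proof.
move=> mn; apply: (pchar_neq pch); rewrite ?legendre_val // !legendre_euler_Fp.
congr (_ ^+ _); rewrite -!pmulrn -(GRing.natr_mod_pchar pch m) mn.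
by rewrite (GRing.natr_mod_pchar pch).
Qed.

Lemma legendre_nonres : exists u : nat, legendre u p = -1.
Proof.
have [z hz] := Fp_prim_root; exists (val z).
have p1 := prime_gt1 p_pr; have h0 : (0 < p./2)%N by rewrite half_gt0.
have e : (legendre (val z) p)%:~R = z ^+ p./2.
  by rewrite legendre_euler_Fp -pmulrn natr_Zp.
have : z ^+ p./2 != 1.
  rewrite -(prim_order_dvd hz) pE; apply/negP => /(dvdn_leq h0).
  by rewrite -[X in (_ <= X)%N]muln1 leq_pmul2l.
have : z ^+ p./2 != 0.
  rewrite expf_neq0 //; apply/eqP => z0; have := prim_expr_order hz.
  by rewrite z0 expr0n pE; case: (p./2) h0 => //= n _ /eqP; rewrite eq_sym oner_eq0.
rewrite -e; have := legendre_val (val z); rewrite !inE => /or3P[]/eqP -> //.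
Qed.

Lemma legendre_opp1 (m : nat) : (p %| m.+1)%N -> legendre m p = if (p %% 4 == 1)%N then 1 else -1.
Proof.
move=> pm; apply: (pchar_neq pch); rewrite ?legendre_val //; first by case: ifP.
rewrite legendre_euler_Fp.
have -> : (m%:Z)%:~R = -1 :> 'F_p.
  by apply/eqP; rewrite -subr_eq0 opprK -pmulrn natr1 -(dvdn_pcharf pch).
have -> : (p %% 4 == 1)%N = ~~ odd p./2.
  have := odd_double_half p./2; have := eqP p2; case: (odd p./2) => /= h1 h2; lia.
by rewrite -signr_odd; case: (odd p./2).
Qed.
End Legendre.

Section Psi.

(** The character of discriminant 8 if d = 1 mod 4, and that of discriminant -8 if d = 3 mod 4. The
    choice makes the product with the Legendre symbols even. *)
Definition chi2 (d n : nat) : int :=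
  nth 0 (if (d %% 4 == 1)%N then [:: 0; 1; 0; -1; 0; -1; 0; 1]
         else [:: 0; 1; 0; 1; 0; -1; 0; -1]) (n %% 8).

(* The real primitive character of conductor [8 * d], for [d] odd and
   squarefree, written as a function that is visibly periodic. *)
Definition psi (d n : nat) : int :=
  chi2 d n * \prod_(p <- primes d) legendre n p.

Lemma chi2M d m n : chi2 d (m * n) = chi2 d m * chi2 d n.
Proof.
rewrite /chi2 -modnMml -modnMmr.
move: (m %% 8)%N (n %% 8)%N (ltn_pmod m (isT : 0 < 8)%N) (ltn_pmod n (isT : 0 < 8)%N) => a b.
by case: eqP => _; do 8 (case: a => [|a]; first (move=> _; do 8 (case: b => [|b] //))).
Qed.

Variable d : nat.
Hypotheses (d_odd : odd d) (d_sf : squarefree d).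
Let q := (8 * d)%N.

Let d0 : (0 < d)%N. Proof. by case/andP: d_sf. Qed.

Lemma odd_conductor_prime p : p \in primes d -> odd p.
Proof. by rewrite mem_primes => /and3P[_ _ /dvdn_odd]; apply. Qed.

Lemma squarefree_prod : d = \prod_(p <- primes d) p.
Proof.
rewrite {1}(prod_prime_decomp d0) prime_decompE big_map.
apply: eq_big_seq => p pd /=; suff -> : logn p d = 1%N by rewrite expn1.
case/andP: d_sf => _ /allP /(_ p pd); move: pd; rewrite mem_primes => /and3P[pp _ pd].
rewrite pfactor_dvdn // -ltnNge ltnS => h; apply/eqP; rewrite eqn_leq h /=.
by rewrite logn_gt0 mem_primes pp d0.
Qed.

Lemma psi_mod m n : m = n %[mod q] -> psi d m = psi d n.
Proof.
move=> mn.
have K k : (k %| q)%N -> m = n %[mod k].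
  by move=> kq; rewrite -(modn_dvdm m kq) mn modn_dvdm.
rewrite /psi /chi2 (K 8); last by rewrite dvdn_mulr.
congr (_ * _); apply: eq_big_seq => p pd; apply: legendre_mod.
- by move: pd; rewrite mem_primes => /and3P[].
- exact: odd_conductor_prime.
- by apply: K; rewrite dvdn_mull //; move: pd; rewrite mem_primes => /and3P[].
Qed.

Lemma psiM m n : psi d (m * n) = psi d m * psi d n.
Proof.
rewrite /psi chi2M mulrACA -big_split /=; congr (_ * _).
apply: eq_big_seq => p pd; rewrite PoszM legendreM ?odd_conductor_prime //.
by move: pd; rewrite mem_primes => /and3P[].
Qed.

Lemma legendre1 p : prime p -> odd p -> legendre 1 p = 1.
Proof.
move=> pp op; apply: (pchar_neq pp op (pchar_Fp pp)); rewrite ?legendre_val //.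
by rewrite legendre_euler_Fp // expr1n.
Qed.

Lemma psi1 : psi d 1 = 1.
Proof.
rewrite /psi /chi2 big_seq big1 ?mulr1; first by case: ifP.
move=> p pd; apply: legendre1; last exact: odd_conductor_prime.
by move: pd; rewrite mem_primes => /and3P[].
Qed.

Lemma chi2_val n : chi2 d n \in [:: -1; 0; 1].
Proof.
rewrite /chi2; move: (n %% 8)%N (ltn_pmod n (isT : 0 < 8)%N) => a.
by case: ifP => _; do 8 (case: a => [|a] //).
Qed.

Lemma psi_val n : psi d n \in [:: -1; 0; 1].
Proof.
have mulV (x y : int) : x \in [:: -1; 0; 1] -> y \in [:: -1; 0; 1] -> x * y \in [:: -1; 0; 1].
  by rewrite !inE => /or3P[]/eqP-> /or3P[]/eqP->.
apply: (mulV _ _); first exact: chi2_val.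
by elim/big_rec: _ => // p x _ hx; apply: (mulV _ _) => //; exact: legendre_val.
Qed.

Lemma psi_eq0 n : (psi d n == 0) = ~~ coprime n q.
Proof.
rewrite /psi mulf_eq0 coprimeMr negb_and; congr (_ || _).
  rewrite (_ : 8 = 2 ^ 3)%N // coprime_pexpr // coprimen2 -(@odd_mod n 8 erefl) /chi2.
  move: (n %% 8)%N (ltn_pmod n (isT : 0 < 8)%N) => a.
  by case: ifP => _; do 8 (case: a => [|a] //).
rewrite prodf_seq_eq0; apply/hasP/idP => [[p pd /=]|h].
  rewrite legendre_eq0 => pn; move: pd; rewrite mem_primes => /and3P[pp _ pd].
  apply/negP => /eqP h; have : (p %| gcdn n d)%N by rewrite dvdn_gcd pd andbT.
  by rewrite h dvdn1 => /eqP p1; rewrite p1 in pp.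
have g1 : (1 < gcdn n d)%N by rewrite ltn_neqAle eq_sym h gcdn_gt0 d0 orbT.
have := pdiv_dvd (gcdn n d); rewrite dvdn_gcd => /andP[h1 h2].
exists (pdiv (gcdn n d)); first by rewrite mem_primes pdiv_prime // d0.
by rewrite legendre_eq0.
Qed.

(** At -1 the Legendre symbols multiply to 1 or -1 according to d mod 4, and [chi2] was chosen with
    the same sign at 7 mod 8. *)
Lemma psi_opp1 : psi d q.-1 = 1.
Proof.
have q0 : (0 < q)%N by rewrite muln_gt0.
have -> : psi d q.-1 = chi2 d q.-1 * \prod_(p <- primes d) (if (p %% 4 == 1)%N then 1 else -1).
  congr (_ * _); apply: eq_big_seq => p pd; apply: legendre_opp1.
  - by move: pd; rewrite mem_primes => /and3P[].
  - exact: odd_conductor_prime.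
  - rewrite prednK // dvdn_mull //; by move: pd; rewrite mem_primes => /and3P[].
have -> : \prod_(p <- primes d) (if (p %% 4 == 1)%N then 1 else -1) = (if (d %% 4 == 1)%N then 1 else -1) :> int.
  rewrite [in RHS]squarefree_prod; have : all odd (primes d) by apply/allP => p; exact: odd_conductor_prime.
  elim: (primes d) => [|p s IH] /=; first by rewrite !big_nil.
  move=> /andP[op os]; rewrite !big_cons (IH os) -modnMml -modnMmr.
  have : odd (\prod_(j <- s) j) by elim: s os {IH} => [|r s IH] /=; rewrite ?big_nil // big_cons oddM => /andP[-> /IH].
  move: (\prod_(j <- s) j) => m om.
  have : (p %% 4 = 1 \/ p %% 4 = 3)%N by lia.
  have : (m %% 4 = 1 \/ m %% 4 = 3)%N by lia.
  by move=> [->|->] [->|->].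
rewrite /chi2 (_ : q.-1 %% 8 = 7)%N; last by move: q0; rewrite /q; lia.
by case: ifP.
Qed.

(** Primitivity in the form that makes Gauss sums vanish: u is 1 modulo the part of 8d prime to r
    and a nonresidue at r, and multiplication by u does not move the multiples of r. *)
Lemma psi_primitive r k : prime r -> (r %| q)%N -> (r %| k)%N ->
  exists2 u, psi d u = -1 & (k * u = k %[mod q])%N.
Proof.
move=> rp rq rk.
have le1 p u : p \in primes d -> u = 1 %[mod p] -> legendre u p = 1.
  move=> pd h; have pp : prime p by move: pd; rewrite mem_primes => /and3P[].
  by rewrite (legendre_mod pp (odd_conductor_prime pd) h) legendre1 // odd_conductor_prime.
have [rd|nrd] := boolP (r %| d)%N; last first.
  have r2 : r = 2%N.
    move: rq; rewrite Euclid_dvdM // (negPf nrd) orbF (_ : 8 = 2 ^ 3)%N // Euclid_dvdX // andbT.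
    by rewrite dvdn_prime2 // => /eqP.
  have co : coprime 8 d by rewrite (_ : 8 = 2 ^ 3)%N // coprime_pexpl // coprime2n.
  (* Both tables of [chi2] have the value -1 at 5, and 5 k = k mod 8 for even k. *)
  pose u := chinese 8 d 5 1.
  have u8 : (u %% 8 = 5)%N by rewrite chinese_modl.
  have ud : u = 1 %[mod d] by rewrite chinese_modr.
  exists u.
    rewrite /psi big_seq big1 ?mulr1 => [|p pd]; first by rewrite /chi2 u8; case: ifP.
    apply: le1 => //; have pd' : (p %| d)%N by move: pd; rewrite mem_primes => /and3P[].
    by rewrite -(modn_dvdm u pd') ud modn_dvdm.
  apply/eqP; rewrite chinese_remainder //; apply/andP; split; last first.
    by rewrite -modnMmr ud modnMmr muln1.
  rewrite -modnMmr u8; move: rk; rewrite r2; lia.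
have ro : odd r by exact: dvdn_odd rd d_odd.
have [w wr] := legendre_nonres rp ro.
have rpd : r \in primes d by rewrite mem_primes rp d0.
pose e := (d %/ r)%N; have de : d = (r * e)%N by rewrite mulnC divnK.
have re : ~~ (r %| e)%N.
  case/andP: d_sf => _ /allP /(_ r rpd); apply: contra => re.
  by rewrite de dvdn_pmul2l ?prime_gt0.
have co : coprime r (8 * e).
  rewrite prime_coprime // Euclid_dvdM // negb_or re andbT (_ : 8 = 2 ^ 3)%N // Euclid_dvdX //.
  by rewrite andbT dvdn_prime2 //; apply: contraTneq ro => ->.
pose u := chinese r (8 * e) w 1.
have ur : u = w %[mod r] by rewrite chinese_modl.
have ue : u = 1 %[mod 8 * e] by rewrite chinese_modr.
have uk m : (m %| 8 * e)%N -> u = 1 %[mod m].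
  by move=> me; rewrite -(modn_dvdm u me) ue modn_dvdm.
exists u.
  rewrite /psi (bigD1_seq r) //= ?primes_uniq // (legendre_mod rp ro ur) wr big_seq_cond big1 ?mulr1.
    by rewrite /chi2 (uk 8) ?dvdn_mulr //; case: ifP.
  move=> p /andP[pd pr]; apply: le1 => //; apply: uk; rewrite dvdn_mull //.
  move: pd; rewrite mem_primes => /and3P[pp _]; rewrite de Euclid_dvdM // dvdn_prime2 //.
  by rewrite (negPf pr).
have -> : q = (r * (8 * e))%N by rewrite /q de mulnCA.
apply/eqP; rewrite chinese_remainder //; apply/andP; split.
  by rewrite -modnMml -[X in _ == X](modn_dvdm _ (dvdnn r)) (eqP rk) mul0n mod0n.
by rewrite -modnMmr ue modnMmr muln1.
Qed.

End Psi.

(** * Gauss sums and quadratic reciprocity *)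

Section GaussSum.
Variables (F : fieldType) (d : nat) (z : F).
Hypotheses (d_odd : odd d) (d_sf : squarefree d).
Let q := (8 * d)%N.
Hypotheses (z_prim : q.-primitive_root z) (F2 : 2%:R != 0 :> F).

Let q0 : (0 < q)%N. Proof. exact: prim_order_gt0 z_prim. Qed.

(** The field is left open: R[i] gives the functional equation, an algebraic closure of F_p gives
    reciprocity. *)
Definition gauss (k : nat) : F := \sum_(a < q) (psi d a)%:~R * z ^+ (a * k).

Lemma sum_mod_mul (h : nat -> F) u : coprime u q ->
  (forall a, h (a %% q)%N = h a) -> \sum_(a < q) h (a * u)%N = \sum_(a < q) h a.
Proof.
move=> cu hq.
pose f (a : 'I_q) := Ordinal (ltn_pmod (a * u) q0).
have fI : injective f.
  move=> a b /(congr1 val) /= /eqP; rewrite -!/(_ = _ %[mod _]) => /eqP ab.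
  apply/val_inj => /=; wlog le_ab : a b ab / (a <= b)%N.
    by move=> W; case/orP: (leq_total a b) => /W; [apply|move=> h'; symmetry; apply: h'].
  have : (q %| b * u - a * u)%N by rewrite -eqn_mod_dvd ?leq_mul2r ?le_ab ?orbT // ab.
  rewrite -mulnBl Gauss_dvdl; last by rewrite coprime_sym.
  move=> /dvdnP[[|k] hk]; first by apply/eqP; rewrite eqn_leq le_ab /= -subn_eq0 hk.
  by have := ltn_ord b; rewrite -(subnK le_ab) hk; nia.
rewrite [RHS](reindex_inj fI) /=; apply: eq_bigr => a _.
by rewrite hq.
Qed.

Lemma exp_mod (m n : nat) : m = n %[mod q] -> z ^+ m = z ^+ n.
Proof. by move=> h; rewrite -(prim_expr_mod z_prim m) h (prim_expr_mod z_prim). Qed.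

Lemma gauss_shift (u k : nat) : coprime u q -> gauss k = (psi d u)%:~R * gauss (u * k).
Proof.
move=> cu; rewrite /gauss.
rewrite -(sum_mod_mul (h := fun a => (psi d a)%:~R * z ^+ (a * k)) cu).
  rewrite mulr_sumr; apply: eq_bigr => a _.
  by rewrite psiM // rmorphM mulrA (mulrC (psi d u)%:~R) mulnA.
move=> a; rewrite (psi_mod d_odd (n := a)) ?modn_mod //; congr (_ * _).
by apply: exp_mod; rewrite modnMml.
Qed.

(** For k prime to 8d the summation variable is multiplied by k. Otherwise [psi_primitive] yields
    [gauss k = - gauss k], and the characteristic is not 2. *)
Lemma gauss_psi k : gauss k = (psi d k)%:~R * gauss 1.
Proof.
have [ck|nck] := boolP (coprime k q).
  have h := gauss_shift 1 ck; rewrite muln1 in h; rewrite h mulrA -rmorphM.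
  have : psi d k != 0 by rewrite psi_eq0 // ck.
  by have := psi_val d k; rewrite !inE => /or3P[]/eqP->; rewrite ?eqxx ?mulr1 ?mulrNN ?mul1r.
have -> : psi d k = 0 by apply/eqP; rewrite psi_eq0.
rewrite mul0r.
have g1 : (1 < gcdn k q)%N by rewrite ltn_neqAle eq_sym nck gcdn_gt0 q0 orbT.
have := pdiv_dvd (gcdn k q); rewrite dvdn_gcd => /andP[h1 h2].
have [u up uk] := psi_primitive d_odd d_sf (pdiv_prime g1) h2 h1.
have cu : coprime u q by rewrite -[coprime _ _]negbK -psi_eq0 // up.
have := gauss_shift k cu.
have -> : gauss (u * k) = gauss k.
  apply: eq_bigr => a _; congr (_ * _); apply: exp_mod.
  by rewrite (mulnC u) -modnMmr uk modnMmr.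
rewrite up rmorphN mulN1r => /eqP; rewrite -addr_eq0 -mulr2n -mulr_natl mulf_eq0.
by rewrite (negPf F2) => /eqP.
Qed.

(** Absorbing one factor by [gauss_psi] leaves a double sum whose inner sums over roots of unity
    vanish except for b = q - 1, where evenness gives the coefficient 1. *)
Lemma gauss_sqr : gauss 1 ^+ 2 = q%:R.
Proof.
have -> : gauss 1 ^+ 2 = \sum_(a < q) z ^+ a * gauss a.
  rewrite expr2 {1}/gauss mulr_suml; apply: eq_bigr => a _.
  by rewrite (gauss_psi a) muln1; ring.
under eq_bigr do rewrite /gauss mulr_sumr.
rewrite exchange_big /=.
have E (b : 'I_q) : \sum_(a < q) z ^+ a * ((psi d b)%:~R * z ^+ (b * a)) =
    (psi d b)%:~R * \sum_(a < q) (z ^+ b.+1) ^+ a.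
  rewrite mulr_sumr; apply: eq_bigr => a _.
  by rewrite -exprM mulSn exprD; ring.
under eq_bigr do rewrite E.
have qq : (q.-1 < q)%N by rewrite prednK.
rewrite (bigD1 (Ordinal qq)) //= [X in _ + X]big1 ?addr0.
  rewrite psi_opp1 // mul1r prednK // (prim_expr_order z_prim).
  under eq_bigr do rewrite expr1n.
  by rewrite sumr_const card_ord.
move=> b bq; have b1 : z ^+ b.+1 != 1.
  rewrite -(prim_order_dvd z_prim); apply: contra bq => h.
  have := dvdn_leq (ltn0Sn b) h; rewrite -(inj_eq val_inj) /=.
  by have := ltn_ord b; move: (nat_of_ord b) => m; lia.
apply/eqP; rewrite mulf_eq0; apply/orP; right.
have := subrX1 (z ^+ b.+1) q.
rewrite -exprM mulnC exprM (prim_expr_order z_prim) expr1n subrr => /esym/eqP.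
by rewrite mulf_eq0 subr_eq0 (negPf b1).
Qed.
End GaussSum.

Section Reciprocity.
Variable d : nat.
Hypotheses (d_odd : odd d) (d_sf : squarefree d).
Let q := (8 * d)%N.

Lemma closed_prim_root (F : closedFieldType) (n : nat) : (0 < n)%N -> n%:R != 0 :> F ->
  exists z : F, n.-primitive_root z.
Proof.
move=> n0 nF; have := separable_Xn_sub_1 nF.
have mon : ('X^n - 1 : {poly F}) \is monic by exact: monicXnsubC.
have [rs E] := closed_field_poly_normal ('X^n - 1 : {poly F}).
rewrite (monicP mon) scale1r in E; rewrite E separable_prod_XsubC => urs.
have : has n.-primitive_root rs.
  apply: cyclic.has_prim_root => //.
    apply/allP => x xr; rewrite unity_rootE.
    have : root ('X^n - 1) x by rewrite E root_prod_XsubC.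
    by rewrite rootE !hornerE subr_eq0.
  by rewrite -ltnS -(size_prod_XsubC rs id) -E size_XnsubC.
by case/hasP => z _ hz; exists z.
Qed.

(* The Gauss sum g, taken in an algebraic closure of F_p, satisfies g^2 = 8d and,
   by Frobenius, g^p = psi(p) g. *)
Lemma kronecker_prime_psi p : prime p -> kronecker_prime q%:Z p = psi d p.
Proof.
move=> pp; rewrite /kronecker_prime; case: eqP => [->|/eqP p2].
  have -> : (2 %| q%:Z)%Z by rewrite dvdzE /= /q dvdn_mulr.
  by apply/esym/eqP; rewrite psi_eq0 // /q coprimeMr.
have po : odd p by case: (even_prime pp) => // h; rewrite h in p2.
have [pq|npq] := boolP (p %| q)%N.
  have -> : psi d p = 0.
    apply/eqP; rewrite psi_eq0 // prime_coprime // negbK //.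
  by apply/eqP; rewrite legendre_eq0.
have [K [iota _]] := countable_algebraic_closure 'F_p.
have chK : p \in [pchar K] by rewrite (fmorph_pchar iota) pchar_Fp.
have q0 : (0 < q)%N by rewrite muln_gt0 /=; case/andP: d_sf.
have qK : q%:R != 0 :> K by rewrite -(dvdn_pcharf chK).
have F2 : 2%:R != 0 :> K by rewrite -(dvdn_pcharf chK) dvdn_prime2 // eq_sym.
have [z hz] := closed_prim_root q0 qK.
have g2 := gauss_sqr d_odd d_sf hz F2.
have gp := gauss_psi d_odd d_sf hz F2 p.
set g := gauss d z 1 in g2 gp.
have g0 : g != 0 by apply: contraNneq qK => g0; rewrite -g2 g0 expr0n.
apply: (pchar_neq pp po chK); rewrite ?legendre_val ?psi_val // legendre_euler //.
apply: (mulIf g0); rewrite -gp -pmulrn -g2 -exprM -exprSr.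
have -> : (2 * p./2).+1 = p by rewrite mul2n -[RHS]odd_double_half po.
rewrite -(pFrobenius_autE chK) /g /gauss rmorph_sum; apply: eq_bigr => a _.
rewrite rmorphM /= rmorph_int pFrobenius_autE muln1 -exprM //.
Qed.

Lemma kronecker_psi n : (0 < n)%N -> kronecker q%:Z n = psi d n.
Proof.
move=> n0; rewrite /kronecker.
have psiX m k : psi d (m ^ k) = psi d m ^+ k.
  elim: k => [|k IH]; first by rewrite expn0 expr0 psi1.
  by rewrite expnS exprS psiM // IH.
rewrite [in RHS](prod_prime_decomp n0) prime_decompE big_map /=.
rewrite (big_morph (psi d) (psiM d_odd) (psi1 d_odd)).
apply: eq_big_seq => p; rewrite mem_primes => /and3P[pp _ _].
by rewrite kronecker_prime_psi // psiX.
Qed.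
End Reciprocity.

(** * Summation by parts *)

Section Abel.
Variable R : realType.
Implicit Types (c a : nat -> R) (C : R).

Definition bounded_sums c C := forall M N, `|\sum_(M <= i < N) c i| <= C.

Lemma abel_bound c C a (M N : nat) : bounded_sums c C ->
  (forall i, (M <= i < N)%N -> 0 <= a i) ->
  (forall i, (M <= i)%N -> (i.+1 < N)%N -> a i.+1 <= a i) -> (M < N)%N ->
  `|\sum_(M <= i < N) c i * a i| <= C * a M.
Proof.
move=> bc a0 da MN.
have C0 : 0 <= C by apply: le_trans (bc 0%N 0%N).
(* Invariant of summation by parts: the part T accumulated so far is bounded by C times the total
   decrease of a. *)
suff K k : (M + k < N)%N -> exists2 T : R, \sum_(M <= i < (M + k).+1) c i * a i =
    (\sum_(M <= i < (M + k).+1) c i) * a (M + k)%N + T & `|T| <= C * (a M - a (M + k)%N).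
  have NE : (M + (N - M.+1)).+1 = N by rewrite -addSn subnKC.
  have [|T E hT] := K (N - M.+1)%N; first by rewrite -[X in (_ < X)%N]NE.
  rewrite NE in E; rewrite E (le_trans (ler_normD _ _)) // normrM.
  have aN : 0 <= a (M + (N - M.+1))%N by apply: a0; rewrite leq_addr -[X in (_ < X)%N]NE ltnS leqnn.
  rewrite (ger0_norm aN).
  have := ler_wpM2r aN (bc M N); move: hT; rewrite mulrBr; lra.
elim: k => [|k IH] hk.
  by exists 0; rewrite ?addn0 ?big_nat1 ?addr0 // subrr mulr0 normr0.
have [|T E hT] := IH; first by apply: leq_trans hk; rewrite ltnS addnS.
rewrite addnS in hk *.
exists (T + (\sum_(M <= i < (M + k).+1) c i) * (a (M + k)%N - a (M + k).+1)).
  rewrite big_nat_recr /= ?(leq_trans (leq_addr k M)) // E [in RHS]big_nat_recr /= ?(leq_trans (leq_addr k M)) //.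
  by ring.
have d : 0 <= a (M + k)%N - a (M + k).+1 by rewrite subr_ge0 da // leq_addr.
rewrite (le_trans (ler_normD _ _)) // normrM (ger0_norm d).
have := ler_wpM2r d (bc M (M + k).+1); move: hT; rewrite !mulrBr; lra.
Qed.

Definition asum c a : R := limn (fun N => \sum_(0 <= i < N) c i * a i).

Section Convergence.
Variables (c a : nat -> R) (C : R).
Hypotheses (bc : bounded_sums c C) (c0 : c 0%N = 0).
Hypotheses (a0 : forall i, (0 < i)%N -> 0 <= a i).
Hypothesis (da : forall i, (0 < i)%N -> a i.+1 <= a i).
Hypothesis (a_to0 : a @ \oo --> (0 : R)).

Let C0 : 0 <= C. Proof. by apply: le_trans (bc 0%N 0%N). Qed.

Lemma abel_tail (M N : nat) : (0 < M)%N -> (M <= N)%N ->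
  `|\sum_(0 <= i < N) c i * a i - \sum_(0 <= i < M) c i * a i| <= C * a M.
Proof.
move=> M0 MN; rewrite (big_cat_nat (leq0n M) MN) /= addrAC subrr add0r.
have [NM|MN'] := leqP N M; first by rewrite big_geq // normr0 mulr_ge0 // a0.
apply: abel_bound => // [i /andP[Mi _]|i Mi _]; [apply: a0|apply: da];
  exact: leq_trans Mi.
Qed.

Lemma asum_cvg : (fun N => \sum_(0 <= i < N) c i * a i) @ \oo --> asum c a.
Proof.
have [|l hl] := @real_cauchy R (fun N => \sum_(0 <= i < N) c i * a i).
  move=> e e0; have C1 : 0 < C + 1 by rewrite ltr_wpDl.
  have e1 : 0 < e / (C + 1) by rewrite divr_gt0.
  have /cvgrPdist_le/(_ _ e1)[N0 _ hN0] := a_to0.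
  have key n m : (N0.+1 <= n)%N -> (n <= m)%N ->
    `|\sum_(0 <= i < m) c i * a i - \sum_(0 <= i < n) c i * a i| <= e.
    move=> hn nm; have n0 : (0 < n)%N by exact: leq_ltn_trans hn.
    rewrite (le_trans (abel_tail n0 nm)) //.
    have := hN0 n (ltnW hn); rewrite /= sub0r normrN ger0_norm ?a0 // ler_pdivlMr // => h.
    by have := a0 n0; rewrite mulrDr mulr1 mulrC in h; lra.
  exists N0.+1 => n m hn hm; have [nm|/ltnW mn] := leqP n m; last exact: key.
  by rewrite distrC key.
by rewrite /asum; have -> := cvg_lim (@norm_hausdorff _ _) hl.
Qed.

Lemma asum_tail (M : nat) : (0 < M)%N ->
  `|asum c a - \sum_(0 <= i < M) c i * a i| <= C * a M.
Proof.
move=> M0; set b := \sum_(0 <= i < M) c i * a i.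
have h : (fun N => `|\sum_(0 <= i < N) c i * a i - b|) @ \oo --> `|asum c a - b|.
  by apply: cvg_norm; apply: cvgB; [exact: asum_cvg|exact: cvg_cst].
rewrite -(cvg_lim (@norm_hausdorff _ _) h); apply: limr_le; first by apply/cvg_ex; eexists; exact: h.
by near=> N; apply: abel_tail => //; near: N; exists M.
Unshelve. all: by end_near. Qed.

Lemma asum_partial_bound (N : nat) : `|\sum_(0 <= i < N) c i * a i| <= C * a 1%N.
Proof.
have h1 : \sum_(0 <= i < 1) c i * a i = 0 by rewrite big_nat1 c0 mul0r.
case: N => [|N]; first by rewrite big_geq // normr0 mulr_ge0 // a0.
by have := abel_tail (ltn0Sn 0) (ltn0Sn N); rewrite h1 subr0.
Qed.
End Convergence.
End Abel.

Section PsiSums.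
Variables (R : realType) (d : nat).
Hypotheses (d_odd : odd d) (d_sf : squarefree d).
Let q := (8 * d)%N.
Let d0 : (0 < d)%N. Proof. by case/andP: d_sf. Qed.
Let q0 : (0 < q)%N. Proof. by rewrite muln_gt0. Qed.

Definition psiR (n : nat) : R := (psi d n)%:~R.

Lemma psi0 : psi d 0 = 0.
Proof.
apply/eqP; rewrite psi_eq0 // /coprime gcd0n.
by apply/eqP => h; have := leq_pmulr 8 d0; rewrite h.
Qed.

Lemma psi_modq n : psi d (n %% q) = psi d n.
Proof. by apply: psi_mod; rewrite ?modn_mod. Qed.

(** The sum is [gauss 0], taken in R[i], which equals psi(0) times [gauss 1]. *)
Lemma sum_psi_period : \sum_(0 <= i < q) psi d i = 0.
Proof.
have q_neq0 : q%:R != 0 :> R[i] by rewrite -cmod_gt0 cmod_nat ltr0n.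
have [z hz] := closed_prim_root q0 q_neq0.
have F2 : 2%:R != 0 :> R[i] by rewrite -cmod_gt0 cmod_nat ltr0n.
have := gauss_psi d_odd d_sf hz F2 0; rewrite psi0 mul0r => h.
apply: (@intr_inj R[i]); rewrite rmorph_sum /= -[RHS]h big_mkord.
by apply: eq_bigr => i _; rewrite muln0 expr0 mulr1.
Qed.

Lemma sum_block (V : nmodType) (F : nat -> V) (n k : nat) :
  \sum_(0 <= i < n * k) F i = \sum_(0 <= b < n) \sum_(0 <= a < k) F (b * k + a)%N.
Proof.
elim: n => [|n IH]; first by rewrite mul0n !big_geq.
rewrite big_nat_recr //= -IH mulSn addnC (big_cat_nat (n := n * k)) ?leq_addr //=; congr (_ + _).
by rewrite -{1}[(n * k)%N]add0n big_addn addKn; apply: eq_bigr => a _; rewrite addnC.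
Qed.

Lemma sum_psiR_mod N : \sum_(0 <= i < N) psiR i = \sum_(0 <= i < N %% q) psiR i.
Proof.
rewrite {1}(divn_eq N q) (big_cat_nat (n := N %/ q * q)) ?leq_addr //= sum_block.
rewrite big1 ?add0r => [|b _].
  rewrite -{1}[(N %/ q * q)%N]add0n big_addn addKn; apply: eq_bigr => i _.
  by rewrite /psiR -psi_modq addnC modnMDl psi_modq.
under eq_bigr do rewrite /psiR -psi_modq modnMDl psi_modq.
by rewrite -rmorph_sum sum_psi_period.
Qed.

Lemma normr_psiR n : `|psiR n| <= 1.
Proof.
rewrite /psiR; have := psi_val d n; rewrite !inE => /or3P[]/eqP->.
- by rewrite rmorphN normrN normr1.
- by rewrite normr0.
- by rewrite normr1.
Qed.

Lemma bounded_psiR : bounded_sums psiR (2 * q%:R).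
Proof.
have B N : `|\sum_(0 <= i < N) psiR i| <= q%:R.
  rewrite sum_psiR_mod (le_trans (ler_norm_sum _ _ _)) //.
  apply: (@le_trans _ _ (\sum_(0 <= i < N %% q) (1 : R))).
    by apply: ler_sum => i _; exact: normr_psiR.
  by rewrite big_const_nat subn0 iter_addr_0 ler_nat ltnW // ltn_mod.
move=> M N; have [NM|/ltnW MN] := leqP N M; first by rewrite big_geq // normr0 mulr_ge0.
have -> : \sum_(M <= i < N) psiR i = \sum_(0 <= i < N) psiR i - \sum_(0 <= i < M) psiR i.
  by rewrite (big_cat_nat (leq0n M) MN) /= addrAC subrr add0r.
rewrite (le_trans (ler_normB _ _)) // mulr_natl mulr2n lerD //.
Qed.
End PsiSums.

Lemma seq_cvg_sum (R : realType) (I : Type) (r : seq I) (f : I -> nat -> R) (l : I -> R) :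
  (forall i, f i @ \oo --> l i) ->
  (fun n => \sum_(i <- r) f i n) @ \oo --> \sum_(i <- r) l i.
Proof.
move=> h; elim: r => [|i r IH].
  by rewrite big_nil; under eq_fun do rewrite big_nil; exact: cvg_cst.
by rewrite big_cons; under eq_fun do rewrite big_cons; apply: cvgD.
Qed.

Section RootsOfUnity.
Variable R : realType.

Definition zetaC (N : nat) : R[i] := cexp (Complex 0 (pi *+ 2 / N%:R)).

Lemma zetaCX N k : zetaC N ^+ k = cexp (Complex 0 (k%:R * (pi *+ 2 / N%:R))).
Proof.
rewrite -cexpMn; congr cexp; rewrite (_ : k%:R = (k%:R)%:C :> R[i]); last by rewrite rmorph_nat.
by apply: complex_ext => /=; ring.
Qed.

Lemma re_zetaCX N k : re (zetaC N ^+ k) = cos (k%:R * (pi *+ 2 / N%:R)).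
Proof. by rewrite zetaCX /cexp /= expR0 mul1r mul0r subr0. Qed.

Lemma cos_double_sin (x : R) : cos (x *+ 2) = 1 - 2 * sin x ^+ 2.
Proof. by rewrite cos_mulr2n cos2sin2; ring. Qed.

Lemma zetaC_prim N : (0 < N)%N -> N.-primitive_root (zetaC N).
Proof.
move=> N0; have Nn : N%:R != 0 :> R by rewrite pnatr_eq0 -lt0n.
have zN : zetaC N ^+ N = 1.
  by rewrite zetaCX mulrC divfK // -(add0r (Complex _ _)) cexp_2pi cexp0.
rewrite /primitive_root_of_unity N0; apply/forallP => i.
rewrite unity_rootE; have [->|iN] := eqVneq i.+1 N; first by rewrite zN eqxx.
have i1 : (i.+1 < N)%N by rewrite ltn_neqAle iN ltn_ord.
apply/eqP/negbTE/eqP => /(congr1 (@complex.Re R)); rewrite re_zetaCX.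
have -> : i.+1%:R * (pi *+ 2 / N%:R) = (i.+1%:R / N%:R * pi) *+ 2 :> R.
  by rewrite -[pi *+ 2]mulr_natl -[_ *+ 2 in RHS]mulr_natl; ring.
rewrite cos_double_sin /= => h.
have : 0 < sin (i.+1%:R / N%:R * pi : R).
  apply: sin_gt0_pi; rewrite mulr_gt0 ?pi_gt0 ?divr_gt0 ?ltr0n //=.
  by rewrite gtr_pMl ?pi_gt0 // ltr_pdivrMr ?ltr0n // mul1r ltr_nat.
by move: h; nra.
Qed.

Lemma zetaC_expM m q : (0 < m)%N -> zetaC (m * q) ^+ m = zetaC q.
Proof.
move=> m0; rewrite zetaCX /zetaC; congr (cexp (Complex _ _)).
by rewrite natrM invfM mulrCA mulVKf // pnatr_eq0 -lt0n.
Qed.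
End RootsOfUnity.

(** * The functional equation *)

Section Poisson.
Variable R : realType.
Implicit Types (y th : R).

Definition poisson y th := (1 - y ^+ 2) / (1 - 2 * y * cos th + y ^+ 2).

(** Partial sum of 1 + 2 sum y^j cos (j th) over j >= 1; the -1 corrects the term j = 0, which the
    factor 2 counts twice. *)
Definition poisson_sum y th K := -1 + 2 * \sum_(0 <= j < K) y ^+ j * cos (j%:R * th).

Lemma poisson_sumE y th K : (1 - 2 * y * cos th + y ^+ 2) * poisson_sum y th K.+1 =
  1 - y ^+ 2 - 2 * y ^+ K.+1 * cos (K.+1%:R * th) + 2 * y ^+ K.+2 * cos (K%:R * th).
Proof.
elim: K => [|K IH].
  by rewrite /poisson_sum big_nat1 !mul0r cos0 !mul1r; ring.
have -> : poisson_sum y th K.+2 = poisson_sum y th K.+1 + 2 * (y ^+ K.+1 * cos (K.+1%:R * th)).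
  by rewrite /poisson_sum big_nat_recr //=; ring.
have c2 : cos (K.+2%:R * th) = 2 * cos th * cos (K.+1%:R * th) - cos (K%:R * th).
  have -> : K.+2%:R * th = K.+1%:R * th + th by rewrite -[K.+2%:R]natr1; ring.
  have -> : K%:R * th = K.+1%:R * th - th by rewrite -[K.+1%:R]natr1; ring.
  by rewrite cosD cosB; ring.
by rewrite mulrDr IH c2 !exprS; ring.
Qed.

Lemma poisson_den y th : 0 <= y < 1 -> (1 - y) ^+ 2 <= 1 - 2 * y * cos th + y ^+ 2.
Proof. by move=> /andP[y0 _]; have := cos_le1 th; nra. Qed.

Lemma poisson_den_gt0 y th : 0 <= y < 1 -> 0 < 1 - 2 * y * cos th + y ^+ 2.
Proof.
move=> hy; rewrite (lt_le_trans _ (poisson_den th hy)) // exprn_gt0 // subr_gt0.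
by case/andP: hy.
Qed.

Lemma poisson_cvg y th : 0 <= y < 1 ->
  (fun K => poisson_sum y th K.+1) @ \oo --> poisson y th.
Proof.
move=> hy; have D0 := poisson_den_gt0 th hy; set D := 1 - _ + _ in D0.
have /andP[y0 y1] := hy.
have yK : (fun K => 4 / D * y ^+ K) @ \oo --> (0 : R).
  rewrite -[X in _ --> X](mulr0 (4 / D)); apply: cvgM; first exact: cvg_cst.
  by apply: cvg_expr; rewrite ger0_norm.
apply/cvgrPdist_le => e e0; have /cvgrPdist_le/(_ _ e0) := yK.
apply: filterS => K; rewrite sub0r normrN /= => h; apply: le_trans h.
have Y0 : 0 <= y ^+ K by rewrite exprn_ge0.
rewrite (ger0_norm (_ : 0 <= 4 / D * y ^+ K)); last by rewrite mulr_ge0 // divr_ge0 // ltW.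
have -> : poisson y th - poisson_sum y th K.+1 =
    (2 * (y * y ^+ K) * cos (K.+1%:R * th) - 2 * (y * y * y ^+ K) * cos (K%:R * th)) / D.
  apply: (mulIf (lt0r_neq0 D0)); rewrite divfK ?lt0r_neq0 // mulrBl [poisson_sum _ _ _ * _]mulrC poisson_sumE.
  by rewrite /poisson divfK ?lt0r_neq0 // !exprS; ring.
rewrite normrM normfV (gtr0_norm D0) [leRHS]mulrAC ler_wpM2r ?invr_ge0 ?(ltW D0) //.
rewrite (le_trans (ler_normB _ _)) // !normrM (ger0_norm y0) (ger0_norm Y0) (ger0_norm (ler0n R 2)).
have c1 := cos_max (K.+1%:R * th); have c2 := cos_max (K%:R * th).
have n1 := normr_ge0 (cos (K.+1%:R * th)); have n2 := normr_ge0 (cos (K%:R * th)).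
have e1 : y * y ^+ K * `|cos (K.+1%:R * th)| <= 1 * y ^+ K * 1.
  by rewrite ler_pM ?mulr_ge0 // ler_wpM2r // ltW.
have e2 : y * y * y ^+ K * `|cos (K%:R * th)| <= 1 * 1 * y ^+ K * 1.
  by rewrite ler_pM ?mulr_ge0 // ler_wpM2r // ler_pM // ltW.
rewrite -!mulrA in e1 e2 *; lra.
Qed.
End Poisson.

Section PartialFractions.
Variables (R : realType) (d : nat).
Hypotheses (d_odd : odd d) (d_sf : squarefree d).
Let q := (8 * d)%N.
Let d0 : (0 < d)%N. Proof. by case/andP: d_sf. Qed.
Let q0 : (0 < q)%N. Proof. by rewrite muln_gt0. Qed.
Let chi := psiR R d.

(** Real part, because [gauss_psi] is applied to sums of cosines, which are real parts of sums of
    powers of the root of unity. *)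
Definition tau : R := re (gauss d (zetaC R q) 1).

(** Over m periods the angle is m times finer than the character resolves. Writing k = b q + a, the
    sum over b is a sum of powers of an m-th root of unity and selects the multiples of m; the sum
    over a is a Gauss sum. *)
Lemma sum_psi_cos m j : (0 < m)%N ->
  \sum_(0 <= k < m * q) chi k * cos (j%:R * (k%:R * (pi *+ 2 / (m * q)%:R))) =
  if (m %| j)%N then m%:R * chi (j %/ m)%N * tau else 0.
Proof.
move=> m0; have N0 : (0 < m * q)%N by rewrite muln_gt0 m0.
have zN := zetaC_prim R N0; set z := zetaC R (m * q) in zN.
have F2 : 2%:R != 0 :> R[i] by rewrite -cmod_gt0 cmod_nat ltr0n.
have -> : \sum_(0 <= k < m * q) chi k * cos (j%:R * (k%:R * (pi *+ 2 / (m * q)%:R))) =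
    re (\sum_(0 <= k < m * q) (chi k)%:C * z ^+ (k * j)).
  rewrite (big_morph (@complex.Re R) (@reD R) (erefl _)); apply: eq_bigr => k _.
  by rewrite reM /= mul0r subr0 re_zetaCX [(k * j)%:R]natrM; congr (_ * cos _); ring.
rewrite sum_block.
have -> : \sum_(0 <= b < m) \sum_(0 <= a < q) (chi (b * q + a)%N)%:C * z ^+ ((b * q + a) * j) =
    (\sum_(0 <= b < m) (z ^+ (q * j)) ^+ b) * (\sum_(0 <= a < q) (chi a)%:C * z ^+ (a * j)).
  rewrite mulr_suml; apply: eq_bigr => b _; rewrite mulr_sumr; apply: eq_bigr => a _.
  rewrite /chi /psiR -(psi_modq d_odd (b * q + a)) modnMDl psi_modq // mulnDl exprD -exprM.
  by rewrite (mulnC (q * j)%N) mulnA; ring.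
case: ifPn => [/dvdnP[i ->]|mj].
  have -> : z ^+ (q * (i * m)) = 1.
    by rewrite mulnCA (mulnC q) mulnC exprM (prim_expr_order zN) expr1n.
  under eq_bigr do rewrite expr1n.
  rewrite mulnK // big_const_nat subn0 iter_addr_0.
  have -> : \sum_(0 <= a < q) (chi a)%:C * z ^+ (a * (i * m)) = gauss d (zetaC R q) i.
    rewrite big_mkord; apply: eq_bigr => a _; rewrite -(zetaC_expM R q m0) -exprM.
    by rewrite /chi /psiR rmorph_int; congr (_ * _ ^+ _); rewrite mulnA mulnC.
  rewrite (gauss_psi d_odd d_sf (zetaC_prim R q0) F2).
  have -> : (m%:R : R[i]) = (m%:R)%:C by rewrite rmorph_nat.
  have -> : ((psi d i)%:~R : R[i]) = (chi i)%:C by rewrite /chi /psiR rmorph_int.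
  by rewrite reM /= mul0r subr0 reM /= mul0r subr0 mulrA.
have w1 : z ^+ (q * j) != 1.
  rewrite -(prim_order_dvd zN) (mulnC m) dvdn_pmul2l //.
have -> : \sum_(0 <= b < m) (z ^+ (q * j)) ^+ b = 0; last by rewrite mul0r.
have := subrX1 (z ^+ (q * j)) m.
rewrite -exprM mulnC mulnA exprM (prim_expr_order zN) expr1n subrr big_mkord => /esym/eqP.
by rewrite mulf_eq0 subr_eq0 (negPf w1) => /eqP.
Qed.

Lemma sum_psi_poisson_sum m y J : (0 < m)%N -> (0 < J)%N ->
  \sum_(0 <= k < m * q) chi k * poisson_sum y (k%:R * (pi *+ 2 / (m * q)%:R)) (J * m) =
  2 * m%:R * tau * \sum_(0 <= b < J) chi b * (y ^+ m) ^+ b.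
Proof.
move=> m0 J0.
have S0 : \sum_(0 <= k < m * q) chi k = 0.
  have := sum_psi_cos 0 m0; rewrite dvdn0 div0n [chi 0%N]/chi /psiR psi0 // mulr0 mul0r => h.
  by rewrite -[RHS]h; apply: eq_bigr => k _; rewrite mul0r cos0 mulr1.
have -> : \sum_(0 <= k < m * q) chi k * poisson_sum y (k%:R * (pi *+ 2 / (m * q)%:R)) (J * m) =
    - \sum_(0 <= k < m * q) chi k + 2 * \sum_(0 <= j < J * m) y ^+ j *
      \sum_(0 <= k < m * q) chi k * cos (j%:R * (k%:R * (pi *+ 2 / (m * q)%:R))).
  rewrite [X in _ + 2 * X](_ : _ = \sum_(0 <= k < m * q) \sum_(0 <= j < J * m)
      y ^+ j * (chi k * cos (j%:R * (k%:R * (pi *+ 2 / (m * q)%:R))))); last first.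
    by rewrite exchange_big; apply: eq_bigr => j _; rewrite mulr_sumr.
  rewrite mulr_sumr -sumrN -big_split /=; apply: eq_bigr => k _.
  rewrite /poisson_sum mulrDr mulrN1; congr (_ + _).
  rewrite mulrCA; congr (_ * _); rewrite mulr_sumr; apply: eq_bigr => j _; ring.
rewrite S0 oppr0 add0r -!mulrA; congr (_ * _); rewrite sum_block !mulr_sumr.
apply: eq_bigr => b _; rewrite big_ltn // sum_psi_cos // addn0 dvdn_mull // mulnK //.
rewrite big_nat_cond big1 => [|a /andP[/andP[a0 am] _]].
  by rewrite addr0 -exprM (mulnC m); ring.
rewrite sum_psi_cos // dvdn_addr ?dvdn_mull // gtnNdvd // mulr0 //.
Qed.

Lemma bounded_chi : bounded_sums chi (2 * q%:R).
Proof. exact: bounded_psiR. Qed.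

Lemma chi0 : chi 0%N = 0.
Proof. by rewrite /chi /psiR psi0. Qed.

Definition lambert (t : R) := asum chi (fun i => expR (- (t * i%:R))).

Lemma exp_to0 (t : R) : 0 < t -> (fun i : nat => expR (- (t * i%:R))) @ \oo --> (0 : R).
Proof.
move=> t0; have -> : (fun i : nat => expR (- (t * i%:R))) = fun i => expR (- t) ^+ i.
  by apply/funext => i; rewrite -expRM_natl; congr expR; ring.
by apply: cvg_expr; rewrite ger0_norm ?expR_ge0 // -[ltRHS]expR0 ltr_expR oppr_lt0.
Qed.

Lemma exp_decr (t : R) i : 0 < t -> expR (- (t * i.+1%:R)) <= expR (- (t * i%:R)).
Proof. by move=> t0; rewrite ler_expR lerN2 ler_pM2l // ler_nat. Qed.

Lemma lambert_cvg t : 0 < t ->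
  (fun N => \sum_(0 <= i < N) chi i * expR (- (t * i%:R))) @ \oo --> lambert t.
Proof.
move=> t0; apply: (asum_cvg bounded_chi) (exp_to0 t0).
- by move=> i _; exact: expR_ge0.
- by move=> i _; exact: exp_decr.
Qed.

(** Only the powers y^(m b) survive the sum over k, so the radius y = exp (-t/m) produces exp (-t
    b), whatever m is. That leaves m free to tend to infinity. *)
Lemma sum_psi_poisson m t : (0 < m)%N -> 0 < t ->
  \sum_(0 <= k < m * q) chi k * poisson (expR (- t / m%:R)) (k%:R * (pi *+ 2 / (m * q)%:R)) =
  2 * m%:R * tau * lambert t.
Proof.
move=> m0 t0; set y := expR _.
have mR : 0 < m%:R :> R by rewrite ltr0n.
have hy : 0 <= y < 1.
  by rewrite expR_ge0 -[ltRHS]expR0 ltr_expR mulNr oppr_lt0 divr_gt0.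
have h1 : (fun J => \sum_(0 <= k < m * q) chi k * poisson_sum y (k%:R * (pi *+ 2 / (m * q)%:R)) (J.+1 * m))
    @ \oo --> \sum_(0 <= k < m * q) chi k * poisson y (k%:R * (pi *+ 2 / (m * q)%:R)).
  apply: seq_cvg_sum => k; apply: cvgM; first exact: cvg_cst.
  have h := @poisson_cvg R y (k%:R * (pi *+ 2 / (m * q)%:R)) hy.
  apply/cvgrPdist_le => e e0; have /cvgrPdist_le/(_ _ e0)[K0 _ hK] := h.
  exists K0 => // J /= KJ; have E : (J.+1 * m)%N = (J.+1 * m).-1.+1 by rewrite prednK // muln_gt0.
  rewrite E; apply: hK => /=; rewrite -ltnS -E.
  by rewrite (leq_trans (_ : K0 < J.+1)%N) // leq_pmulr.
have h2 : (fun J => \sum_(0 <= k < m * q) chi k * poisson_sum y (k%:R * (pi *+ 2 / (m * q)%:R)) (J.+1 * m))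
    @ \oo --> 2 * m%:R * tau * lambert t.
  have -> : (fun J => \sum_(0 <= k < m * q) chi k * poisson_sum y (k%:R * (pi *+ 2 / (m * q)%:R)) (J.+1 * m)) =
      (fun J => 2 * m%:R * tau * \sum_(0 <= b < J.+1) chi b * expR (- (t * b%:R))).
    apply/funext => J; rewrite sum_psi_poisson_sum //; congr (_ * _).
    apply: eq_bigr => b _; congr (_ * _); rewrite -exprM -expRM_natl; congr expR.
    by rewrite natrM; field; rewrite gt_eqF.
  apply: cvgM; first exact: cvg_cst.
  have := lambert_cvg t0; rewrite -(cvg_shiftS (fun N => \sum_(0 <= i < N) chi i * expR (- (t * i%:R)))).
  exact.
exact: cvg_unique h1 h2.
Qed.
End PartialFractions.

Lemma derive_seq (R : realType) (g : R -> R) (l : R) : is_derive (0 : R) 1 g l -> g 0 = 0 ->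
  (fun n => n.+1%:R * g (n.+1%:R^-1)) @ \oo --> l.
Proof.
move=> /is_deriveP H g0; apply/cvgrPdist_le => e e0; have [d dp {}H] := H e e0.
have d0 : 0 <= d^-1 by rewrite invr_ge0 ltW.
exists (Num.bound d^-1) => // n /= hn.
have n0 : 0 < n.+1%:R :> R by rewrite ltr0n.
have nd : `|n.+1%:R^-1| < d.
  rewrite ger0_norm ?invr_ge0 // -[ltRHS]invrK ltf_pV2 ?posrE ?invr_gt0 //.
  by rewrite (lt_trans (archi_boundP d0)) // ltr_nat ltnS.
have := H _ nd; rewrite add0r g0 subr0 (ger0_norm (_ : 0 <= n.+1%:R^-1)) ?invr_ge0 //.
rewrite -(ler_pM2l n0) mulrCA divff ?gt_eqF // mulr1; apply: le_trans.
have -> : l - n.+1%:R * g n.+1%:R^-1 = - (n.+1%:R * (g n.+1%:R^-1 - l * n.+1%:R^-1)).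
  by field; rewrite gt_eqF.
by rewrite normrN normrM (gtr0_norm n0).
Qed.

(* The Poisson kernels of radius exp(-t/m), summed against the character over a
   period of length m * 8d, tend term by term to the partial fractions. *)
Section PartialFractionLimit.
Variables (R : realType) (d : nat).
Hypotheses (d_odd : odd d) (d_sf : squarefree d).
Let q := (8 * d)%N.
Let d0 : (0 < d)%N. Proof. by case/andP: d_sf. Qed.
Let q0 : (0 < q)%N. Proof. by rewrite muln_gt0. Qed.
Let chi := psiR R d.
Let tau := tau R d.

Definition alpha (k : nat) : R := k%:R * (pi *+ 2 / q%:R).
Definition pfrac (t : R) (k : nat) : R := 2 * t / (t ^+ 2 + alpha k ^+ 2).

Let w (t : R) (m k : nat) : R :=
  poisson (expR (- t / m%:R)) (k%:R * (pi *+ 2 / (m * q)%:R)) / m%:R.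

Let H m := (m * (4 * d))%N.
Let NE m : (m * q = H m + H m)%N. Proof. by rewrite /H /q; lia. Qed.

(** The terms k and m q - k agree because psi and cos are even, and the end points 0 and m q / 2 are
    even numbers, where psi is 0. Half a period is used because the kernel is monotone there. *)
Lemma half_sum (t : R) m : (0 < m)%N -> 0 < t ->
  \sum_(0 <= k < H m) chi k * w t m k = tau * lambert d t.
Proof.
move=> m0 t0; have := sum_psi_poisson d_odd d_sf m0 t0; rewrite -/q -/chi -/tau.
pose F k := chi k * poisson (expR (- t / m%:R)) (k%:R * (pi *+ 2 / (m * q)%:R)).
rewrite -/(F _); have -> : \sum_(0 <= k < m * q) F k = \sum_(0 <= k < H m) F k + \sum_(0 <= k < H m) F k.
  rewrite NE (big_cat_nat (n := H m)) ?leq_addr //=; congr (_ + _).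
  have F0 : F 0%N = 0 by rewrite /F /chi /psiR psi0 // mul0r.
  have FH : F (H m) = 0.
    rewrite /F /chi /psiR (_ : psi d (H m) = 0) ?mul0r //; apply/eqP; rewrite psi_eq0 //.
    apply/negP => /eqP h; have : (2 %| gcdn (H m) (8 * d))%N.
      by rewrite dvdn_gcd /H (dvdn_mull _ (dvdn_mulr d (isT : 2 %| 4)%N)) dvdn_mulr.
    by rewrite h.
  have Fsym k : (k.+1 <= m * q)%N -> F (m * q - k.+1)%N = F k.+1.
    move=> kN; rewrite /F; congr (_ * _).
      rewrite /chi /psiR; congr (_%:~R).
      rewrite -[RHS]mul1r -(psi_opp1 d_odd d_sf) -psiM //; apply: psi_mod => //.
      apply/eqP; rewrite -(eqn_modDr k.+1) subnK // modnMl -mulSnr prednK //.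
      by rewrite modnMr.
    rewrite /poisson; suff -> : cos ((m * q - k.+1)%:R * (pi *+ 2 / (m * q)%:R) : R) =
        cos (k.+1%:R * (pi *+ 2 / (m * q)%:R)) by [].
    rewrite natrB // mulrBl mulrC divfK; last by rewrite pnatr_eq0 -lt0n muln_gt0 m0.
    by rewrite addrC cosD2pi cosN.
  have -> : \sum_(H m <= k < H m + H m) F k = \sum_(0 <= k < H m) F k.+1.
    rewrite -{1}[H m]add0n big_addn addnK big_nat_rev; apply: eq_big_nat => k /andP[_ kH].
    rewrite add0n; have E : (H m - k.+1 + H m = m * q - k.+1)%N by rewrite NE; move: kH; clear; lia.
    have kN : (k.+1 <= m * q)%N by rewrite NE; move: kH; clear; lia.
    rewrite E; exact: Fsym.
  have := @big_nat_recl _ 0 +%R (H m) 0 F (leq0n _); rewrite big_nat_recr //= F0 FH add0r addr0 => ->.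
  by [].
have mR : m%:R != 0 :> R by rewrite pnatr_eq0 -lt0n.
move=> h; have -> : \sum_(0 <= k < H m) chi k * w t m k = (\sum_(0 <= k < H m) F k) / m%:R.
  by rewrite mulr_suml; apply: eq_bigr => k _; exact: mulrA.
apply: (mulIf mR); rewrite divfK //; move: h; rewrite -mulr2n -mulr_natl; lra.
Qed.

(** The denominator of the kernel is (1 - y)^2 + 4 y sin^2 (th/2). After expanding by m^2, the
    quantities m (1 - y), m (1 - y^2) and m sin (th/2) tend to t, 2t and [alpha k / 2]. *)
Lemma w_cvg (t : R) k : 0 < t -> (0 < k)%N -> (fun n => w t n.+1 k) @ \oo --> pfrac t k.
Proof.
move=> t0 k0; set A := alpha k.
have dlin (c : R) : is_derive (0 : R) 1 ( *%R c) c.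
  apply/is_derive_epsP => e e0; exists 1 => // h _.
  by rewrite add0r mulr0 subr0 subrr normr0 mulr_ge0 // ltW.
have dexp (c : R) : is_derive (0 : R) 1 (fun h : R => 1 - expR (- (c * h))) c.
  have d1 : is_derive (0 : R) 1 (fun h : R => - (c * h)) (- c).
    by have := dlin (- c); rewrite (_ : *%R (- c) = fun h => - (c * h)) //; apply/funext => h; rewrite mulNr.
  have d2 := @is_derive1_comp R (@expR R) (fun h => - (c * h)) 0 _ _ (is_derive_expR _) d1.
  have := @is_deriveB R R R (cst 1) _ 0 1 _ _ (is_derive_cst _ _ _) d2.
  by rewrite mulr0 oppr0 expR0 mul1r sub0r opprK.
have dsin : is_derive (0 : R) 1 (fun h : R => sin (A / 2 * h)) (A / 2).
  have d1 : is_derive (0 : R) 1 (fun h : R => A / 2 * h) (A / 2) by exact: dlin.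
  have d2 := @is_derive1_comp R (@sin R) (fun h => A / 2 * h) 0 _ _ (is_derive_sin _) d1.
  by move: d2; rewrite mulr0 cos0 mul1r.
have l1 := derive_seq (dexp t) _; rewrite /= mulr0 oppr0 expR0 subrr in l1.
have l2 := derive_seq (dexp (2 * t)) _; rewrite /= mulr0 oppr0 expR0 subrr in l2.
have l3 := derive_seq dsin _; rewrite /= mulr0 sin0 in l3.
have {}l1 := l1 erefl; have {}l2 := l2 erefl; have {}l3 := l3 erefl.
have ly : (fun n => expR (- (t * n.+1%:R^-1))) @ \oo --> (1 : R).
  have -> : (fun n => expR (- (t * n.+1%:R^-1))) =
      (fun n => 1 - n.+1%:R^-1 * (n.+1%:R * (1 - expR (- (t * n.+1%:R^-1))))).
    by apply/funext => n; rewrite mulKf ?pnatr_eq0 // subKr.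
  rewrite -[X in _ --> X]subr0 -(mul0r t); apply: cvgB; first exact: cvg_cst.
  by apply: cvgM => //; exact: cvg_harmonic.
have D0 : t ^+ 2 + A ^+ 2 != 0 by rewrite gt_eqF // ltr_wpDr ?sqr_ge0 // exprn_gt0.
have lim : (fun n => (n.+1%:R * (1 - expR (- (2 * t * n.+1%:R^-1)))) /
    ((n.+1%:R * (1 - expR (- (t * n.+1%:R^-1)))) * (n.+1%:R * (1 - expR (- (t * n.+1%:R^-1)))) +
     4 * expR (- (t * n.+1%:R^-1)) * ((n.+1%:R * sin (A / 2 * n.+1%:R^-1)) * (n.+1%:R * sin (A / 2 * n.+1%:R^-1)))))
   @ \oo --> 2 * t / (t * t + 4 * 1 * (A / 2 * (A / 2))).
  apply: cvgM; first exact: l2.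
  apply: cvgV; first by rewrite (_ : _ + _ = t ^+ 2 + A ^+ 2) //; field.
  apply: cvgD; first exact: cvgM.
  apply: cvgM; last exact: cvgM.
  by apply: cvgM => //; exact: cvg_cst.
rewrite /pfrac -/A (_ : t ^+ 2 + A ^+ 2 = t * t + 4 * 1 * (A / 2 * (A / 2))); last by field.
have E : (fun n => w t n.+1 k) =1 (fun n => (n.+1%:R * (1 - expR (- (2 * t * n.+1%:R^-1)))) /
    ((n.+1%:R * (1 - expR (- (t * n.+1%:R^-1)))) * (n.+1%:R * (1 - expR (- (t * n.+1%:R^-1)))) +
     4 * expR (- (t * n.+1%:R^-1)) * ((n.+1%:R * sin (A / 2 * n.+1%:R^-1)) * (n.+1%:R * sin (A / 2 * n.+1%:R^-1))))).
  move=> n; have n0 : n.+1%:R != 0 :> R by rewrite pnatr_eq0.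
  have y2 : expR (- (2 * t * n.+1%:R^-1)) = expR (- (t * n.+1%:R^-1)) ^+ 2.
    by rewrite -expRM_natl; congr expR; ring.
  have th : k%:R * (pi *+ 2 / (n.+1 * q)%:R) = (A / 2 * n.+1%:R^-1) *+ 2.
    rewrite -[_ *+ 2 in RHS]mulr_natl /A /alpha natrM; field.
    by rewrite addrC natr1 n0 pnatr_eq0 -lt0n.
  have ne : expR (- (t * n.+1%:R^-1)) < 1.
    by rewrite -[ltRHS]expR0 ltr_expR oppr_lt0 mulr_gt0 // invr_gt0.
  have np := expR_gt0 (- (t * n.+1%:R^-1)).
  rewrite /w /poisson th cos_double_sin y2 mulNr; set y := expR _ in ne np *; set S := sin _.
  have h : 0 < (1 - y) ^+ 2 + 4 * y * S ^+ 2.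
    apply: ltr_wpDr; last by rewrite exprn_gt0 // subr_gt0.
    by rewrite mulr_ge0 ?sqr_ge0 // mulr_ge0 // ltW.
  have n0' : 1 + n%:R != 0 :> R by rewrite addrC natr1.
  field; rewrite n0' /=; apply/andP; split.
    rewrite (_ : _ + _ = (1 + n%:R) ^+ 2 * ((1 - y) ^+ 2 + 4 * y * S ^+ 2)); last by ring.
    by rewrite mulf_neq0 ?expf_neq0 // gt_eqF.
  by rewrite (_ : _ + _ = (1 - y) ^+ 2 + 4 * y * S ^+ 2) ?gt_eqF //; ring.
by have -> := funext E.
Qed.

Let bc : bounded_sums chi (2 * q%:R) := bounded_psiR R d_odd d_sf.

Lemma alpha_le j k : (j <= k)%N -> alpha j <= alpha k.
Proof.
move=> jk; rewrite ler_wpM2r ?ler_nat // divr_ge0 // mulrn_wge0 // ltW // pi_gt0 //.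
Qed.

Lemma pfrac_ge0 t k : 0 < t -> 0 <= pfrac t k.
Proof. by move=> t0; rewrite divr_ge0 ?addr_ge0 ?sqr_ge0 // mulr_ge0 // ltW. Qed.

Lemma pfrac_decr t k : 0 < t -> pfrac t k.+1 <= pfrac t k.
Proof.
move=> t0; have t2 : 0 < t ^+ 2 by rewrite exprn_gt0.
rewrite ler_pM2l ?mulr_gt0 // lef_pV2 ?posrE ?ltr_wpDr ?sqr_ge0 // lerD2l.
have a0 : 0 <= alpha k by rewrite -[0](mul0r (pi *+ 2 / q%:R)) -[0]/(0%:R); exact: (alpha_le (leq0n k)).
by rewrite ler_sqr ?nnegrE ?(le_trans a0) // alpha_le.
Qed.

Lemma pfrac_to0 t : 0 < t -> (fun k => pfrac t k) @ \oo --> (0 : R).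
Proof.
move=> t0; set c := pi *+ 2 / q%:R : R.
have c0 : 0 < c by rewrite divr_gt0 ?ltr0n // pmulrn_lgt0 // pi_gt0.
apply/cvgrPdist_le => e e0.
exists (Num.bound (2 * t / c ^+ 2 / e)).+1 => // k /= hk.
have k0 : (0 < k)%N by apply: leq_trans hk.
have kR : 1 <= k%:R :> R by rewrite ler1n.
rewrite sub0r normrN ger0_norm ?pfrac_ge0 //.
have b : 2 * t / c ^+ 2 / e < k%:R.
  rewrite (lt_trans (archi_boundP _)) ?ltr_nat //.
  by rewrite !mulr_ge0 ?invr_ge0 ?exprn_ge0 // ltW.
have c2 : 0 < c ^+ 2 by rewrite exprn_gt0.
move: b; rewrite ltr_pdivrMr // ltr_pdivrMr // => b.
rewrite /pfrac ler_pdivrMr; last by rewrite ltr_wpDr ?sqr_ge0 // exprn_gt0.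
rewrite (le_trans (ltW b)) // -mulrA mulrCA ler_wpM2l ?(ltW e0) //.
rewrite /alpha -/c (le_trans (_ : _ <= k%:R ^+ 2 * c ^+ 2)) //.
  by rewrite ler_wpM2r ?(ltW c2) // expr2 ler_peMr // ler0n.
by rewrite -exprMn lerDr sqr_ge0.
Qed.

(** On half a period the angles stay in [0, pi], where cos decreases; hence the kernel decreases in
    k and Abel's bound applies with a constant independent of m. *)
Let w_bound t m K : (0 < m)%N -> 0 < t -> (0 < K < H m)%N ->
  `|\sum_(K <= k < H m) chi k * w t m k| <= 2 * q%:R * w t m K.
Proof.
move=> m0 t0 /andP[K0 KH]; have mR : 0 < m%:R :> R by rewrite ltr0n.
set y := expR (- t / m%:R).
have hy : 0 <= y < 1.
  by rewrite expR_ge0 -[ltRHS]expR0 ltr_expR mulNr oppr_lt0 divr_gt0.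
have /andP[y0 y1] := hy.
have y2 : 0 <= 1 - y ^+ 2 by rewrite subr_ge0 expr_le1 // ltW.
apply: abel_bound => // [k _|k Kk kH].
  rewrite divr_ge0 // ?(ltW mR) // divr_ge0 // ltW //; exact: poisson_den_gt0.
rewrite ler_wpM2r ?invr_ge0 ?(ltW mR) // ler_wpM2l // lef_pV2 ?posrE ?poisson_den_gt0 //.
rewrite lerD2r lerD2l lerN2 ler_wpM2l ?mulr_ge0 //.
set c := pi *+ 2 / (m * q)%:R : R.
have mq : 0 < (m * q)%:R :> R by rewrite ltr0n muln_gt0 m0.
have c0 : 0 < c by rewrite divr_gt0 // pmulrn_lgt0 // pi_gt0.
have bnd j : (j <= H m)%N -> j%:R * c \in `[0, pi].
  move=> jH; rewrite in_itv /= mulr_ge0 ?(ltW c0) //= mulrA ler_pdivrMr //.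
  rewrite mulrnAr -mulrnAl mulrC ler_wpM2l ?(ltW (pi_gt0 R)) // -mulrnA ler_nat.
  by rewrite NE addnn -muln2 leq_mul2r jH orbT.
have kH' := ltnW kH; have kH2 := ltnW kH'.
rewrite ltW // ltr_cos ?bnd //.
by rewrite ltr_pM2r // ltr_nat.
Qed.

(** The limit in m is taken under a cut at K: by [w_bound] the remainder is at most a constant times
    [w t m K], which tends to that constant times [pfrac t K]. Then K grows. *)
Lemma partial_fractions t : 0 < t -> tau * lambert d t = asum chi (pfrac t).
Proof.
move=> t0; have chi00 : chi 0%N = 0 by rewrite /chi /psiR psi0.
have key K : (0 < K)%N ->
  `|tau * lambert d t - \sum_(0 <= k < K) chi k * pfrac t k| <= 2 * q%:R * pfrac t K.
  move=> K0.
  have h1 : (fun n => \sum_(0 <= k < K) chi k * w t n.+1 k) @ \oo --> \sum_(0 <= k < K) chi k * pfrac t k.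
    apply: seq_cvg_sum => k; have [->|k0] := posnP k.
      by rewrite chi00 mul0r; under eq_fun do rewrite mul0r; exact: cvg_cst.
    by apply: cvgM; [exact: cvg_cst|exact: w_cvg].
  have h2 : (fun n => `|tau * lambert d t - \sum_(0 <= k < K) chi k * w t n.+1 k|) @ \oo -->
      `|tau * lambert d t - \sum_(0 <= k < K) chi k * pfrac t k|.
    by apply: cvg_norm; apply: cvgB; [exact: cvg_cst|exact: h1].
  have h3 : (fun n => 2 * q%:R * w t n.+1 K) @ \oo --> 2 * q%:R * pfrac t K.
    by apply: cvgM; [exact: cvg_cst|exact: w_cvg].
  rewrite -(cvg_lim (@norm_hausdorff _ _) h2) -(cvg_lim (@norm_hausdorff _ _) h3).
  apply: ler_lim; [by apply/cvg_ex; eexists; exact: h2|by apply/cvg_ex; eexists; exact: h3|].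
  exists K => // n /= Kn.
  have KH : (K < H n.+1)%N.
    by rewrite (leq_trans (_ : K < n.+1)%N) // leq_pmulr // muln_gt0 d0.
  rewrite -(half_sum (ltn0Sn n) t0) (big_cat_nat (leq0n K) (ltnW KH)) /= addrAC subrr add0r.
  by apply: w_bound => //; rewrite K0.
have := asum_cvg bc (fun i _ => pfrac_ge0 i t0) (fun i _ => pfrac_decr i t0) (pfrac_to0 t0).
move=> h; apply: (cvg_unique (@norm_hausdorff _ _) _ h).
apply/cvgrPdist_le => e e0.
have c0 : 0 < 2 * q%:R + 1 :> R by rewrite ltr_wpDl.
have /cvgrPdist_le/(_ _ (divr_gt0 e0 c0))[N _ hN] := pfrac_to0 t0.
exists N.+1 => // K /= NK; rewrite (le_trans (key K _)) //; first exact: leq_ltn_trans NK.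
have := hN K (ltnW NK); rewrite sub0r normrN ger0_norm ?pfrac_ge0 // ler_pdivlMr //.
have := pfrac_ge0 K t0; rewrite mulrDr mulr1; nra.
Qed.
End PartialFractionLimit.

(** * Mellin transforms in the variable x = ln t *)

Section AsumIntegral.
Variable R : realType.
Local Notation mu := (@lebesgue_measure R).

Lemma continuous_integrable (k : R -> R) (I : R) : continuous k -> (forall x, 0 <= k x) ->
  (\int[mu]_x (k x)%:E = I%:E)%E -> mu.-integrable setT (fun x => (k x)%:E).
Proof.
move=> ck k0 kI; apply/integrableP; split.
  by apply/measurable_EFinP; exact: continuous_measurable_fun.
by under eq_integral do rewrite gee0_abs ?lee_fin //; rewrite kI ltry.
Qed.

Lemma continuous_shift (k : R -> R) (a : R) : continuous k -> continuous (fun x => k (x + a)).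
Proof.
move=> ck x; apply: continuous_comp; last exact: ck.
by apply: continuousD; [exact: cvg_id|exact: cst_continuous].
Qed.

Lemma integral_shift (k : R -> R) (a : R) : continuous k -> (forall x, 0 <= k x) ->
  (\int[mu]_x (k (x + a))%:E = \int[mu]_x (k x)%:E)%E.
Proof.
move=> ck k0.
have dF (x : R) : is_derive x 1 (fun y : R => y + a) 1.
  by rewrite -[X in is_derive _ _ _ X]addr0; apply: is_deriveD.
have F' : derive1 (fun y : R => y + a) = cst 1.
  by apply/funext => x; rewrite derive1E; apply: derive_val.
rewrite (@increasing_ge0_integration_by_substitutionT R (fun y => y + a) k) //.
- by apply: eq_integral => x _ /=; rewrite F' /= mulr1.
- by move=> x y xy; rewrite ltrD2r.
- by rewrite F'; move=> x; exact: cst_continuous.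
- by rewrite F'; apply: is_cvg_cst.
- by rewrite F'; apply: is_cvg_cst.
- exact: cvg_addrr_Ny.
- exact: cvg_addrr.
Qed.

(** The two exponential bounds combine to 2 exp (-r |x|) with r = min (s, 1 - s), twice an even
    function whose half is a multiple of an exponential density. Positivity comes from the interval
    [0, 1]. *)
Lemma kernel_integral (k : R -> R) (s del : R) : 0 < s < 1 -> 0 < del -> continuous k ->
  (forall x, 0 <= k x) -> (forall x, k x <= 2 * expR (s * x)) ->
  (forall x, k x <= 2 * expR (- ((1 - s) * x))) ->
  (forall x, 0 <= x <= 1 -> del <= k x) ->
  exists2 I : R, 0 < I & (\int[mu]_x (k x)%:E = I%:E)%E.
Proof.
move=> /andP[s0 s1] del0 ck k0 kl kr kd.
pose r := Num.min s (1 - s).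
have r0 : 0 < r by rewrite lt_min s0 subr_gt0.
have mk : measurable_fun setT (EFin \o k).
  by apply/measurable_EFinP; exact: continuous_measurable_fun.
have cg : continuous (fun x : R => 2 * expR (- (r * `|x|))).
  move=> x; apply: cvgM; first exact: cvg_cst.
  apply: continuous_comp; last exact: continuous_expR.
  apply: continuousN; apply: continuousM; first exact: cst_continuous.
  exact: norm_continuous.
have g0 (x : R) : 0 <= 2 * expR (- (r * `|x|)) by rewrite mulr_ge0 // expR_ge0.
have up : (\int[mu]_x (k x)%:E <= \int[mu]_x (2 * expR (- (r * `|x|)))%:E)%E.
  apply: ge0_le_integral => //.
  - by move=> x _; rewrite lee_fin.
  - by apply/measurable_EFinP; exact: continuous_measurable_fun.
  - move=> x _; rewrite lee_fin; have [x0|x0] := lerP 0 x.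
      rewrite ger0_norm // (le_trans (kr x)) // ler_pM2l // ler_expR lerN2 ler_wpM2r //.
      by rewrite ge_min lexx orbT.
    rewrite ltr0_norm // (le_trans (kl x)) // ler_pM2l // ler_expR mulrN opprK ler_wnM2r //.
      exact: ltW.
    by rewrite ge_min lexx.
have fin : (\int[mu]_x (2 * expR (- (r * `|x|)))%:E = (4 / r)%:E)%E.
  rewrite ge0_symfun_integralT //; last by move=> x /=; rewrite normrN.
  have E : (\int[mu]_(x in [set x : R | (0 <= x)%R]) (2 * expR (- (r * `|x|)))%:E =
      \int[mu]_(x in `[0%R, +oo[) ((2 / r)%:E * (exponential_pdf r x)%:E))%E.
    rewrite (_ : [set x : R | (0 <= x)%R] = `[0, +oo[%classic); last first.
      by apply/seteqP; split => x /=; rewrite in_itv /= andbT.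
    apply: eq_integral => x hx; rewrite -EFinM /exponential_pdf patchE hx; congr EFin.
    move: hx; rewrite inE /= in_itv /= andbT => x0; rewrite ger0_norm // mulNr.
    by field; rewrite gt_eqF.
  rewrite E ge0_integralZl_EFin //.
  - rewrite -[X in (_ * (_ * X))%E](_ : (\int[mu]_x (exponential_pdf r x)%:E)%E = _); last first.
      rewrite [RHS]integral_mkcond; apply: eq_integral => x _.
      by rewrite [RHS]patchE /exponential_pdf patchE; case: ifP.
    by rewrite integral_exponential_pdf // mule1 -EFinM; congr EFin; field; rewrite gt_eqF.
  - by move=> x _; rewrite lee_fin exponential_pdf_ge0 // ltW.
  - apply/measurable_EFinP; apply: measurable_funTS; exact: measurable_exponential_pdf.
  - by rewrite divr_ge0 // ltW.
have lo : (del%:E <= \int[mu]_x (k x)%:E)%E.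
  rewrite (le_trans (_ : _ <= \int[mu]_(x in `[0%R, 1%R]) (k x)%:E)%E) //; last first.
    by apply: ge0_subset_integral => // x _; rewrite lee_fin.
  rewrite (le_trans (_ : _ <= \int[mu]_(x in `[0%R, 1%R]) (cst del%:E x))%E) //.
    by rewrite integral_cst //= lebesgue_measure_itv /= lte_fin ltr01 sube0 mule1.
  apply: ge0_le_integral => //.
  - by move=> x _; rewrite lee_fin ltW.
  - exact: measurable_funTS.
exists (fine (\int[mu]_x (k x)%:E)%E).
  rewrite -lte_fin fineK ?(lt_le_trans _ lo) ?lte_fin //.
  by rewrite ge0_fin_numE ?(le_lt_trans up) ?fin ?ltry // (le_trans _ lo) // lee_fin ltW.
by rewrite fineK // ge0_fin_numE ?(le_lt_trans up) ?fin ?ltry // (le_trans _ lo) // lee_fin ltW.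
Qed.

(** The series converges only conditionally, but Abel's bound dominates all partial sums by C [h 1],
    so dominated convergence permits termwise integration. The index 0 is removed by c(0) = 0 since
    [h 0] may fail to be integrable, as exp (s x) does. *)
Lemma asum_integral (c : nat -> R) (C : R) (h : nat -> R -> R) (v : nat -> R) (I : R) :
  bounded_sums c C -> c 0%N = 0 ->
  (forall n, continuous (h n)) -> (forall n x, 0 <= h n x) ->
  (forall n x, (0 < n)%N -> h n.+1 x <= h n x) ->
  (forall x, (fun n => h n x) @ \oo --> (0 : R)) ->
  (forall n, (0 < n)%N -> (\int[mu]_x (h n x)%:E = (v n * I)%:E)%E) ->
  (fun N => (\sum_(0 <= i < N) c i * v i) * I) @ \oo -->
    fine (\int[mu]_x (asum c (fun n => h n x))%:E)%E.
Proof.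
move=> bc c0 ch h0 hd ht hv.
have hi n : (0 < n)%N -> mu.-integrable setT (fun x => (h n x)%:E).
  by move=> n0; apply: continuous_integrable (hv n n0).
pose f N x := \sum_(0 <= i < N) c i * h i x.
have cf N : continuous (f N).
  elim: N => [|N IH] x.
    have -> : f 0%N = cst 0 by apply/funext => y; rewrite /f big_geq.
    exact: cst_continuous.
  have -> : f N.+1 = fun y => f N y + c N * h N y.
    by apply/funext => y; rewrite /f big_nat_recr.
  apply: continuousD; first exact: IH.
  by apply: continuousM; [exact: cst_continuous|exact: ch].
have fI N : mu.-integrable setT (fun x => (f N x)%:E) /\
    (\int[mu]_x (f N x)%:E = ((\sum_(0 <= i < N) c i * v i) * I)%:E)%E.
  elim: N => [|N [IH1 IH2]].
    have -> : (fun x => (f 0%N x)%:E) = cst 0%:E by apply/funext => y; rewrite /f big_geq.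
    by rewrite integral0 big_geq // mul0r; split => //; exact: integrable0.
  have E : (fun x => (f N.+1 x)%:E) = (fun x => (f N x)%:E + (c N)%:E * (h N x)%:E)%E.
    by apply/funext => y; rewrite /f big_nat_recr.
  rewrite E; case: (posnP N) => [N0|N0].
    have E' : (fun x => (f N x)%:E + (c N)%:E * (h N x)%:E)%E = (fun x => (f N x)%:E).
      by apply/funext => y; rewrite N0 c0 mul0e adde0.
    by rewrite E' IH2; split => //; rewrite big_nat_recr //= {3}N0 c0 mul0r addr0.
  have hc : mu.-integrable setT (fun x => (c N)%:E * (h N x)%:E)%E.
    by apply: integrableZl => //; exact: hi.
  split; first exact: integrableD.
  rewrite integralD // IH2 integralZl //; last exact: hi.
  by rewrite hv // -EFinM -EFinD big_nat_recr //= mulrDl mulrA.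
have lf x : (fun N => f N x) @ \oo --> asum c (fun n => h n x).
  apply: (asum_cvg bc) => // i i0; exact: hd.
have [] := @dominated_convergence _ _ R mu setT measurableT (fun N x => (f N x)%:E)
    (fun x => (asum c (fun n => h n x))%:E) (fun x => C%:E * (h 1%N x)%:E)%E.
- by move=> N; apply/measurable_EFinP; exact: continuous_measurable_fun.
- apply/measurable_EFinP; apply: (@measurable_fun_cvg _ _ _ setT f).
    by move=> N; exact: continuous_measurable_fun.
  by move=> x _; exact: lf.
- by apply: aeW => x _; apply: cvg_EFin; [exact: nearW|exact: lf].
- by apply: integrableZl => //; exact: hi.
- apply: aeW => x N _ /=; rewrite lee_fin; apply: (asum_partial_bound bc) => //.
  by move=> i i0; exact: hd.
move=> i1 _ i2.
have fn : (\int[mu]_x (asum c (fun n => h n x))%:E \is a fin_num)%E.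
  exact: integrable_fin_num.
move: i2; rewrite -(fineK fn) => /fine_cvgP[_]; apply: cvg_trans.
by apply: near_eq_cvg; apply: nearW => N /=; case: (fI N) => _ ->.
Qed.
End AsumIntegral.

Section Mellin.
Variable R : realType.
Local Notation mu := (@lebesgue_measure R).

(** The integrand of Gamma(s) after t = exp x; in the same way [beta_kernel] comes from 2t / (1 +
    t^2) against t^(s - 1) dt. In this variable, scaling of t becomes translation. *)
Definition gamma_kernel (s x : R) := expR (- expR x) * expR (s * x).
Definition beta_kernel (s x : R) := 2 * expR ((1 + s) * x) / (1 + expR (2 * x)).

Lemma continuous_expM (s : R) : continuous (fun x : R => expR (s * x)).
Proof.
move=> x; apply: continuous_comp; last exact: continuous_expR.
by apply: continuousM; [exact: cst_continuous|exact: cvg_id].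
Qed.

Lemma continuous_gamma_kernel (a s : R) :
  continuous (fun x : R => expR (- (expR x * a)) * expR (s * x)).
Proof.
move=> x; apply: cvgM; last exact: continuous_expM.
apply: continuous_comp; last exact: continuous_expR.
apply: continuousN; apply: continuousM; [exact: continuous_expR|exact: cst_continuous].
Qed.

Lemma continuous_beta_kernel (a b s : R) : 0 <= a ->
  continuous (fun x : R => b * expR (s * x) / (a + expR (2 * x))).
Proof.
move=> a0 x; apply: cvgM.
  by apply: cvgM; [exact: cst_continuous|exact: continuous_expM].
apply: cvgV; first by rewrite gt_eqF // ltr_wpDl // expR_gt0.
by apply: cvgD; [exact: cst_continuous|exact: continuous_expM].
Qed.

Lemma gamma_kernel_integral (s : R) : 0 < s < 1 ->
  exists2 I : R, 0 < I & (\int[mu]_x (gamma_kernel s x)%:E = I%:E)%E.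
Proof.
move=> hs; have /andP[s0 s1] := hs.
apply: (@kernel_integral R _ s (expR (- expR 1)) hs (expR_gt0 _)).
- move=> x; have := @continuous_gamma_kernel 1 s x; congr (continuous_at _ _).
  by apply/funext => y; rewrite mulr1.
- by move=> x; rewrite mulr_ge0 // expR_ge0.
- move=> x; rewrite ler_wpM2r ?expR_ge0 //.
  have : expR (- expR x) <= expR 0 by rewrite ler_expR oppr_le0 expR_ge0.
  by rewrite expR0; lra.
- move=> x; rewrite /gamma_kernel -expRD (@le_trans _ _ (expR (- ((1 - s) * x)))) //.
    rewrite ler_expR; have := expR_ge1Dx x; lra.
  by rewrite ler_peMl ?expR_ge0 // ler1n.
- move=> x /andP[x0 x1]; rewrite -[leLHS]mulr1 ler_pM ?expR_ge0 //.
    by rewrite ler_expR lerN2 ler_expR.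
  by rewrite -[leLHS]expR0 ler_expR mulr_ge0 // ltW.
Qed.

Lemma beta_kernel_integral (s : R) : 0 < s < 1 ->
  exists2 I : R, 0 < I & (\int[mu]_x (beta_kernel s x)%:E = I%:E)%E.
Proof.
move=> hs; have /andP[s0 s1] := hs.
have D0 x : 0 < 1 + expR (2 * x) :> R by rewrite ltr_wpDl // expR_gt0.
have E0 : 0 < 2 / (1 + expR 2) :> R by rewrite divr_gt0 // ltr_wpDl // expR_gt0.
apply: (@kernel_integral R _ s (2 / (1 + expR 2)) hs E0).
- exact: continuous_beta_kernel.
- by move=> x; rewrite divr_ge0 ?mulr_ge0 ?expR_ge0 // ltW.
- move=> x; rewrite ler_pdivrMr // -mulrA ler_pM2l //.
  rewrite (_ : (1 + s) * x = s * x + x); last by ring.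
  rewrite expRD ler_pM2l ?expR_gt0 // (_ : 2 * x = x + x); last by ring.
  by rewrite expRD; have := expR_gt0 x; nra.
- move=> x; rewrite ler_pdivrMr // -mulrA ler_pM2l //.
  rewrite (_ : (1 + s) * x = - ((1 - s) * x) + 2 * x); last by ring.
  by rewrite expRD ler_pM2l ?expR_gt0 // lerDr.
- move=> x /andP[x0 x1]; apply: ler_pM => //.
  + by rewrite -[leLHS]mulr1 ler_pM2l // -[leLHS]expR0 ler_expR mulr_ge0 // addr_ge0 // ltW.
  + rewrite lef_pV2 ?posrE // ?ltr_wpDl ?expR_gt0 // lerD2l ler_expR.
    by rewrite -[leRHS]mulr1 ler_pM2l.
Qed.

Lemma powR_expR (a s : R) : 0 < a -> a `^ s = expR (s * ln a).
Proof. by move=> a0; rewrite /powR gt_eqF. Qed.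

Lemma asumM (c a : nat -> R) (b : R) :
  (fun N => \sum_(0 <= i < N) c i * a i) @ \oo --> asum c a ->
  asum c (fun n => a n * b) = asum c a * b.
Proof.
move=> h; apply: (cvg_lim (@norm_hausdorff _ _)).
have -> : (fun N => \sum_(0 <= i < N) c i * (a i * b)) = (fun N => (\sum_(0 <= i < N) c i * a i) * b).
  by apply/funext => N; rewrite mulr_suml; apply: eq_bigr => i _; rewrite mulrA.
by apply: cvgM => //; exact: cvg_cst.
Qed.

Lemma asumZ (c a : nat -> R) (b : R) :
  (fun N => \sum_(0 <= i < N) c i * a i) @ \oo --> asum c a ->
  asum (fun n => b * c n) a = b * asum c a.
Proof.
move=> h; apply: (cvg_lim (@norm_hausdorff _ _)).
have -> : (fun N => \sum_(0 <= i < N) b * c i * a i) = (fun N => b * (\sum_(0 <= i < N) c i * a i)).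
  by apply/funext => N; rewrite mulr_sumr; apply: eq_bigr => i _; rewrite mulrA.
by apply: cvgM => //; exact: cvg_cst.
Qed.

Lemma bounded_sumsZ (c : nat -> R) (C b : R) : bounded_sums c C ->
  bounded_sums (fun n => b * c n) (`|b| * C).
Proof. by move=> bc M N; rewrite -mulr_sumr normrM ler_wpM2l. Qed.

Lemma powR_decr (s : R) n : 0 <= s -> (0 < n)%N -> (n.+1%:R : R) `^ (- s) <= n%:R `^ (- s).
Proof.
move=> s0 n0; rewrite !powRN lef_pV2 ?posrE ?powR_gt0 ?ltr0n //.
by rewrite ge0_ler_powR ?nnegrE ?ler0n // ler_nat.
Qed.

Lemma powR_to0 (s : R) : 0 < s -> (fun n : nat => n%:R `^ (- s)) @ \oo --> (0 : R).
Proof.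
move=> s0; apply/cvgrPdist_le => e e0; set M := (e^-1) `^ s^-1.
exists (Num.bound M).+1 => // n /= hn.
have n0 : 0 < n%:R :> R by rewrite ltr0n (leq_ltn_trans _ hn).
rewrite sub0r normrN ger0_norm ?powR_ge0 // powRN -[leRHS]invrK lef_pV2 ?posrE ?invr_gt0 ?powR_gt0 //.
have -> : e^-1 = M `^ s by rewrite -powRrM mulVf ?gt_eqF // powRr1 // invr_ge0 ltW.
rewrite ge0_ler_powR ?(ltW s0) ?nnegrE ?powR_ge0 ?(ltW n0) //.
by rewrite ltW // (lt_trans (archi_boundP (powR_ge0 _ _))) // ltr_nat.
Qed.
End Mellin.

Section RealFunctionalEquation.
Variables (R : realType) (d : nat).
Hypotheses (d_odd : odd d) (d_sf : squarefree d).
Let q := (8 * d)%N.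
Let d0 : (0 < d)%N. Proof. by case/andP: d_sf. Qed.
Let q0 : (0 < q)%N. Proof. by rewrite muln_gt0. Qed.
Let chi := psiR R d.
Let tau := tau R d.
Let bc : bounded_sums chi (2 * q%:R) := bounded_psiR R d_odd d_sf.
Let chi0 : chi 0%N = 0. Proof. by rewrite /chi /psiR psi0. Qed.
Local Notation mu := (@lebesgue_measure R).

Definition realL (s : R) := asum chi (fun n => n%:R `^ (- s)).

Lemma realL_cvg s : 0 < s -> (fun N => \sum_(0 <= i < N) chi i * i%:R `^ (- s)) @ \oo --> realL s.
Proof.
move=> s0; apply: (asum_cvg bc) (powR_to0 s0) => i i0; first exact: powR_ge0.
exact: powR_decr (ltW s0) i0.
Qed.

(** The n-th term is n^-s times [gamma_kernel s] translated by ln n. The integral on the right is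
    the one that [mellin_pfrac] evaluates by the other expansion. *)
Lemma mellin_lambert (s A : R) : 0 < s < 1 -> (\int[mu]_x (gamma_kernel s x)%:E = A%:E)%E ->
  tau * realL s * A = fine (\int[mu]_x (tau * lambert d (expR x) * expR (s * x))%:E)%E.
Proof.
move=> /andP[s0 s1] hA.
have Ea x : tau * lambert d (expR x) * expR (s * x) =
    asum (fun n => tau * chi n) (fun n => expR (- (expR x * n%:R)) * expR (s * x)).
  rewrite asumM; first by rewrite asumZ //; exact: lambert_cvg (expR_gt0 x).
  have -> : (fun N => \sum_(0 <= i < N) tau * chi i * expR (- (expR x * i%:R))) =
    (fun N => tau * (\sum_(0 <= i < N) chi i * expR (- (expR x * i%:R)))).
    by apply/funext => N; rewrite mulr_sumr; apply: eq_bigr => i _; rewrite mulrA.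
  rewrite asumZ //; last exact: lambert_cvg (expR_gt0 x).
  by apply: cvgM; [exact: cvg_cst|exact: lambert_cvg (expR_gt0 x)].
under eq_integral do rewrite Ea.
have := @asum_integral R _ _ (fun n x => expR (- (expR x * n%:R)) * expR (s * x))
  (fun n => n%:R `^ (- s)) A (bounded_sumsZ tau bc) _ _ _ _ _ _.
move=> H; apply: (cvg_unique (@norm_hausdorff _ _) _ (H _ _ _ _ _ _)) => {H}.
- have -> : (fun N => (\sum_(0 <= i < N) tau * chi i * i%:R `^ (- s)) * A) =
    (fun N => tau * (\sum_(0 <= i < N) chi i * i%:R `^ (- s)) * A).
    by apply/funext => N; rewrite mulr_sumr; congr (_ * A); apply: eq_bigr => i _; rewrite mulrA.
  by apply: cvgM; [apply: cvgM; [exact: cvg_cst|exact: realL_cvg]|exact: cvg_cst].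
- by rewrite chi0 mulr0.
- by move=> n; exact: continuous_gamma_kernel.
- by move=> n x; rewrite mulr_ge0 // expR_ge0.
- by move=> n x n0; rewrite ler_wpM2r ?expR_ge0 // exp_decr // expR_gt0.
- move=> x; rewrite -[X in _ --> X](mul0r (expR (s * x))); apply: cvgM; last exact: cvg_cst.
  by apply: exp_to0; exact: expR_gt0.
move=> n n0; have nR : 0 < n%:R :> R by rewrite ltr0n.
have ck : continuous (gamma_kernel s).
  move=> x; have := @continuous_gamma_kernel _ 1 s x; congr (continuous_at _ _).
  by apply/funext => y; rewrite mulr1.
have k0 x : 0 <= gamma_kernel s x by rewrite mulr_ge0 // expR_ge0.
rewrite EFinM -hA -(integral_shift (ln n%:R) ck k0) -ge0_integralZl_EFin ?powR_ge0 //.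
- apply: eq_integral => x _; rewrite -EFinM /gamma_kernel; congr EFin.
  have -> : expR (x + ln n%:R) = expR x * n%:R by rewrite expRD lnK.
  by rewrite powR_expR // [RHS]mulrCA -[in RHS]expRD; congr (_ * expR _); ring.
- by move=> x _; rewrite lee_fin.
- apply/measurable_EFinP; apply: continuous_measurable_fun; exact: continuous_shift.
Qed.

(** By homogeneity of 2t / (t^2 + a^2), the n-th term is a^(s - 1) times [beta_kernel s] translated
    by -ln a, with a = [alpha R d n]. *)
Lemma mellin_pfrac (s B : R) : 0 < s < 1 -> (\int[mu]_x (beta_kernel s x)%:E = B%:E)%E ->
  (pi *+ 2 / q%:R) `^ (s - 1) * realL (1 - s) * B =
  fine (\int[mu]_x (tau * lambert d (expR x) * expR (s * x))%:E)%E.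
Proof.
move=> /andP[s0 s1] hB; set c := pi *+ 2 / q%:R.
have c0 : 0 < c by rewrite divr_gt0 ?ltr0n // pmulrn_lgt0 // pi_gt0.
have Ea x : tau * lambert d (expR x) * expR (s * x) =
    asum chi (fun n => pfrac d (expR x) n * expR (s * x)).
  rewrite partial_fractions ?expR_gt0 // asumM //.
  apply: (asum_cvg bc) => [i _|i _|]; [apply: pfrac_ge0|apply: pfrac_decr|apply: pfrac_to0] => //;
    exact: expR_gt0.
under eq_integral do rewrite Ea.
have := @asum_integral R _ _ (fun n x => pfrac d (expR x) n * expR (s * x))
  (fun n => (n%:R * c) `^ (s - 1)) B bc _ _ _ _ _ _.
move=> H; apply: (cvg_unique (@norm_hausdorff _ _) _ (H _ _ _ _ _ _)) => {H} //.
- have -> : (fun N => (\sum_(0 <= i < N) chi i * (i%:R * c) `^ (s - 1)) * B) =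
    (fun N => c `^ (s - 1) * (\sum_(0 <= i < N) chi i * i%:R `^ (- (1 - s))) * B).
    apply/funext => N; rewrite mulr_sumr; congr (_ * B); apply: eq_bigr => i _.
    by rewrite opprB powRM ?ler0n ?(ltW c0) // mulrA mulrC.
  apply: cvgM; last exact: cvg_cst; apply: cvgM; first exact: cvg_cst.
  by apply: realL_cvg; rewrite subr_gt0.
- move=> n x; have := @continuous_beta_kernel _ (alpha R d n ^+ 2) 2 (1 + s) (sqr_ge0 _) x.
  congr (continuous_at _ _); apply/funext => y.
  have -> : (1 + s) * y = y + s * y by ring.
  by rewrite expRD /pfrac -expRM_natl [expR (2 * y) + _]addrC mulrA [RHS]mulrAC.
- by move=> n x; rewrite mulr_ge0 ?pfrac_ge0 ?expR_ge0 ?expR_gt0.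
- by move=> n x n0; rewrite ler_wpM2r ?expR_ge0 // pfrac_decr // expR_gt0.
- move=> x; rewrite -[X in _ --> X](mul0r (expR (s * x))); apply: cvgM; last exact: cvg_cst.
  by apply: pfrac_to0 => //; exact: expR_gt0.
move=> n n0; have a0 : 0 < alpha R d n by rewrite mulr_gt0 // ltr0n.
have ck : continuous (beta_kernel s) by exact: continuous_beta_kernel.
have k0 x : 0 <= beta_kernel s x.
  by rewrite divr_ge0 ?mulr_ge0 ?addr_ge0 ?expR_ge0.
rewrite EFinM -hB -(integral_shift (- ln (alpha R d n)) ck k0) -ge0_integralZl_EFin ?powR_ge0 //.
- apply: eq_integral => x _; rewrite -EFinM /beta_kernel -/(alpha R d n); congr EFin.
  rewrite powR_expR // /pfrac; set a := alpha R d n in a0 *.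
  have E1 : expR x ^+ 2 = expR (2 * (x - ln a)) * a ^+ 2.
    rewrite -[X in _ = _ * X ^+ 2](lnK (_ : a \is Num.pos)) ?posrE // -!expRM_natl -expRD.
    by congr expR; ring.
  have E2 : expR x * expR (s * x) = expR ((s - 1) * ln a) * expR ((1 + s) * (x - ln a)) * a ^+ 2.
    rewrite -[X in _ = _ * X ^+ 2](lnK (_ : a \is Num.pos)) ?posrE // -!expRM_natl -!expRD.
    by congr expR; ring.
  have := expR_gt0 (2 * (x - ln a)); set E := expR (2 * _) in E1 *.
  rewrite mulrAC -[2 * _ * expR (s * x)]mulrA E2 E1 => Epos.
  have -> : E * a ^+ 2 + a ^+ 2 = (1 + E) * a ^+ 2 by ring.
  by field; rewrite !gt_eqF // addr_gt0.
- by move=> x _; rewrite lee_fin.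
- apply/measurable_EFinP; apply: continuous_measurable_fun; exact: continuous_shift.
Qed.
End RealFunctionalEquation.

(** Here A is Gamma(s) and B the integral of [beta_kernel s]. They are chosen before d, which is
    what lets them cancel between two values of d. *)
Lemma real_functional_equation (R : realType) (s : R) : 0 < s < 1 ->
  exists A B : R, [/\ 0 < A, 0 < B & forall d, odd d -> squarefree d ->
    tau R d * realL d s * A = (pi *+ 2 / (8 * d)%:R) `^ (s - 1) * realL d (1 - s) * B].
Proof.
move=> hs; have [A A0 hA] := gamma_kernel_integral hs; have [B B0 hB] := beta_kernel_integral hs.
by exists A, B; split => // d h1 h2; rewrite (mellin_lambert h1 h2 hs hA) (mellin_pfrac h1 h2 hs hB).
Qed.

Lemma int_of_rat_sqr (r : rat) (z : int) (m : nat) :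
  (forall p, prime p -> ~~ (p ^ 2 %| m)%N) -> m%:R * r ^+ 2 = z%:~R -> r \is a Num.int.
Proof.
move=> msf h; rewrite Qint_def; apply: contraT => d1.
have d1' : `|denq r|%N != 1%N by apply: contra d1 => /eqP h1; rewrite -absz_denq h1.
have E : (m * `|numq r| ^ 2 = `|z| * `|denq r| ^ 2)%N.
  have : m%:R * (numq r)%:~R ^+ 2 = z%:~R * (denq r)%:~R ^+ 2 :> rat.
    by rewrite numqE exprMn mulrA h.
  move: (numq r) (denq r) => N D.
  rewrite pmulrn -!rmorphXn -!rmorphM => /intr_inj /(congr1 absz).
  by rewrite abszM abszX [RHS]abszM abszX.
have pd := pdiv_dvd `|denq r|%N.
have pp : prime (pdiv `|denq r|) by rewrite pdiv_prime // ltn_neqAle eq_sym d1' absz_gt0 denq_neq0.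
set p := pdiv _ in pd pp.
have co : coprime (p ^ 2) (`|numq r| ^ 2).
  rewrite coprimeXl // coprimeXr // (coprime_dvdl pd) // coprime_sym.
  exact: coprime_num_den.
have : (p ^ 2 %| m * `|numq r| ^ 2)%N by rewrite E dvdn_mull // dvdn_exp2r.
by rewrite Gauss_dvdl // (negPf (msf p pp)).
Qed.

(** * Ideals of quadratic integers *)

Section QuadraticField.
Variables (K : fieldExtType rat) (w : K) (m : nat).
Hypothesis w2 : w ^+ 2 = m%:R.
Hypothesis gen : forall x : K, exists a b : rat, x = a%:A + b%:A * w.
Hypotheses (m4 : (m %% 4 = 2)%N) (msf : forall p, prime p -> ~~ (p ^ 2 %| m)%N).

(** A rational square root would be an integer, and a square is 0 or 1 modulo 4, never 2. *)
Lemma radicand_not_square (r : rat) : r ^+ 2 != m%:R.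
Proof.
apply/eqP => h; have : r \is a Num.int.
  apply: (@int_of_rat_sqr r m%:Z 1) => [p pp|]; last by rewrite mul1r h.
  by rewrite dvdn1 -(exp1n 2) eqn_exp2r // ; case: p pp => [|[]].
move=> /intrP[z hz]; move: h; rewrite hz -rmorphXn pmulrn => /intr_inj /(congr1 absz).
rewrite abszX /= => h; move: m4; rewrite -h.
have := divn_eq `|z| 4; have := ltn_pmod `|z| (isT : 0 < 4)%N.
move: (`|z| %/ 4)%N (`|z| %% 4)%N => u v; move: `|z|%N => x v4 ->.
have -> : ((u * 4 + v) ^ 2 = (4 * u * u + 2 * u * v) * 4 + v ^ 2)%N by ring.
by rewrite modnMDl; do 4 (case: v v4 => [|v v4] //).
Qed.

Lemma quad_inj0 (a b : rat) : a%:A + b%:A * w = 0 -> a = 0 /\ b = 0.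
Proof.
move=> h; suff b0 : b = 0.
  split=> //; move: h; rewrite b0 scale0r mul0r addr0 => /eqP.
  by rewrite scaler_eq0 oner_eq0 orbF => /eqP.
apply/eqP; apply: contraT => b0.
have : w = (- a / b)%:A.
  have bA : b%:A != 0 :> K by rewrite scaler_eq0 oner_eq0 orbF.
  have bE : b * (- a / b) = - a by field.
  apply: (mulfI bA); rewrite -[in RHS]in_algE -[in RHS](in_algE K (- a / b)) -rmorphM bE rmorphN /=.
  by apply/eqP; rewrite -addr_eq0 addrC h.
move=> wE; have := radicand_not_square (- a / b); case/negP.
have := w2; rewrite wE -in_algE -rmorphXn -(rmorph_nat (in_alg K)) => /fmorph_inj ->.
by [].
Qed.

Lemma quad_inj (a b c d : rat) : a%:A + b%:A * w = c%:A + d%:A * w -> a = c /\ b = d.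
Proof.
move=> h; have [|/eqP + /eqP] := @quad_inj0 (a - c) (b - d).
  rewrite !scalerBl mulrBl addrACA h -opprD subrr //.
by rewrite !subr_eq0 => /eqP -> /eqP ->.
Qed.

(** Conjugation is followed through the evaluation of an integer polynomial, so no field
    automorphism has to be constructed to see that conjugates of integral elements are integral. *)
Lemma horner_conj (a b : rat) (p : {poly int}) : exists u v : rat,
  (map_poly intr p).[a%:A + b%:A * w] = u%:A + v%:A * w /\
  (map_poly intr p).[a%:A - b%:A * w] = u%:A - v%:A * w.
Proof.
elim/poly_ind: p => [|p c [u [v [h1 h2]]]].
  by exists 0, 0; rewrite !rmorph0 !horner0 !scale0r mul0r addr0 subr0.
exists (u * a + v * b * m%:R + c%:~R), (u * b + v * a).
rewrite !rmorphD !rmorphM /= map_polyX map_polyC /= !hornerE h1 h2.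
rewrite -!in_algE !(rmorphD, rmorphM, rmorph_nat, rmorph_int) -w2.
by split; ring.
Qed.

Lemma integral_conj (a b : rat) : integralOver (intr : int -> K) (a%:A + b%:A * w) ->
  integralOver (intr : int -> K) (a%:A - b%:A * w).
Proof.
case=> p pm; rewrite /root; have [u [v [-> h2]]] := horner_conj a b p => /eqP h.
by exists p => //; have [u0 v0] := quad_inj0 h; rewrite /root h2 u0 v0 !scale0r mul0r subr0.
Qed.

Lemma integral_rat (r : rat) : integralOver (intr : int -> K) r%:A -> r \is a Num.int.
Proof.
case=> p pm hp.
have hr : root (map_poly (intr : int -> rat) p) r.
  rewrite -(fmorph_root (in_alg K)) /= -map_poly_comp /=.
  rewrite (eq_map_poly (g := intr)) // => z /=.
  by rewrite -in_algE rmorph_int.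
have ha : root (map_poly (intr : int -> algC) p) (ratr r).
  move: hr; rewrite -(fmorph_root (ratr : rat -> algC)) -map_poly_comp /=.
  by rewrite (eq_map_poly (g := intr)) // => z /=; rewrite ratr_int.
have /intrP[z hz] : (ratr r : algC) \is a Num.int.
  apply: Cint_rat_Aint; first exact: Crat_rat.
  apply: root_monic_Aint ha _ _; first exact: monic_map.
  by apply/polyOverP => i; rewrite coef_map /= intr_int.
apply/intrP; exists z; apply: (fmorph_inj (ratr : rat -> algC)).
by rewrite /= ratr_int -hz.
Qed.

Definition quad (x y : int) : K := x%:~R + y%:~R * w.

Lemma quadE x y : quad x y = x%:~R%:A + y%:~R%:A * w.
Proof. by rewrite /quad -!in_algE !rmorph_int. Qed.

Lemma quadI x y x' y' : quad x y = quad x' y' -> x = x' /\ y = y'.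
Proof. by rewrite !quadE => /quad_inj[/intr_inj -> /intr_inj ->]. Qed.

Lemma quadD x y x' y' : quad x y + quad x' y' = quad (x + x') (y + y').
Proof. by rewrite /quad !rmorphD; ring. Qed.

Lemma quadM x y x' y' : quad x y * quad x' y' = quad (x * x' + m%:Z * (y * y')) (x * y' + y * x').
Proof.
rewrite /quad !rmorphD !rmorphM /= (_ : (m%:Z)%:~R = w ^+ 2); last by rewrite w2 -pmulrn.
by ring.
Qed.

(** For integral a + b w the trace 2a = A and the norm N are integers. Then m (2b)^2 = A^2 - 4N is
    an integer, so 2b is one because m is square-free, and a parity argument halves both. *)
Lemma ring_of_integers_quad x : ring_of_integers x <-> exists a b, x = quad a b.
Proof.
split=> [|[a [b ->]]]; last first.
  apply: integral_add; first exact: integral_id.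
  apply: integral_mul; first exact: integral_id.
  exists ('X^2 - m%:Z%:P); first exact: monicXnsubC.
  rewrite /root rmorphB /= map_polyXn map_polyC /= !hornerE -pmulrn w2 subrr //.
rewrite /ring_of_integers /= => ix; have [a [b xE]] := gen x.
rewrite xE in ix; have iy := integral_conj ix.
have /intrP[A hA] : 2%:R * a \is a Num.int.
  apply: integral_rat; have := integral_add ix iy.
  have -> : a%:A + b%:A * w + (a%:A - b%:A * w) = (2%:R * a)%:A.
    by rewrite -!in_algE !(rmorphM, rmorph_nat); ring.
  by [].
have /intrP[N hN] : a ^+ 2 - m%:R * b ^+ 2 \is a Num.int.
  apply: integral_rat; have := integral_mul ix iy.
  have -> : (a%:A + b%:A * w) * (a%:A - b%:A * w) = (a ^+ 2 - m%:R * b ^+ 2)%:A.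
    by rewrite -!in_algE !(rmorphB, rmorphM, rmorphXn, rmorph_nat) -w2; ring.
  by [].
have hB2 : m%:R * (2%:R * b) ^+ 2 = (A ^+ 2 - 4 * N)%:~R.
  by rewrite intrB [(4 * N)%:~R]intrM [(A ^+ 2)%:~R]rmorphXn /= -hA -hN; ring.
have /intrP[B hB] := int_of_rat_sqr msf hB2.
have E : m%:Z * B ^+ 2 = A ^+ 2 - 4 * N.
  by apply: (@intr_inj rat); rewrite -hB2 hB intrM -pmulrn expr2 intrM -expr2.
have [k mk] : exists k : nat, m = (4 * k + 2)%N by exists (m %/ 4)%N; lia.
have [A1 [r [Ar r01]]] : exists A1 r : int, A = 2 * A1 + r /\ (r = 0 \/ r = 1).
  by exists (A %/ 2)%Z, (A %% 2)%Z; lia.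
have [B1 [s [Bs s01]]] : exists B1 s : int, B = 2 * B1 + s /\ (s = 0 \/ s = 1).
  by exists (B %/ 2)%Z, (B %% 2)%Z; lia.
(* Since m = 2 mod 4, the norm equation says 2 s^2 = r^2 modulo 4 for the parities r, s, which
   leaves only r = s = 0. *)
have E2 : 2 * s ^+ 2 = r ^+ 2 + 4 * (A1 * A1 + A1 * r - N - k%:Z * B ^+ 2 - 2 * B1 * B1 - 2 * B1 * s).
  have -> : r ^+ 2 = A ^+ 2 - 4 * (A1 * A1 + A1 * r) by rewrite Ar; ring.
  have -> : A ^+ 2 = m%:Z * B ^+ 2 + 4 * N by rewrite E; ring.
  by rewrite mk PoszD PoszM Bs; ring.
have [r0 s0] : r = 0 /\ s = 0.
  move: E2; move: (_ - 2 * B1 * s) => T.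
  by case: r01 => ->; case: s01 => ->; rewrite ?expr0n ?expr1n /=; lia.
exists A1, B1; rewrite xE quadE; congr (_%:A + _%:A * _); apply: (@mulfI _ 2%:R) => //.
  by rewrite hA Ar r0 addr0 rmorphM.
by rewrite hB Bs s0 addr0 rmorphM.
Qed.
End QuadraticField.

Lemma Qsqrt_gen (m : nat) : exists w : Qsqrt m, w ^+ 2 = m%:R /\
  forall x : Qsqrt m, exists a b : rat, x = a%:A + b%:A * w.
Proof.
rewrite /Qsqrt; case: num_field_exists => K /= [iota [s1 hs full]].
case: s1 hs full => [|w [|]] //= [hw] full; exists w.
have w2 : w ^+ 2 = m%:R.
  by apply: (fmorph_inj iota); rewrite rmorphXn /= hw sqrtCK rmorph_nat.
split=> // x; have : x \in <<1; w>>%VS by rewrite -adjoin_seq1 full memvf.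
case/Fadjoin_polyP => p /polyOverP p1 ->.
elim/poly_ind: p p1 => [|p c IH] p1.
  by exists 0, 0; rewrite horner0 !scale0r mul0r addr0.
have [a [b h]] : exists a b : rat, p.[w] = a%:A + b%:A * w.
  by apply: IH => i; have := p1 i.+1; rewrite coefD coefMX coefC /= addr0.
have [k ck] : exists k : rat, c = k%:A.
  by have := p1 0%N; rewrite coefD coefMX coefC /= add0r => /vlineP.
exists (b * m%:R + k), a; rewrite !hornerE h ck -!in_algE !(rmorphD, rmorphM, rmorph_nat) -w2.
by ring.
Qed.

Lemma least_nat (P : nat -> Prop) : (exists n, P n) ->
  exists n, P n /\ forall k, P k -> (n <= k)%N.
Proof.
move=> [n Pn]; have ex : exists n, `[< P n >] by exists n; apply/asboolP.
case: (ex_minnP ex) => k /asboolP Pk hk; exists k; split=> // j Pj.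
by apply: hk; apply/asboolP.
Qed.

Lemma int_subgroup (S : int -> Prop) : (forall x y, S x -> S y -> S (x - y)) ->
  (exists2 x, S x & x != 0) ->
  exists g : nat, [/\ (0 < g)%N, S g%:Z & forall x, S x -> exists k, x = g%:Z * k].
Proof.
move=> SB [x0 Sx0 x00].
have S0 : S 0 by rewrite -(subrr x0); exact: SB.
have SN x : S x -> S (- x) by move=> Sx; rewrite -sub0r; exact: SB.
have [|g [[g0 Sg] gmin]] := @least_nat (fun n => (0 < n)%N /\ S n%:Z).
  exists `|x0|%N; split; first by rewrite absz_gt0.
  by have [h|h] := lerP 0 x0; [rewrite gez0_abs|rewrite ltz0_abs //; exact: SN].
have SM (n : nat) : S (g%:Z * n%:Z).
  elim: n => [|n IH]; first by rewrite mulr0.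
  have -> : g%:Z * n.+1%:Z = g%:Z * n%:Z - - g%:Z by rewrite intS; ring.
  by apply: SB => //; exact: SN.
exists g; split=> // x Sx; exists (x %/ g)%Z.
have E := divz_eq x g; have gn : g%:Z != 0 by lia.
have r0 := modz_ge0 x gn; have r1 : (x %% g)%Z < g by rewrite ltz_pmod // ltz_nat.
have Sr : S (x %% g)%Z.
  have -> : (x %% g)%Z = x - g%:Z * (x %/ g)%Z by rewrite {2}E; ring.
  apply: SB => //; have [h|h] := lerP 0 (x %/ g)%Z.
    by rewrite -(gez0_abs h).
  by rewrite -[(x %/ g)%Z]opprK -(ltz0_abs h) mulrN; apply: SN.
rewrite {1}E mulrC; suff -> : (x %% g)%Z = 0 by rewrite addr0.
have [//|rn] := eqVneq ((x %% g)%Z) 0.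
have := gmin `|(x %% g)%Z|%N; rewrite gez0_abs // => h.
have : (g <= `|(x %% g)%Z|)%N by apply: h; split; rewrite ?absz_gt0.
lia.
Qed.

Lemma Posz_sqr (b : nat) : (b ^ 2)%N%:Z = b%:Z ^+ 2.
Proof. by rewrite expr2 expnS expn1 PoszM. Qed.

Section Ideals.
Variables (K : fieldExtType rat) (w : K) (m : nat).
Hypothesis w2 : w ^+ 2 = m%:R.
Hypothesis gen : forall x : K, exists a b : rat, x = a%:A + b%:A * w.
Hypotheses (m4 : (m %% 4 = 2)%N) (msf : forall p, prime p -> ~~ (p ^ 2 %| m)%N).

Let e := quad w.
Let eI := quadI w2 m4.
Let eM := quadM w2.
Let OE := ring_of_integers_quad w2 gen m4 msf.

(** The lattice g (Z a + Z (b + w)) in Hermite normal form; it is an ideal when b^2 = m mod a and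
    then has norm g^2 a. *)
Definition ideal_of (g a b : nat) : set K :=
  [set z | exists x y : int, z = e (g%:Z * (x * a%:Z + y * b%:Z)) (g%:Z * y)].

Lemma ideal_ofP g a b x y : ideal_of g a b (e x y) <->
  exists s t : int, x = g%:Z * (s * a%:Z + t * b%:Z) /\ y = g%:Z * t.
Proof.
split=> [[s [t /eI[-> ->]]]|[s [t [-> ->]]]]; first by exists s, t.
by exists s, t.
Qed.

Lemma ideal_of_ideal g a b : (b ^ 2 = m %[mod a])%N -> (0 < a)%N -> (0 < g)%N ->
  nonzero_ideals (ideal_of g a b).
Proof.
move=> ba a0 g0; split; last first.
  move=> h; have : ideal_of g a b (e (g%:Z * a%:Z) 0).
    by apply/ideal_ofP; exists 1, 0; split; ring.
  rewrite h /= => h0; have := @eI (g%:Z * a%:Z) 0 0 0.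
  rewrite -/e h0 /e /quad !mulr0z mul0r addr0 => /(_ erefl)[+ _].
  by move: a0 g0; nia.
have [t ht] : exists t : int, b%:Z ^+ 2 - m%:Z = t * a%:Z.
  exists ((b ^ 2 %/ a)%N%:Z - (m %/ a)%N%:Z).
  have h1 := divn_eq (b ^ 2) a; have h2 := divn_eq m a; rewrite ba in h1.
  by rewrite -Posz_sqr (congr1 Posz h1) [X in _ - X](congr1 Posz h2) !PoszD !PoszM; ring.
split.
- by move=> z [x [y ->]]; apply/OE; do 2 eexists.
- by exists 0, 0; rewrite !mul0r addr0 !mulr0 /e /quad !mulr0z mul0r addr0.
- move=> _ _ [x [y ->]] [x' [y' ->]]; rewrite quadD; exists (x + x'), (y + y').
  by congr quad; ring.
- move=> _ _ /OE[c [d' ->]] [x [y ->]]; rewrite eM.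
  exists (c * x - d' * x * b%:Z - d' * y * t), (c * y + d' * (x * a%:Z + y * b%:Z)).
  congr quad; last by ring.
  transitivity (g%:Z * (c * (x * a%:Z + y * b%:Z) + d' * y * (b%:Z ^+ 2 - (b%:Z ^+ 2 - m%:Z)))).
    by ring.
  by rewrite ht; ring.
Qed.

Lemma ideal_of_inj g a b g' a' b' : (0 < g)%N -> (b < a)%N -> (0 < g')%N -> (b' < a')%N ->
  ideal_of g a b = ideal_of g' a' b' -> [/\ g = g', a = a' & b = b'].
Proof.
have half g1 a1 b1 g2 a2 b2 : ideal_of g1 a1 b1 = ideal_of g2 a2 b2 ->
    exists s t u v : int, g1%:Z * b1%:Z = g2%:Z * (s * a2%:Z + t * b2%:Z) /\ g1%:Z = g2%:Z * t
     /\ g1%:Z * a1%:Z = g2%:Z * (u * a2%:Z + v * b2%:Z) /\ 0 = g2%:Z * v.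
  move=> h.
  have : ideal_of g1 a1 b1 (e (g1%:Z * b1%:Z) g1%:Z) by apply/ideal_ofP; exists 0, 1; split; ring.
  rewrite h => /ideal_ofP[s [t [h1 h2]]].
  have : ideal_of g1 a1 b1 (e (g1%:Z * a1%:Z) 0) by apply/ideal_ofP; exists 1, 0; split; ring.
  rewrite h => /ideal_ofP[u [v [h3 h4]]].
  by exists s, t, u, v.
move=> g0 ba g'0 ba' h.
have [s [t [u [v [h1 [h2 [h3 h4]]]]]]] := half _ _ _ _ _ _ h.
have [s' [t' [u' [v' [h1' [h2' [h3' h4']]]]]]] := half _ _ _ _ _ _ (esym h).
have gg : g = g'.
  have t0 : 0 < t by nia.
  have t0' : 0 < t' by nia.
  nia.
subst g'; have v0 : v = 0 by nia.
have v0' : v' = 0 by nia.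
subst v v'.
have gn : g%:Z != 0 by lia.
have t1 : t = 1 by apply: (mulfI gn); rewrite -h2 mulr1.
move: h3 h3'; rewrite !mul0r !addr0 => /(mulfI gn) h3 /(mulfI gn) h3'.
have aa : a = a'.
  have u0 : 0 < u by nia.
  have u0' : 0 < u' by nia.
  nia.
subst a'; split=> //.
move: h1; rewrite t1 mul1r => /(mulfI gn) h1.
have s0 : s = 0 by nia.
by move: h1; rewrite s0 mul0r add0r => -[].
Qed.

Lemma coset_eq (I : set K) x y : is_ideal I -> ring_of_integers x -> ring_of_integers y ->
  ([set x + z | z in I] = [set y + z | z in I]) <-> I (x - y).
Proof.
move=> [IO I0 ID IM] ox oy; split=> [h|h].
  have : [set x + z | z in I] (x + 0) by exists 0.
  by rewrite h addr0 => -[z Iz <-]; rewrite addrC addKr.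
have o1 : ring_of_integers (-1 : K) by apply/OE; exists (-1), 0; rewrite /quad mulr0z mul0r addr0.
have Iyx : I (y - x) by rewrite -opprB -mulN1r; exact: IM.
apply/seteqP; split=> _ [z Iz <-].
  by exists (x - y + z); [exact: ID|ring].
by exists (y - x + z); [exact: ID|ring].
Qed.

Lemma ideal_norm_of g a b : (b ^ 2 = m %[mod a])%N -> (0 < a)%N -> (0 < g)%N ->
  ideal_norm (ideal_of g a b) = (g ^ 2 * a)%N.
Proof.
move=> ba a0 g0; have [II _] := ideal_of_ideal ba a0 g0.
have ga0 : (0 < g * a)%N by rewrite muln_gt0 g0.
have oe x y : ring_of_integers (e x y) by apply/OE; do 2 eexists.
rewrite /ideal_norm; apply: card_fset_set.
(* Coset representatives u + v w with 0 <= u < g a and 0 <= v < g, encoded by the single number k =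
   v g a + u. *)
pose r k := e (k %% (g * a))%N%:Z (k %/ (g * a))%N%:Z.
pose f k := [set r k + z | z in ideal_of g a b].
have -> : [set [set x + y | y in ideal_of g a b] | x in @ring_of_integers K] = f @` `I_(g ^ 2 * a).
  apply/seteqP; split=> [_ [x ox <-]|_ [k _ <-]]; last by exists (r k) => //; exact: oe.
  move: ox => /OE[c [d xE]].
  pose v := `|(d %% g)%Z|%N; pose y := (d %/ g)%Z.
  pose c' := c - g%:Z * y * b%:Z.
  pose u := `|(c' %% (g * a)%N)%Z|%N; pose x' := (c' %/ (g * a)%N)%Z.
  have gn : g%:Z != 0 by lia.
  have gan : (g * a)%N%:Z != 0 by lia.
  have vE : d = g%:Z * y + v%:Z by rewrite /v gez0_abs ?modz_ge0 // /y {1}(divz_eq d g); ring.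
  have uE : c' = (g * a)%N%:Z * x' + u%:Z by rewrite /u gez0_abs ?modz_ge0 // /x' {1}(divz_eq c' (g * a)%N); ring.
  have vg : (v < g)%N by rewrite /v -ltz_nat gez0_abs ?modz_ge0 // ltz_pmod // ltz_nat.
  have uga : (u < g * a)%N by rewrite /u -ltz_nat gez0_abs ?modz_ge0 // ltz_pmod // ltz_nat.
  exists (v * (g * a) + u)%N; first by rewrite /= expnS expn1; nia.
  rewrite /f /r modnMDl modn_small // divnMDl // divn_small // addn0.
  rewrite xE; apply/coset_eq => //.
  have -> : e u%:Z v%:Z - quad w c d = e (u%:Z - c) (v%:Z - d).
    by rewrite /e /quad !rmorphB /=; ring.
  apply/ideal_ofP; exists (- x'), (- y); split; last by rewrite {1}vE; ring.
  have -> : c = c' + g%:Z * y * b%:Z by rewrite /c'; ring.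
  by rewrite uE PoszM; ring.
apply: inj_card_eq => k l /set_mem /= hk /set_mem /= hl /coset_eq.
move=> /(_ II (oe _ _) (oe _ _)).
have -> : r k - r l = e ((k %% (g * a))%N%:Z - (l %% (g * a))%N%:Z) ((k %/ (g * a))%N%:Z - (l %/ (g * a))%N%:Z).
  by rewrite /r /e /quad !rmorphB /=; ring.
move=> /ideal_ofP[s [t [h1 h2]]].
have lk : (k %/ (g * a) < g)%N by rewrite ltn_divLR // mulnA mulnn.
have ll : (l %/ (g * a) < g)%N by rewrite ltn_divLR // mulnA mulnn.
have mk := ltn_pmod k ga0; have ml := ltn_pmod l ga0.
have t0 : t = 0 by nia.
have dd : (k %/ (g * a) = l %/ (g * a))%N by move: h2; rewrite t0 mulr0; lia.
have s0 : s = 0 by move: h1; rewrite t0 mul0r addr0; nia.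
have mm : (k %% (g * a) = l %% (g * a))%N by move: h1; rewrite t0 s0 !mul0r addr0 mulr0; lia.
by rewrite (divn_eq k (g * a)) (divn_eq l (g * a)) dd mm.
Qed.

(** Take g to generate the coefficients of w that occur in I, and A the rational integers in I.
    Multiplication by w turns a first coordinate into a second one, so g divides all coordinates and
    A = g a. *)
Lemma ideal_classification (I : set K) : nonzero_ideals I ->
  exists g a b : nat, [/\ (0 < g)%N, (b < a)%N, (b ^ 2 = m %[mod a])%N & I = ideal_of g a b].
Proof.
move=> [[IO I0 ID IM] In0]; pose J x y := I (e x y).
have JM c d x y : J x y -> J (c * x + m%:Z * (d * y)) (c * y + d * x).
  by move=> h; rewrite /J /e -eM; apply: IM => //; apply/OE; do 2 eexists.
have JB x y x' y' : J x y -> J x' y' -> J (x - x') (y - y').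
  move=> h h'; rewrite /J /e -quadD; apply: ID => //.
  by have := JM (-1) 0 _ _ h'; rewrite !mul0r mulr0 !addr0 !mulN1r.
have Jeq x y x' y' : J x y -> x = x' -> y = y' -> J x' y' by move=> h <- <-.
have [x1 [y1 [J1 n1]]] : exists x y, J x y /\ ~ (x = 0 /\ y = 0).
  apply: contrapT => H; apply: In0; apply/seteqP; split=> [z Iz|_ ->//].
  have /OE[c [d zE]] := IO z Iz; apply: contrapT => z0; apply: H; exists c, d.
  split; first by rewrite /J /e -zE.
  by move=> [c0 d0]; apply: z0; rewrite /= zE c0 d0 /quad !mulr0z mul0r addr0.
have [||g [g0 [b0 Jg] gall]] := @int_subgroup (fun y => exists x, J x y).
- by move=> y y' [x h] [x' h']; exists (x - x'); exact: JB.
- have [y0|y0] := eqVneq y1 0; last by exists y1 => //; exists x1.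
  exists x1; last by apply/eqP => x0; apply: n1.
  by eexists; apply: (Jeq _ _ _ _ (JM 0 1 _ _ J1) erefl); ring.
have [||A [A0 JA Aall]] := @int_subgroup (fun x => J x 0).
- by move=> x x' h h'; rewrite -(subr0 0); exact: JB.
(* The norm of a nonzero element lies in I, being a multiple of it by the conjugate; it is nonzero
   because m is not a rational square. *)
- exists (x1 * x1 + m%:Z * (- y1 * y1)).
    by apply: (Jeq _ _ _ _ (JM x1 (- y1) _ _ J1) erefl); ring.
  apply/eqP => h; have := radicand_not_square m4.
  have [y0|y0] := eqVneq y1 0.
    move: h; rewrite y0 !mulr0 addr0 => /eqP; rewrite mulf_eq0 orbb => /eqP x0.
    by case: n1.
  move=> /(_ (x1%:~R / y1%:~R)); rewrite expr_div_n => /eqP; apply.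
  have y0' : y1%:~R ^+ 2 != 0 :> rat by rewrite expf_neq0 // intr_eq0.
  apply: (mulIf y0'); rewrite divfK // pmulrn -!rmorphXn -rmorphM; congr (_%:~R).
  by apply/eqP; rewrite -subr_eq0; apply/eqP; rewrite -h; ring.
have [a Aa] : exists a : nat, A = (g * a)%N.
  have [k hk] : exists k, A%:Z = g%:Z * k.
    by apply: gall; eexists; apply: (Jeq _ _ _ _ (JM 0 1 _ _ JA) erefl); ring.
  by exists `|k|%N; nia.
have a0 : (0 < a)%N by move: A0; rewrite Aa muln_gt0 => /andP[].
have [b1 hb1] : exists b1, b0 = g%:Z * b1.
  by apply: gall; eexists; apply: (Jeq _ _ _ _ (JM 0 1 _ _ Jg) erefl); ring.
have an : a%:Z != 0 by lia.
pose b := `|(b1 %% a)%Z|%N.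
have bE : b%:Z = b1 - (b1 %/ a)%Z * a%:Z.
  by rewrite /b gez0_abs ?modz_ge0 // {2}(divz_eq b1 a); ring.
have ba : (b < a)%N by rewrite /b -ltz_nat gez0_abs ?modz_ge0 // ltz_pmod // ltz_nat.
have JAk k : J (A%:Z * k) 0.
  by apply: (Jeq _ _ _ _ (JM k 0 _ _ JA)); ring.
have Jb : J (g%:Z * b%:Z) g%:Z.
  by apply: (Jeq _ _ _ _ (JB _ _ _ _ Jg (JAk (b1 %/ a)%Z))); rewrite ?bE ?hb1 ?Aa ?PoszM; ring.
have Jall x y : J x y -> exists s t, x = g%:Z * (s * a%:Z + t * b%:Z) /\ y = g%:Z * t.
  move=> h; have [t yt] : exists t, y = g%:Z * t by apply: gall; exists x.
  have [s hs] : exists s, x - t * (g%:Z * b%:Z) = A%:Z * s.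
    apply: Aall; apply: (Jeq _ _ _ _ (JB _ _ _ _ h (JM t 0 _ _ Jb))); first by ring.
    by rewrite yt; ring.
  exists s, t; split=> //; rewrite Aa PoszM in hs.
  by rewrite -[LHS](subrK (t * (g%:Z * b%:Z))) hs; ring.
exists g, a, b; split=> //.
  (* Writing w g (b + w) = g m + g b w in the basis forces t = b and m = s a + b^2. *)
  have [s [t [h1 h2]]] := Jall _ _ (JM 0 1 _ _ Jb).
  have gn : g%:Z != 0 by lia.
  move: h2; rewrite !mul0r !add0r !mul1r => /(mulfI gn) tb.
  move: h1; rewrite !mul0r !add0r !mul1r mulrC => /(mulfI gn) h1.
  have : (m%:Z == (b ^ 2)%N%:Z %[mod a])%Z.
    by rewrite eqz_mod_dvd; apply/dvdzP; exists s; rewrite h1 -tb Posz_sqr; ring.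
  by rewrite !modz_nat => /eqP[].
apply/seteqP; split=> [z Iz|_ [s [t ->]]].
  by have /OE[c [d zE]] := IO z Iz; rewrite zE; apply/ideal_ofP; apply: Jall; rewrite /J /e -zE.
have -> : e (g%:Z * (s * a%:Z + t * b%:Z)) (g%:Z * t) = e (A%:Z * s - (- t * (g%:Z * b%:Z) + m%:Z * (0 * g%:Z))) (0 - (- t * g%:Z + 0 * (g%:Z * b%:Z))).
  by rewrite Aa PoszM; congr quad; ring.
by apply: JB => //; exact: JM.
Qed.

Definition rho (a : nat) : nat := count (fun b => b ^ 2 == m %[mod a])%N (iota 0 a).

Definition ideal_params (n : nat) : seq (nat * nat) :=
  [seq (g, b) | g <- [seq g <- iota 1 n | (g ^ 2 %| n)%N],
    b <- [seq b <- iota 0 (n %/ g ^ 2) | (b ^ 2 == m %[mod n %/ g ^ 2])%N]].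

Definition ideal_list (n : nat) : seq (set K) :=
  [seq ideal_of gb.1 (n %/ gb.1 ^ 2) gb.2 | gb <- ideal_params n].

Lemma ideal_paramsP n g b : reflect
  [/\ (0 < g <= n)%N, (g ^ 2 %| n)%N, (b < n %/ g ^ 2)%N & (b ^ 2 = m %[mod n %/ g ^ 2])%N]
  ((g, b) \in ideal_params n).
Proof.
apply: (iffP allpairsPdep) => [[g' [b' [hg hb [-> ->]]]]|[h1 h2 h3 h4]].
  move: hg hb; rewrite !mem_filter !mem_iota add0n => /andP[h1 h2] /andP[/eqP h3 h4].
  by split=> //; lia.
exists g, b; rewrite !mem_filter !mem_iota add0n h2 h3 h4 eqxx; split=> //=.
Qed.

Lemma size_ideal_list n : size (ideal_list n) =
  \sum_(1 <= g < n.+1 | (g ^ 2 %| n)%N) rho (n %/ g ^ 2).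
Proof.
rewrite size_map size_allpairs_dep sumnE big_map big_filter /index_iota subn1.
by apply: eq_bigr => g _; rewrite size_filter.
Qed.

Lemma ideal_list_uniq n : (0 < n)%N -> uniq (ideal_list n).
Proof.
move=> n0; rewrite map_inj_in_uniq.
  apply: allpairs_uniq_dep; first by rewrite filter_uniq // iota_uniq.
    by move=> g _; rewrite filter_uniq // iota_uniq.
  by move=> [g b] [g' b'] _ _ [-> ->].
move=> [g b] [g' b'] /ideal_paramsP[/andP[h1 _] h2 h3 _] /ideal_paramsP[/andP[k1 _] k2 k3 _] /=.
by move=> /(ideal_of_inj h1 h3 k1 k3)[-> _ ->].
Qed.

Lemma ideal_listP n (I : set K) : (0 < n)%N ->
  I \in ideal_list n <-> nonzero_ideals I /\ ideal_norm I = n.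
Proof.
move=> n0; split=> [/mapP[[g b] /ideal_paramsP[/andP[h1 _] h2 h3 h4] ->] /=|].
  have a0 : (0 < n %/ g ^ 2)%N by exact: leq_ltn_trans h3.
  split; first exact: ideal_of_ideal.
  by rewrite ideal_norm_of // mulnC divnK.
move=> [/ideal_classification[g [a [b [g0 ba bm ->]]]]].
have a0 : (0 < a)%N by exact: leq_ltn_trans ba.
rewrite ideal_norm_of // => nE; apply/mapP; exists (g, b) => /=.
  apply/ideal_paramsP; rewrite -nE dvdn_mulr // mulKn ?expn_gt0 ?g0 //; split=> //.
  by rewrite expnS expn1; nia.
by rewrite -nE mulKn ?expn_gt0 ?g0.
Qed.

Lemma ideal_norm_gt0 (I : set K) : nonzero_ideals I -> (0 < ideal_norm I)%N.
Proof.
move=> /ideal_classification[g [a [b [g0 ba bm ->]]]].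
have a0 : (0 < a)%N by exact: leq_ltn_trans ba.
by rewrite ideal_norm_of // muln_gt0 expn_gt0 g0.
Qed.
End Ideals.

(** * Square roots of m modulo n, and the number of ideals of norm n *)

Section PrimePowerRoots.
Variable m : nat.

Lemma eqn_mod_dvdz (a x y : nat) : (x == y %[mod a])%N = (a%:Z %| x%:Z - y%:Z)%Z.
Proof. by rewrite -eqz_mod_dvd !modz_nat. Qed.

Lemma sqr_mod_dvdz (a b : nat) : (b ^ 2 == m %[mod a])%N = (a%:Z %| b%:Z ^+ 2 - m%:Z)%Z.
Proof. by rewrite eqn_mod_dvdz Posz_sqr. Qed.

Lemma rho1 : rho m 1 = 1%N.
Proof. by rewrite /rho /= !modn1. Qed.

Lemma sqr_mod_mod (a b : nat) : ((b %% a) ^ 2 == m %[mod a])%N = (b ^ 2 == m %[mod a])%N.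
Proof. by rewrite modnXm. Qed.

Lemma rhoM a b : (0 < a)%N -> (0 < b)%N -> coprime a b -> rho m (a * b) = (rho m a * rho m b)%N.
Proof.
move=> a0 b0 co; have ab0 : (0 < a * b)%N by rewrite muln_gt0 a0.
rewrite /rho -!size_filter -(size_allpairs pair); set A := seq.filter _ (iota 0 a); set B := seq.filter _ (iota 0 b).
rewrite -(size_map (fun z => (z %% a, z %% b)%N)); apply/perm_size/uniq_perm.
- rewrite map_inj_in_uniq ?filter_uniq ?iota_uniq // => x y.
  rewrite !mem_filter !mem_iota !add0n /= => /andP[_ hx] /andP[_ hy] [h1 h2].
  rewrite -(modn_small hx) -(modn_small hy); apply/eqP.
  by rewrite chinese_remainder // h1 h2 !eqxx.
- by apply: allpairs_uniq; rewrite ?filter_uniq ?iota_uniq // => -[? ?] [? ?] _ _ [-> ->].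
move=> [x y]; apply/mapP/allpairsP => [[z + [-> ->]]|[[x' y'] /= [+ + [-> ->]]]].
  rewrite mem_filter mem_iota add0n /= chinese_remainder // => /andP[/andP[h1 h2] hz].
  by exists (z %% a, z %% b)%N; rewrite !mem_filter !mem_iota !add0n /= !ltn_mod a0 b0 !sqr_mod_mod h1 h2.
rewrite !mem_filter !mem_iota !add0n /= => /andP[h1 hx] /andP[h2 hy].
exists (chinese a b x' y' %% (a * b))%N; last first.
  rewrite (modn_dvdm _ (dvdn_mulr b (dvdnn a))) (modn_dvdm _ (dvdn_mull a (dvdnn b))).
  rewrite chinese_modl // chinese_modr //.
  by rewrite !modn_small.
rewrite mem_filter mem_iota add0n /= ltn_mod ab0 andbT sqr_mod_mod chinese_remainder //.
rewrite -(sqr_mod_mod a) chinese_modl // sqr_mod_mod h1 /=.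
by rewrite -(sqr_mod_mod b) chinese_modr // sqr_mod_mod.
Qed.

Lemma rho_size (s : seq nat) a : uniq s ->
  (forall b, (b \in s) = (b < a)%N && (b ^ 2 == m %[mod a])%N) -> rho m a = size s.
Proof.
move=> us hs; rewrite /rho -size_filter; apply/perm_size/uniq_perm => //.
  by rewrite filter_uniq // iota_uniq.
by move=> b; rewrite mem_filter mem_iota add0n hs andbC.
Qed.

Variable p : nat.
Hypothesis p_pr : prime p.

(** Modulo p the only root is 0; a root modulo p^2 would be divisible by p and make p^2 divide m. *)
Lemma rho_ramified k : (p %| m)%N -> ~~ (p ^ 2 %| m)%N -> rho m (p ^ k) = (k <= 1)%N.
Proof.
move=> pm p2m; case: k => [|[|k]]; first by rewrite expn0 rho1.
  rewrite expn1; apply: (@rho_size [:: 0%N]) => // b; rewrite inE (eqP pm : m %% p = 0)%N.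
  rewrite -/(dvdn p (b ^ 2)) Euclid_dvdX // andbT.
  apply/eqP/andP => [->|[bp pb]]; first by rewrite prime_gt0.
  by apply/eqP; rewrite -leqn0 leqNgt; apply/negP => /dvdn_leq/(_ pb); rewrite leqNgt bp.
apply: (@rho_size [::]) => // b; rewrite in_nil; apply/esym/negbTE/negP => /andP[_ /eqP h].
have h2 : b ^ 2 = m %[mod p ^ 2].
  have pk : (p ^ 2 %| p ^ k.+2)%N by rewrite dvdn_exp2l.
  by rewrite -(modn_dvdm _ pk) h modn_dvdm.
have pb : (p %| b)%N.
  have : (p %| b ^ 2)%N by rewrite /dvdn -(modn_dvdm _ (dvdn_exp (isT : 0 < 2)%N (dvdnn p))) h2 modn_dvdm // dvdn_exp.
  by rewrite Euclid_dvdX // andbT.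
case/negP: p2m; rewrite /dvdn -h2; exact: dvdn_exp2r.
Qed.

Hypotheses (p_odd : odd p) (pm : ~~ (p %| m)%N).

Lemma root_not_dvd k b : (0 < k)%N -> (b ^ 2 = m %[mod p ^ k])%N -> ~~ (p %| b)%N.
Proof.
move=> k0 h; apply: contra pm => pb.
have pk : (p %| p ^ k)%N by rewrite dvdn_exp.
by rewrite /dvdn -(modn_dvdm _ pk) -h modn_dvdm // -/(dvdn _ _) dvdn_exp.
Qed.

(** The modulus divides (x - b)(x + b), and p cannot divide both factors, as it would divide 2x. So
    the full power divides one factor, and x is b or the opposite root. *)
Lemma rho_two k b : (0 < k)%N -> (b < p ^ k)%N -> (b ^ 2 = m %[mod p ^ k])%N -> rho m (p ^ k) = 2.
Proof.
move=> k0 bk hb; have pb := root_not_dvd k0 hb; set q := (p ^ k)%N in bk hb *.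
have b0 : (0 < b)%N by rewrite lt0n; apply: contraNneq pb => ->.
have q0 : (0 < q)%N by rewrite expn_gt0 prime_gt0.
have oq : odd q by rewrite oddX p_odd orbT.
have hb' : ((q - b) ^ 2 = m %[mod q])%N.
  rewrite -hb; apply/eqP; rewrite eqn_mod_dvdz; apply/dvdzP; exists (q%:Z - 2 * b%:Z).
  by rewrite !Posz_sqr -subzn ?(ltnW bk) //; ring.
apply: (@rho_size [:: b; (q - b)%N]) => [|x].
  rewrite /= inE andbT; apply: contraTneq oq => h.
  have even (r : nat) : b = (r - b)%N -> (b < r)%N -> ~~ odd r.
    by move=> h1 h2; rewrite (_ : r = b.*2) ?odd_double //; move: h1 h2; clear; lia.
  exact: even bk.
rewrite !inE; apply/orP/andP => [[/eqP->|/eqP->]|[xq /eqP hx]].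
- by rewrite bk hb.
- by rewrite hb' ltn_subrL b0 q0.
have px := root_not_dvd k0 hx.
have D : (q %| `|x%:Z - b%:Z| * (x + b))%N.
  have : (q%:Z %| x%:Z ^+ 2 - (b ^ 2)%N%:Z)%Z.
    by rewrite -Posz_sqr -eqn_mod_dvdz hx -hb.
  by rewrite Posz_sqr subr_sqr dvdzE abszM.
have [pd|npd] := boolP (p %| x + b)%N.
  have : (q %| x + b)%N.
    move: D; rewrite Gauss_dvdr // coprimeXl // prime_coprime //; apply/negP => pd2.
    have /dvdzP[u hu] : (p%:Z %| x%:Z - b%:Z)%Z by rewrite dvdzE.
    have /dvdnP[v hv] := pd.
    have : (p %| 2 * x)%N.
      suff : (p%:Z %| (2 * x)%N%:Z)%Z by rewrite dvdzE.
      by apply/dvdzP; exists (u + v%:Z); move: hu hv; clear; lia.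
    rewrite Euclid_dvdM // (negPf px) orbF dvdn_prime2 // => /eqP h.
    by move: p_odd; rewrite h.
  clearbody q; move=> /dvdnP[[|[|j]] hj]; right; apply/eqP.
  - by move: hj b0; clear; lia.
  - by move: hj bk; clear; lia.
  - have : (2 * q <= j.+2 * q)%N by rewrite leq_mul2r orbT.
    by rewrite -hj; move: xq bk; clear; lia.
have : (q%:Z %| x%:Z - b%:Z)%Z.
  rewrite dvdzE /=; move: D; rewrite Gauss_dvdl // coprimeXl // prime_coprime //.
move=> /dvdzP[j hj]; left; apply/eqP.
have [j0|[j1|j1]] : j = 0 \/ (1 <= j \/ j <= -1) by clear; lia.
- by move: hj; rewrite j0 mul0r; clear; lia.
- have : q%:Z <= j * q%:Z by rewrite ler_peMl.
  by rewrite -hj; move: xq; clear; lia.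
- have : q%:Z <= - j * q%:Z by rewrite ler_peMl // lerNr.
  by rewrite mulNr -hj; move: bk; clear; lia.
Qed.

(** A Newton step, with v an inverse of 2c modulo r and e the quotient of the current error by P;
    the multiple D of P2 accounts for reducing the new root into range. *)
Lemma hensel_step (c e u v r Pk P P2 D n : int) : P = r * Pk -> P2 = r * P ->
  c ^+ 2 - n = e * P -> u * r + v * (2 * c) = 1 ->
  (P2 %| (c + - e * v * P - D * P2) ^+ 2 - n)%Z.
Proof.
move=> hP hP2 he uv; pose c' := c + - e * v * P.
apply/dvdzP; exists (- 2 * c' * D + D * D * P2 + e * u + (e * v) ^+ 2 * Pk).
have -> : (c + - e * v * P - D * P2) ^+ 2 - n =
    (c ^+ 2 - n) - e * P * (v * (2 * c)) + (e * v) ^+ 2 * P * P + P2 * (- 2 * c' * D + D * D * P2).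
  by rewrite /c'; ring.
have -> : v * (2 * c) = 1 - u * r by rewrite -[X in X - _]uv; ring.
have -> : (e * v) ^+ 2 * P * P = (e * v) ^+ 2 * P * (r * Pk) by rewrite -hP.
by rewrite he hP2; ring.
Qed.

Lemma root_lift b k : (b ^ 2 = m %[mod p])%N ->
  exists2 c, (c < p ^ k.+1)%N & (c ^ 2 = m %[mod p ^ k.+1])%N.
Proof.
move=> hb; have p0 := prime_gt0 p_pr.
elim: k => [|k [c ck hc]].
  by exists (b %% p)%N; rewrite expn1 ?ltn_mod // modnXm.
have pc := root_not_dvd (ltn0Sn k) hc.
have co : coprimez p%:Z (2 * c%:Z).
  rewrite coprimezE abszM /= prime_coprime // Euclid_dvdM // (negPf pc) orbF dvdn_prime2 //.
  by apply/negP => /eqP h; move: p_odd; rewrite h.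
have [[u v] /= uv] := coprimezP _ _ co.
have /dvdzP[e he] : ((p ^ k.+1)%N%:Z %| c%:Z ^+ 2 - m%:Z)%Z by rewrite -sqr_mod_dvdz hc.
pose t := - e * v.
pose c' := c%:Z + t * (p ^ k.+1)%N%:Z.
have hP : (p ^ k.+2)%N%:Z = p%:Z * (p ^ k.+1)%N%:Z by rewrite expnS PoszM.
have hP' : (p ^ k.+1)%N%:Z = p%:Z * (p ^ k)%N%:Z by rewrite expnS PoszM.
have P0 : (p ^ k.+2)%N%:Z != 0 by have := expn_gt0 p k.+2; rewrite p0 /=; lia.
pose x := `|(c' %% (p ^ k.+2)%N)%Z|%N.
have xE : x%:Z = c' - (c' %/ (p ^ k.+2)%N)%Z * (p ^ k.+2)%N%:Z.
  by rewrite /x gez0_abs ?modz_ge0 // {2}(divz_eq c' (p ^ k.+2)%N); ring.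
exists x; first by rewrite /x -ltz_nat gez0_abs ?modz_ge0 // ltz_pmod // ltz_nat expn_gt0 p0.
apply/eqP; rewrite sqr_mod_dvdz xE; exact: hensel_step hP' hP he uv.
Qed.
End PrimePowerRoots.

Section DivisorSums.

Lemma sum_divisors_pfactor (V : nmodType) (p e n : nat) (phi : nat -> V) :
  prime p -> (0 < n)%N -> ~~ (p %| n)%N ->
  \sum_(g <- divisors (p ^ e * n)) phi g =
  \sum_(0 <= j < e.+1) \sum_(g <- divisors n) phi (p ^ j * g)%N.
Proof.
move=> pp n0 pn; have p0 := prime_gt0 pp.
have pe0 : (0 < p ^ e * n)%N by rewrite muln_gt0 expn_gt0 p0.
have lg j g : (0 < g)%N -> ~~ (p %| g)%N -> logn p (p ^ j * g) = j.
  move=> g0 pg; rewrite lognM ?expn_gt0 ?p0 // pfactorK // (_ : logn p g = 0)%N ?addn0 //.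
  by apply: logn_coprime; rewrite prime_coprime.
transitivity (\sum_(g <- [seq (p ^ j * g)%N | j <- index_iota 0 e.+1, g <- divisors n]) phi g);
  last by rewrite big_allpairs_dep.
apply/perm_big/uniq_perm; first exact: divisors_uniq.
- apply: allpairs_uniq; [exact: iota_uniq|exact: divisors_uniq|].
  move=> x y /allpairsP[[j g] [_ h ->]] /allpairsP[[j' g'] [_ h' ->]] E.
  rewrite /= in h h' E *.
  rewrite -dvdn_divisors // in h; rewrite -dvdn_divisors // in h'.
  have g0 := dvdn_gt0 n0 h; have g0' := dvdn_gt0 n0 h'.
  have pg : ~~ (p %| _)%N := contra (fun H => dvdn_trans H h) pn.
  have pg' : ~~ (p %| _)%N := contra (fun H => dvdn_trans H h') pn.
  have jj := congr1 (logn p) E; rewrite !lg // in jj; rewrite -jj; congr pair.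
  have pj : (0 < p ^ j)%N by rewrite expn_gt0 p0.
  by subst j'; apply/eqP; rewrite -(eqn_pmul2l pj) E.
move=> g; apply/idP/allpairsP => [|[[j g'] /= []]].
  rewrite -dvdn_divisors // => gd; have g0 := dvdn_gt0 pe0 gd.
  have [g' cg' gE] := pfactor_coprime pp g0.
  exists (logn p g, g'); split => /=; last by rewrite mulnC.
    rewrite mem_index_iota /= ltnS -[leqRHS](lg e n n0 pn); exact: dvdn_leq_log.
  rewrite -dvdn_divisors //.
  have : (g' %| p ^ e * n)%N by apply: dvdn_trans gd; rewrite gE dvdn_mulr.
  by rewrite Gauss_dvdr // coprime_sym coprimeXl.
rewrite mem_index_iota ltnS -!dvdn_divisors // => je gn ->.
by rewrite dvdn_mul // dvdn_exp2l.
Qed.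

Variable d : nat.
Hypotheses (d_odd : odd d) (d_sf : squarefree d).
Let m := (2 * d)%N.
Let q := (8 * d)%N.
Let d0 : (0 < d)%N. Proof. by case/andP: d_sf. Qed.

Lemma radicand_mod4 : (m %% 4 = 2)%N.
Proof. by rewrite /m; lia. Qed.

Lemma radicand_squarefree p : prime p -> ~~ (p ^ 2 %| m)%N.
Proof.
move=> pp; have [p2|po] := even_prime pp.
  by rewrite p2; apply/negP; rewrite /dvdn; have := radicand_mod4; move=> ->.
have co : coprime (p ^ 2) 2 by rewrite coprimen2 oddX po orbT.
rewrite /m Gauss_dvdr //; case/andP: d_sf => _ /allP H; apply/negP => h.
have pd : p \in primes d.
  by rewrite mem_primes pp d0 (dvdn_trans _ h) // dvdn_exp.
by have := H p pd; rewrite h.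
Qed.

Lemma dvd_conductor p : prime p -> (p %| q)%N = (p %| m)%N.
Proof.
move=> pp; rewrite /q /m (_ : 8 * d = 2 ^ 2 * (2 * d))%N; last by lia.
rewrite Euclid_dvdM // Euclid_dvdX // andbT.
by case: (boolP (p %| 2)%N) => //= h; rewrite Euclid_dvdM // h.
Qed.

(** Since 8d = 2^2 (2d), the conductor and the radicand are squares modulo the same odd primes, so
    reciprocity makes psi(p) decide whether m has a root; Hensel lifting then treats all powers of p
    alike. *)
Lemma rho_psi p k : prime p -> ~~ (p %| m)%N ->
  (rho m (p ^ k.+1))%:Z = 1 + psi d p /\ (psi d p = 1 \/ psi d p = -1).
Proof.
move=> pp pm; have po : odd p.
  by have [p2|//] := even_prime pp; move: pm; rewrite p2 /m dvdn_mulr.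
have p0 := prime_gt0 pp.
have p2 : (p == 2)%N = false by apply/negP => /eqP h; rewrite h in po.
have pch := pchar_Fp pp.
have psiE : psi d p = legendre q%:Z p.
  by rewrite -(kronecker_prime_psi d_odd d_sf pp) /kronecker_prime p2.
have qp : (p %| q%:Z)%Z = false by rewrite dvdzE /= dvd_conductor // (negPf pm).
have two0 : 2%:R != 0 :> 'F_p by rewrite -(dvdn_pcharf pch) dvdn_prime2 // p2.
have root (b : nat) : (b ^ 2 == m %[mod p])%N = ((b%:R : 'F_p) ^+ 2 == m%:R).
  by rewrite sqr_mod_dvdz (dvdz_pcharf pch) rmorphB rmorphXn /= subr_eq0 -!pmulrn.
have qF : (q%:Z)%:~R = 4 * m%:R :> 'F_p.
  by rewrite -pmulrn -natrM; congr (_%:R); rewrite /q /m; lia.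
rewrite psiE /legendre qp; case: ifPn => [/existsP[x /eqP hx]|/existsPn nx]; split; try by [left|right].
  have [|c ck hc] := root_lift pp po pm k (b := val (x / 2%:R)).
    apply/eqP; rewrite root natr_Zp expr_div_n hx qF (_ : 4 = 2%:R ^+ 2 :> 'F_p); last by rewrite expr2 -natrM.
    by rewrite mulrAC divff ?mul1r // expf_neq0.
  by rewrite (rho_two pp po pm _ ck hc).
rewrite subrr; congr Posz; apply: (@rho_size m [::]) => // b.
rewrite in_nil; apply/esym/negbTE/negP => /andP[_ /eqP h].
have : (b ^ 2 == m %[mod p])%N.
  have pk : (p %| p ^ k.+1)%N by rewrite dvdn_exp.
  by rewrite -(modn_dvdm _ pk) h modn_dvdm.
rewrite root => /eqP hb; case/negP: (nx (2 * b%:R)).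
rewrite exprMn hb qF (_ : 4 = 2%:R ^+ 2 :> 'F_p) //.
by rewrite expr2 -natrM.
Qed.

Let S p e := (\sum_(0 <= j < e.+1 | (j.*2 <= e)%N) rho m (p ^ (e - j.*2)))%N.
Let T p e := \sum_(0 <= i < e.+1) psi d p ^+ i.

(** Both sides satisfy a recursion with step 2: one grows by rho(p^(e+2)), the other by psi^(e+1) +
    psi^(e+2), and both increments equal 1 + psi(p) if psi(p) is 1 or -1, and 0 if p is ramified. *)
Lemma local_factor p e : prime p -> (S p e)%:Z = T p e.
Proof.
move=> pp.
have S2 e' : S p e'.+2 = (rho m (p ^ e'.+2) + S p e')%N.
  rewrite /S big_mkcond [in RHS]big_mkcond /= big_nat_recl // [X in (_ + X)%N]big_nat_recr //=.
  rewrite subn0; congr addn; rewrite [X in (_ + X)%N]ifF ?addn0; last by rewrite -addnn; lia.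
  by apply: eq_bigr => j _; rewrite doubleS !ltnS !subSS.
have T2 e' : T p e'.+2 = T p e' + psi d p ^+ e'.+1 + psi d p ^+ e'.+2.
  by rewrite /T !big_nat_recr.
have [pm|pm] := boolP (p %| m)%N.
  have psi0 : psi d p = 0.
    by apply/eqP; rewrite psi_eq0 // prime_coprime // negbK dvd_conductor.
  have R k := @rho_ramified m p pp k pm (radicand_squarefree pp).
  suff : (S p e)%:Z = T p e /\ (S p e.+1)%:Z = T p e.+1 by case.
  elim: e => [|e [IH1 IH2]]; last first.
    by split => //; rewrite S2 T2 PoszD IH1 psi0 !expr0n R !addr0 add0r.
  split; first by rewrite /S /T big_mkcond !big_nat1 /= expn0 rho1.
  rewrite /S /T big_mkcond /= big_nat_recr // big_nat1 /= subn0 addn0 R.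
  by rewrite big_nat_recr //= big_nat1 psi0.
have [_ pV] := rho_psi 0 pp pm; have R k := (rho_psi k pp pm).1.
suff : (S p e)%:Z = T p e /\ (S p e.+1)%:Z = T p e.+1 by case.
elim: e => [|e [IH1 IH2]]; last first.
  split => //; rewrite S2 T2 PoszD IH1 R !exprS; case: pV => ->.
    by rewrite !mul1r expr1n; ring.
  by rewrite !mulN1r; ring.
split; first by rewrite /S /T big_mkcond !big_nat1 /= expn0 rho1.
rewrite /S /T big_mkcond /= big_nat_recr // big_nat1 /= subn0 addn0 R.
by rewrite big_nat_recr //= big_nat1.
Qed.

(** The factorisation zeta_K = zeta L on the level of coefficients: the left side counts the ideals
    of norm n by their content g. The full power of the least prime factor is split off and handled
    by [local_factor]. *)
Lemma sum_psi n : (0 < n)%N ->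
  (\sum_(1 <= g < n.+1 | (g ^ 2 %| n)%N) rho m (n %/ g ^ 2))%N%:Z = \sum_(k <- divisors n) psi d k.
Proof.
have toDiv N : (0 < N)%N -> (\sum_(1 <= g < N.+1 | (g ^ 2 %| N)%N) rho m (N %/ g ^ 2) =
    \sum_(g <- divisors N) if (g ^ 2 %| N)%N then rho m (N %/ g ^ 2) else 0)%N.
  move=> N0; rewrite -big_mkcond /= -big_filter -[RHS]big_filter.
  apply/perm_big/uniq_perm; rewrite ?filter_uniq ?divisors_uniq ?iota_uniq // => g.
  rewrite !mem_filter -dvdn_divisors // mem_index_iota ltnS.
  have [h|//] := boolP (g ^ 2 %| N)%N; rewrite /=.
  have gN : (g %| N)%N by apply: dvdn_trans h; rewrite dvdn_exp.
  by rewrite gN (dvdn_gt0 N0 gN) dvdn_leq.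
elim/ltn_ind: n => n IH n0; rewrite toDiv //.
have [n1|n1] := leqP n 1.
  have -> : n = 1%N by lia.
  by rewrite (_ : divisors 1 = [:: 1%N]) // !big_cons !big_nil /= divn1 rho1 psi1.
set p := pdiv n; have pp : prime p by rewrite pdiv_prime.
have p1 := prime_gt1 pp; have p0 := prime_gt0 pp.
have [n' cn' nE] := pfactor_coprime pp n0; rewrite mulnC in nE.
set e := logn p n in nE.
have e0 : (0 < e)%N by rewrite logn_gt0 mem_primes pp n0 pdiv_dvd.
have n'0 : (0 < n')%N by move: n0; rewrite nE muln_gt0 => /andP[].
have pn' : ~~ (p %| n')%N by rewrite -prime_coprime.
have n'n : (n' < n)%N.
  by rewrite nE ltn_Pmull // -{1}(expn0 p) ltn_exp2l.
rewrite nE !sum_divisors_pfactor //.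
have -> : \sum_(0 <= j < e.+1) \sum_(k <- divisors n') psi d (p ^ j * k) =
    T p e * \sum_(k <- divisors n') psi d k.
  rewrite mulr_suml; apply: eq_bigr => j _; rewrite mulr_sumr; apply: eq_bigr => k _.
  rewrite psiM //; congr (_ * _); elim: j => [|j IHj]; first by rewrite expn0 expr0 psi1.
  by rewrite expnS exprS psiM // IHj.
rewrite -IH // -local_factor // -PoszM toDiv // /S; congr Posz.
rewrite [X in _ = (X * _)%N]big_mkcond big_distrl; apply: eq_bigr => j _.
rewrite big_distrr /=; apply: eq_big_seq => g; rewrite -dvdn_divisors // => gn'.
have pg : ~~ (p %| g)%N := contra (fun H => dvdn_trans H gn') pn'.
have cg : coprime (p ^ e) (g ^ 2) by rewrite coprimeXl // coprimeXr // prime_coprime.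
have cpn : coprime (p ^ j.*2) n' by rewrite coprimeXl // prime_coprime.
have g0 := dvdn_gt0 n'0 gn'.
rewrite expnMn -expnM muln2.
have [h|h] := boolP (p ^ j.*2 * g ^ 2 %| p ^ e * n')%N; last first.
  case: (boolP (j.*2 <= e)%N) => [h1|_]; last by rewrite mul0n.
  case: (boolP (g ^ 2 %| n')%N) => [h2|_]; last by rewrite muln0.
  by case/negP: h; rewrite dvdn_mul // dvdn_exp2l.
have h1 : (j.*2 <= e)%N.
  rewrite -(dvdn_Pexp2l _ _ p1) -(Gauss_dvdl _ cpn); apply: dvdn_trans h.
  by rewrite dvdn_mulr.
have h2 : (g ^ 2 %| n')%N.
  have cge : coprime (g ^ 2) (p ^ e) by rewrite coprime_sym.
  rewrite -(Gauss_dvdr n' cge).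
  by apply: dvdn_trans h; rewrite dvdn_mull.
rewrite h1 h2; have /dvdnP[t tE] := h2.
have t0 : (0 < t)%N by move: n'0; rewrite tE muln_gt0 => /andP[].
have -> : (p ^ e * n' %/ (p ^ j.*2 * g ^ 2) = p ^ (e - j.*2) * t)%N.
  rewrite -{1}(subnKC h1) expnD tE (mulnC t) mulnACA.
  by rewrite mulKn ?muln_gt0 ?expn_gt0 ?p0 ?g0.
rewrite tE mulnK ?expn_gt0 ?g0 // rhoM ?expn_gt0 ?p0 //.
by rewrite coprimeXl // prime_coprime //; apply: contra pn' => pt; rewrite tE dvdn_mulr.
Qed.
End DivisorSums.

(** * The L-function on the half-plane Re s > 0 *)

Section DirichletFunction.
Variables (R : realType) (d : nat).
Hypotheses (d_odd : odd d) (d_sf : squarefree d).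
Let q := (8 * d)%N.
Let d0 : (0 < d)%N. Proof. by case/andP: d_sf. Qed.
Implicit Types s : R[i].

Definition psiC n : R[i] := (psiR R d n)%:C.
Let T N : R[i] := \sum_(i < N) psiC i.+1.

(* Summation by parts makes the Dirichlet series absolutely convergent for 0 < Re s. *)
Definition dirL s : R[i] := csum (fun n => T n.+1 * zterm 1 n s).

Let T_bound N : cmod (T N) <= 2 * q%:R.
Proof.
rewrite /T -rmorph_sum cmod_real; have := bounded_psiR R d_odd d_sf 1 N.+1.
by rewrite big_add1 /= big_mkord.
Qed.

Let q_ge0 : 0 <= 2 * q%:R :> R. Proof. by rewrite mulr_ge0. Qed.

Let term_bound s : 0 < re s -> exists2 e : R, 0 < e & exists2 r, 0 < r & exists K,
  forall n z, cmod (z - s) <= r -> cmod (T n.+1 * zterm 1 n z) <= K * n.+1%:R `^ (- (1 + e)).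
Proof.
move=> s0; have [|e e0 [r r0 [K hK]]] := @zterm_bound_disc R 0 s; first by rewrite ltrDr.
exists e => //; exists r => //; exists (2 * q%:R * K) => n z hz.
by rewrite cmodM -mulrA ler_pM ?cmod_ge0 // hK.
Qed.

Lemma cder_dirL s : 0 < re s -> exists l, cder dirL s l.
Proof.
move=> /term_bound[e e0 [r r0 [K hK]]]; apply: (csum_holo e0 r0 _ hK) => n z _.
have [l hl] := cder_zterm 1 n z.
by eexists; apply: cderM (cder_cst (T n.+1) z) hl.
Qed.

Lemma dirL_cconv s : 0 < re s ->
  cconv (fun N => \sum_(i < N) psiC i.+1 * npw i.+1 s) (dirL s).
Proof.
move=> s0; have [e e0 [r r0 [K hK]]] := term_bound s0.
have h1 : cconv (fun N => \sum_(i < N) T i.+1 * zterm 1 i s) (dirL s).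
  by apply: (mtest_conv e0 hK); rewrite /= subrr cmod0 ltW.
have h2 : cconv (fun N => T N * npw N.+1 s) 0.
  move=> f f0; have q1 : 0 < 2 * q%:R + 1 :> R by rewrite ltr_wpDl.
  have [|N hN] := npw_to0 s0 (e := f / (2 * q%:R + 1)); first by rewrite divr_gt0.
  exists N => n /hN; rewrite !subr0 ler_pdivlMr // => h.
  rewrite cmodM (le_trans _ h) // mulrC ler_wpM2l ?cmod_ge0 //.
  by rewrite (le_trans (T_bound n)) // lerDl.
rewrite -[dirL s]addr0; have := cconvD h1 h2; congr cconv; apply/funext.
elim=> [|N IH]; first by rewrite !big_ord0 /T big_ord0 mul0r addr0.
rewrite [in RHS]big_ord_recr /= -IH big_ord_recr /= /zterm big_geq // addr0.
by rewrite /T [in X in _ + X * npw N.+2 s = _]big_ord_recr [in X in _ + X * _ + _ = _]big_ord_recr /=; ring.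
Qed.

Lemma dirL_real (x : R) : 0 < x -> dirL x%:C = (realL d x)%:C.
Proof.
move=> x0; apply: cconv_unique (dirL_cconv (s := x%:C) x0) _ => e e0.
have /cvgrPdist_le/(_ _ e0)[N _ hN] := realL_cvg d_odd d_sf x0.
exists N => n Nn; have := hN n.+1 (leqW Nn).
rewrite distrC -cmod_real rmorphB; congr (cmod (_ - _) <= _).
rewrite rmorph_sum big_nat_recl // /psiR psi0 // mul0r rmorph0 add0r big_mkord.
by apply: eq_bigr => i _; rewrite rmorphM npw_real.
Qed.

Lemma is_dirichletL_cder f s : is_dirichletL (kronecker (8 * d)%N%:Z) f ->
  exists l, cder (f : R[i] -> R[i]) s l.
Proof. by case=> h _; eexists; apply: derivable_cder (h s). Qed.

Lemma cvg_cconv (u : nat -> CC R) (l : CC R) : u @ \oo --> l -> cconv u l.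
Proof.
move=> h e e0; have e0' : 0 < e%:C by rewrite ltcR.
have /cvgrPdist_le/(_ _ e0')[N _ hN] := h.
by exists N => n /hN; rewrite cmodBC cmodE lecR.
Qed.

(** The identity theorem ties any continuation to the concrete series, so facts proved for [dirL]
    and [realL] reach the abstract value at 1/2. *)
Lemma is_dirichletL_dirL f s : is_dirichletL (kronecker (8 * d)%N%:Z) f ->
  0 < re s -> f s = dirL s.
Proof.
move=> hf; apply: (@identity_halfplane R f dirL 0 1) => z hz.
- exact: is_dirichletL_cder hf.
- exact: cder_dirL.
have z0 : 0 < re z by rewrite (lt_trans _ hz).
apply: cconv_unique (dirL_cconv z0).
have := cvg_cconv (hf.2 z hz); congr cconv; apply/funext => N.
rewrite /series /= big_mkord; apply: eq_bigr => i _.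
by rewrite natcpow_npw // kronecker_psi // /psiC /psiR rmorph_int.
Qed.
End DirichletFunction.

Lemma big_divisors (V : nmodType) n (F : nat -> V) : (0 < n)%N ->
  \sum_(k <- divisors n) F k = \sum_(1 <= k < n.+1 | (k %| n)%N) F k.
Proof.
move=> n0; rewrite -[RHS]big_filter; apply: perm_big; apply: uniq_perm.
- exact: divisors_uniq.
- by rewrite filter_uniq // iota_uniq.
- move=> k; rewrite mem_filter mem_index_iota -dvdn_divisors //.
  case: (boolP (k %| n)%N) => //= kn.
  by rewrite ltnS (dvdn_leq n0 kn) andbT (dvdn_gt0 n0 kn).
Qed.

(** Both sides run over the pairs with k m <= X; from X to X + 1 the bound X / k grows by one
    exactly when k divides X + 1. *)
Lemma sum_divisors_exchange (V : nmodType) (F : nat -> nat -> V) (X : nat) :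
  \sum_(1 <= n < X.+1) \sum_(k <- divisors n) F k (n %/ k)%N =
  \sum_(1 <= k < X.+1) \sum_(1 <= m < (X %/ k).+1) F k m.
Proof.
elim: X => [|X IH]; first by rewrite !big_geq.
rewrite big_nat_recr //= IH big_divisors //.
have -> : \sum_(1 <= k < X.+1) \sum_(1 <= m < (X %/ k).+1) F k m =
    \sum_(1 <= k < X.+2) \sum_(1 <= m < (X %/ k).+1) F k m.
  by rewrite [in RHS]big_nat_recr //= divn_small // [X in _ + X]big_geq // addr0.
rewrite [X in _ + X]big_mkcond -big_split /=; apply: eq_big_nat => k /andP[k0 _].
rewrite divnS //; case: ifP => kX; last by rewrite add0n addr0.
by rewrite kX add1n [in RHS]big_nat_recr.
Qed.

Lemma ler_sum_subset (R : numDomainType) (I : eqType) (s t : seq I) (F : I -> R) :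
  uniq s -> uniq t -> {subset s <= t} -> (forall i, i \in t -> 0 <= F i) ->
  \sum_(i <- s) F i <= \sum_(i <- t) F i.
Proof.
move=> us ut st F0; rewrite [leRHS](bigID [in s]) /=.
have -> : \sum_(i <- s) F i = \sum_(i <- t | i \in s) F i.
  rewrite -[RHS]big_filter; apply: perm_big; apply: uniq_perm; rewrite ?filter_uniq //.
  by move=> i; rewrite mem_filter; case: (boolP (i \in s)) => //= /st ->.
by rewrite lerDl big_seq_cond sumr_ge0 // => i /andP[/F0].
Qed.

Lemma bernoulli (R : numDomainType) (e : R) n : 0 <= e <= 1 -> 1 - n%:R * e <= (1 - e) ^+ n.
Proof.
move=> /andP[e0 e1]; elim: n => [|n IH]; first by rewrite mul0r subr0.
have h : 0 <= 1 - e by rewrite subr_ge0.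
rewrite exprS (le_trans _ (ler_wpM2l h IH)) // -[n.+1%:R]natr1.
have := mulr_ge0 (ler0n R n) (mulr_ge0 e0 e0); set m := n%:R.
by rewrite -subr_ge0 => h2; rewrite -subr_ge0; apply: le_trans h2 _; rewrite le_eqVlt; apply/orP; left; apply/eqP; ring.
Qed.

(** * Nonvanishing at 1 *)

Section LambertCoefficient.
Variable R : realType.
Implicit Types x y : R.

Definition geo x n := \sum_(i < n) x ^+ i.
(** Equal to 1/n - (1 - x) x^n / (1 - x^n) for 0 <= x < 1; written with [geo], it is also meaningful
    at x = 1. *)
Definition lcoef x n := n%:R^-1 - x ^+ n / geo x n.

Lemma geoE x n : (1 - x) * geo x n = 1 - x ^+ n.
Proof. by rewrite -[RHS]opprB subrX1 -mulNr opprB. Qed.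

Lemma geo_gt0 x n : 0 <= x -> 0 < geo x n.+1.
Proof.
by move=> x0; rewrite /geo big_ord_recl expr0 ltr_pwDl // sumr_ge0 // => i _; rewrite exprn_ge0.
Qed.

(** The arithmetic-geometric mean inequality for the terms i and n - i. It needs the square root y
    of the base, which is why later statements take x = y^2. *)
Lemma geo_sqr y n : 0 <= y -> n.+1%:R * y ^+ n <= geo (y ^+ 2) n.+1.
Proof.
move=> y0; rewrite -(ler_pM2l (ltr0n R 2)) !mulr_natl [leRHS]mulr2n.
rewrite {2}/geo (reindex_inj rev_ord_inj) /= -big_split /=.
rewrite (_ : _ *+ 2 = \sum_(i < n.+1) y ^+ n *+ 2); last by rewrite sumr_const card_ord mulrnAC -mulr_natl.
apply: ler_sum => i _; rewrite subSS -!exprM.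
have E : y ^+ n = y ^+ i * y ^+ (n - i) by rewrite -exprD subnKC // -ltnS.
rewrite E ![(2 * _)%N]mulnC !exprM; set a := y ^+ i; set b := y ^+ (n - i).
by have := sqr_ge0 (a - b); nra.
Qed.

Lemma lcoef_ge0 x n : 0 <= x <= 1 -> 0 <= lcoef x n.+1.
Proof.
move=> /andP[x0 x1]; rewrite subr_ge0 ler_pdivrMr ?geo_gt0 // ler_pdivlMl ?ltr0n //.
rewrite mulr_natl (_ : _ *+ _ = \sum_(i < n.+1) x ^+ n.+1); last by rewrite sumr_const card_ord.
by apply: ler_sum => i _; rewrite ler_wiXn2l // ltnW.
Qed.

(** The decrease is 1/((n+1)(n+2)) - x^(n+1) / (geo geo). Two uses of [geo_sqr] bound the product
    below by (n+1)(n+2) y^(2n+1), and y^(2n+1) >= y^(2n+2) = x^(n+1). *)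
Lemma lcoef_decr y n : 0 <= y <= 1 -> lcoef (y ^+ 2) n.+2 <= lcoef (y ^+ 2) n.+1.
Proof.
move=> /andP[y0 y1]; set x := y ^+ 2.
have x0 : 0 <= x by rewrite exprn_ge0.
have g1 := geo_gt0 n x0; have g2 := geo_gt0 n.+1 x0.
have n1 : 0 < n.+1%:R :> R by rewrite ltr0n.
have n2 : 0 < n.+2%:R :> R by rewrite ltr0n.
have rec : geo x n.+2 = 1 + x * geo x n.+1.
  rewrite /geo big_ord_recl expr0 mulr_sumr; congr (_ + _).
  by apply: eq_bigr => i _; rewrite exprS.
have E : lcoef x n.+1 - lcoef x n.+2 =
    (n.+1%:R * n.+2%:R)^-1 - x ^+ n.+1 / (geo x n.+1 * geo x n.+2).
  have -> : (n.+1%:R * n.+2%:R)^-1 = n.+1%:R^-1 - n.+2%:R^-1 :> R.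
    rewrite -[n.+2%:R]natr1; move: (n.+1%:R : R) n1 => a a0.
    by field; rewrite !gt_eqF // ltr_wpDr.
  rewrite /lcoef; have -> : x ^+ n.+1 / (geo x n.+1 * geo x n.+2) =
      x ^+ n.+1 / geo x n.+1 - x ^+ n.+2 / geo x n.+2.
    rewrite [x ^+ n.+2]exprS; have := g2; rewrite rec => g2'.
    by field; rewrite !gt_eqF.
  by ring.
rewrite -subr_ge0 E subr_ge0 ler_pdivrMr ?mulr_gt0 // ler_pdivlMl ?mulr_gt0 //.
have h1 := geo_sqr n y0; have h2 := geo_sqr n.+1 y0.
apply: (@le_trans _ _ ((n.+1%:R * y ^+ n) * (n.+2%:R * y ^+ n.+1))); last first.
  by apply: ler_pM => //; rewrite mulr_ge0 // exprn_ge0.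
rewrite [leRHS](_ : _ = n.+1%:R * n.+2%:R * y ^+ (n + n.+1)); last by rewrite exprD; ring.
rewrite ler_wpM2l ?mulr_ge0 // /x -exprM ler_wiXn2l //.
by rewrite mul2n -addnn addSn.
Qed.
End LambertCoefficient.

Section Nonvanishing.
Variables (R : realType) (d : nat).
Hypotheses (d_odd : odd d) (d_sf : squarefree d).
Let q := (8 * d)%N.
Let d0 : (0 < d)%N. Proof. by case/andP: d_sf. Qed.
Let chi := psiR R d.
Let bc : bounded_sums chi (2 * q%:R) := bounded_psiR R d_odd d_sf.

Definition rdiv n : int := \sum_(k <- divisors n) psi d k.

Lemma rdiv_ge0 n : (0 < n)%N -> 0 <= rdiv n.
Proof. by move=> n0; rewrite /rdiv -(sum_psi d_odd d_sf n0). Qed.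

Lemma rdiv_sqr k : (0 < k)%N -> 1 <= rdiv (k ^ 2).
Proof.
move=> k0; have k2 : (0 < k ^ 2)%N by rewrite expn_gt0 k0.
rewrite /rdiv -(sum_psi d_odd d_sf k2) lez_nat big_mkcond (bigD1_seq k) /= ?iota_uniq //.
  by rewrite dvdnn divnn k2 /= /rho /= !modn1.
by rewrite mem_index_iota k0 ltnS leq_pmull.
Qed.

(** Grouping by the divisor k leaves geometric sums over the multiples of k up to X; the second
    power records where they are cut off. *)
Lemma sum_rdiv (x : R) X : x != 1 -> 0 <= x < 1 ->
  \sum_(1 <= n < X.+1) x ^+ n * (rdiv n)%:~R =
  \sum_(1 <= k < X.+1) chi k * ((x ^+ k - x ^+ (k * (X %/ k).+1)) / (1 - x ^+ k)).
Proof.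
move=> x1 /andP[x0 xl].
have -> : \sum_(1 <= n < X.+1) x ^+ n * (rdiv n)%:~R =
   \sum_(1 <= n < X.+1) \sum_(k <- divisors n) chi k * x ^+ (k * (n %/ k)).
  apply: eq_big_nat => n /andP[n0 _]; rewrite /rdiv rmorph_sum mulr_sumr.
  rewrite big_seq [RHS]big_seq; apply: eq_bigr => k; rewrite -dvdn_divisors // => kn.
  by rewrite mulnC divnK // mulrC.
rewrite (sum_divisors_exchange (fun k m => chi k * x ^+ (k * m))).
apply: eq_big_nat => k /andP[k0 _]; rewrite -mulr_sumr; congr (_ * _).
have xk : 1 - x ^+ k != 0.
  by rewrite subr_eq0 eq_sym lt_eqF // exprn_ilt1 // -lt0n.
apply: (mulIf xk); rewrite divfK //; elim: (X %/ k)%N => [|m IH].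
  by rewrite big_geq // mul0r muln1 subrr.
rewrite big_nat_recr //= mulrDl IH [(k * m.+2)%N]mulnS exprD.
by ring.
Qed.

(* After Monsky: if L(1) = 0 then sum r(n) x^n = sum chi(n) x^n / (1 - x^n) is,
   up to sign, the sum of chi(n) lcoef x n / (1 - x), which is bounded as x -> 1
   because [lcoef x] decreases from 1 - x; but r(n) >= 0 and r(k^2) >= 1. *)
Lemma realL1_neq0 : realL d (1 : R) != 0.
Proof.
apply/eqP => L0; set C : R := 2 * q%:R.
have C0 : 0 <= C by rewrite mulr_ge0.
have inv1 n : n%:R `^ (- 1) = n%:R^-1 :> R by rewrite powR_inv1.
have tail X : `|\sum_(1 <= n < X.+1) chi n * n%:R^-1| <= C / X.+1%:R.
  have := asum_tail bc (fun i i0 => powR_ge0 _ _) (fun i => @powR_decr R 1 i ler01) (powR_to0 (@ltr01 R)) (ltn0Sn X).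
  rewrite -/(realL d 1) L0 sub0r normrN inv1 big_ltn // /chi /psiR psi0 // mul0r add0r.
  by under eq_bigr do rewrite inv1.
have key (y x : R) X : 0 < y < 1 -> x = y ^+ 2 ->
    \sum_(1 <= n < X.+2) x ^+ n * (rdiv n)%:~R <=
    C + C / (1 - x) / X.+2%:R + y ^+ X.+1 / ((1 - y) * (1 - x)).
  move=> /andP[y0 y1]; set x' := y ^+ 2 => ->; rewrite {x}/x'; set x := y ^+ 2.
  have x0 : 0 < x by rewrite exprn_gt0.
  have x1 : x < 1 by rewrite exprn_ilt1 // ltW.
  have dx : 0 < 1 - x by rewrite subr_gt0.
  have dy : 0 < 1 - y by rewrite subr_gt0.
  rewrite sum_rdiv ?(ltW x0) ?lt_eqF //.
  (* The truncation error. Its exponent is at least X + 1 and at least k, so with x = y^2 the power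
     is at most y^(X+1) y^k, and the sum over k is again geometric. *)
  pose e k := x ^+ (k * (X.+1 %/ k).+1) / (1 - x ^+ k).
  have E k : (0 < k)%N -> chi k * ((x ^+ k - x ^+ (k * (X.+1 %/ k).+1)) / (1 - x ^+ k)) =
      (1 - x)^-1 * (chi k * k%:R^-1) - (1 - x)^-1 * (chi k * lcoef x k) - chi k * e k.
    case: k => // k _; rewrite /lcoef /e -geoE; have := geo_gt0 k (ltW x0).
    have : 0 < k.+1%:R :> R by rewrite ltr0n.
    set K := k.+1%:R; set g := geo x k.+1 => K0 g0.
    by field; rewrite !gt_eqF.
  rewrite (eq_big_nat _ _ (F2 := fun k => (1 - x)^-1 * (chi k * k%:R^-1) -
    (1 - x)^-1 * (chi k * lcoef x k) - chi k * e k)); last by move=> k /andP[k0 _]; exact: E.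
  rewrite !sumrB -!mulr_sumr.
  have b1 : `|\sum_(1 <= k < X.+2) chi k * lcoef x k| <= C * lcoef x 1.
    apply: (abel_bound bc) => //.
    - by case=> // i _; rewrite lcoef_ge0 // !ltW.
    - by case=> // i _ _; rewrite lcoef_decr // !ltW.
  have l1 : lcoef x 1 = 1 - x by rewrite /lcoef /geo big_ord1 expr0 invr1 mulr1 expr1.
  have b2 : `|\sum_(1 <= k < X.+2) chi k * e k| <= y ^+ X.+1 / ((1 - y) * (1 - x)).
    rewrite (le_trans (ler_norm_sum _ _ _)) //.
    apply: (@le_trans _ _ (\sum_(1 <= k < X.+2) y ^+ X.+1 / (1 - x) * y ^+ k)).
      rewrite big_nat [leRHS]big_nat; apply: ler_sum => k /andP[k0 kX].
      have xk : 0 < 1 - x ^+ k by rewrite subr_gt0 exprn_ilt1 // ?(ltW x0) // -lt0n.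
      rewrite normrM (le_trans (ler_wpM2r (normr_ge0 _) (normr_psiR R d k))) // mul1r.
      have ek : 0 <= e k by apply: divr_ge0; [rewrite exprn_ge0 // ltW|exact: ltW].
      rewrite (ger0_norm ek) /e [_ / (1 - x) * _]mulrAC; apply: ler_pM.
      + by rewrite exprn_ge0 // ltW.
      + by rewrite invr_ge0 ltW.
      + rewrite -exprD /x -exprM ler_wiXn2l ?(ltW y0) ?(ltW y1) //.
        rewrite mul2n -addnn leq_add //; last by rewrite leq_pmulr.
        by rewrite ltnW // mulnC ltn_ceil.
      + rewrite lef_pV2 ?posrE // lerD2l lerN2 -[leRHS]expr1 ler_wiXn2l ?(ltW x0) ?(ltW x1) //.
    have -> : y ^+ X.+1 / ((1 - y) * (1 - x)) = y ^+ X.+1 / (1 - x) * (1 - y)^-1.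
      by field; rewrite !gt_eqF.
    have c0 : 0 <= y ^+ X.+1 / (1 - x) by apply: divr_ge0; [rewrite exprn_ge0 // ltW|exact: ltW].
    rewrite -mulr_sumr ler_wpM2l //.
    rewrite -[leRHS]mul1r ler_pdivlMr // mulrC.
    have := geoE y X.+2; rewrite /geo big_ord_recl expr0 => h.
    have p : 0 <= y ^+ X.+2 by rewrite exprn_ge0 // ltW.
    rewrite big_add1 /= big_mkord; move: h; rewrite mulrDr mulr1.
    rewrite (_ : \sum_(i < X.+1) y ^+ lift ord0 i = \sum_(i < X.+1) y ^+ i.+1); last by apply: eq_bigr.
    move: p y0; lra.
  rewrite l1 in b1.
  have t1 : (1 - x)^-1 * (\sum_(1 <= k < X.+2) chi k * k%:R^-1) <= C / (1 - x) / X.+2%:R.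
    rewrite mulrAC mulrC ler_wpM2r ?invr_ge0 ?(ltW dx) //.
    exact: le_trans (ler_norm _) (tail _).
  have t2 : - ((1 - x)^-1 * \sum_(1 <= k < X.+2) chi k * lcoef x k) <= C.
    rewrite -mulrN -ler_pdivlMl ?invr_gt0 // invrK mulrC.
    by rewrite (le_trans (ler_norm _)) // normrN.
  have t3 : - (\sum_(1 <= k < X.+2) chi k * e k) <= y ^+ X.+1 / ((1 - y) * (1 - x)).
    by rewrite (le_trans (ler_norm _)) // normrN.
  rewrite [C + _]addrC; exact: lerD (lerD t1 t2) t3.
(* With ep = 1 / (4 K^2), Bernoulli's inequality keeps x^(K^2) >= 1/2, so the squares up to K^2
   contribute at least K / 2. This exceeds C + 2, where C is the uniform bound and the 2 absorbs two
   errors that vanish as X grows. *)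
pose K := (Num.bound (2 * (C + 2))).+1.
have KC : 2 * (C + 2) < K%:R.
  by rewrite (lt_trans (archi_boundP _)) ?ltr_nat // mulr_ge0 // addr_ge0.
have K0 : 0 < K%:R :> R by rewrite ltr0n.
have K1 : 1 <= K%:R :> R by rewrite ler1n.
pose ep : R := (4 * K%:R ^+ 2)^-1.
have ep0 : 0 < ep by rewrite invr_gt0 mulr_gt0 // exprn_gt0.
have ep1 : ep < 1.
  rewrite invf_lt1; last by rewrite mulr_gt0 // exprn_gt0.
  by have := exprn_ege1 2 K1; lra.
pose y := 1 - ep; have y01 : 0 < y < 1 by rewrite subr_gt0 ep1 gtrBl.
have /andP[y0 y1] := y01; set x := y ^+ 2.
have x0 : 0 < x by rewrite exprn_gt0.
have x1 : x < 1 by rewrite exprn_ilt1 // ltW.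
have xK : 2^-1 <= x ^+ (K ^ 2).
  rewrite -exprM; apply: le_trans (bernoulli (2 * K ^ 2) _); last by rewrite !ltW.
  rewrite natrM natrX /ep -/K [2 * _]mulrC.
  have -> : K%:R ^+ 2 * 2 / (4 * K%:R ^+ 2) = 2^-1 :> R by field; rewrite gt_eqF.
  by lra.
have lo X : (K ^ 2 <= X)%N -> K%:R / 2 <= \sum_(1 <= n < X.+2) x ^+ n * (rdiv n)%:~R.
  move=> KX; apply: (@le_trans _ _ (\sum_(n <- [seq (k ^ 2)%N | k <- iota 1 K]) x ^+ n * (rdiv n)%:~R)).
    rewrite big_map (_ : K%:R / 2 = \sum_(k <- iota 1 K) 2^-1); last first.
      by rewrite big_const_seq count_predT size_iota iter_addr addr0 mulr_natl.
    rewrite big_seq [leRHS]big_seq; apply: ler_sum => k; rewrite mem_iota add1n ltnS => /andP[k0 kK].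
    rewrite -[leLHS]mulr1 ler_pM // ?invr_ge0 //.
      rewrite (le_trans xK) // ler_wiXn2l ?(ltW x0) ?(ltW x1) // leq_sqr //.
    by rewrite ler1z rdiv_sqr.
  apply: ler_sum_subset.
  - by rewrite map_inj_uniq ?iota_uniq // => a b /eqP; rewrite eqn_sqr => /eqP.
  - exact: iota_uniq.
  - move=> n /mapP[k]; rewrite mem_iota add1n ltnS => /andP[k0 kK] ->.
    rewrite mem_index_iota expn_gt0 k0 /= ltnS (leq_trans _ (leqW KX)) // leq_sqr //.
  - move=> n; rewrite mem_index_iota => /andP[n0 _].
    have r0 : 0 <= (rdiv n)%:~R :> R by rewrite ler0z rdiv_ge0.
    by rewrite mulr_ge0 // exprn_ge0 // ltW.
have l1 : (fun X : nat => C / (1 - x) / X.+2%:R) @ \oo --> (0 : R).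
  rewrite -[X in _ --> X](mulr0 (C / (1 - x))); apply: cvgM; first exact: cvg_cst.
  have := @cvg_harmonic R; rewrite -cvg_shiftS; exact.
have l2 : (fun X => y ^+ X.+1 / ((1 - y) * (1 - x))) @ \oo --> (0 : R).
  rewrite -[X in _ --> X](mul0r ((1 - y) * (1 - x))^-1); apply: cvgM; last exact: cvg_cst.
  have : (fun n => y ^+ n) @ \oo --> (0 : R) by apply: cvg_expr; rewrite gtr0_norm.
  by rewrite -cvg_shiftS.
have /cvgrPdist_lt/(_ _ ltr01)[N1 _ h1] := l1.
have /cvgrPdist_lt/(_ _ ltr01)[N2 _ h2] := l2.
pose X := (K ^ 2 + N1 + N2)%N.
have XK : (K ^ 2 <= X)%N by rewrite /X -addnA leq_addr.
have XN1 : (N1 <= X)%N by rewrite /X -addnA addnCA leq_addr.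
have XN2 : (N2 <= X)%N by rewrite /X leq_addl.
have {}h1 := h1 X XN1; have {}h2 := h2 X XN2.
rewrite sub0r normrN in h1; rewrite sub0r normrN in h2.
have := le_trans (lo X XK) (key y x X y01 erefl).
have := le_lt_trans (ler_norm _) h1; have := le_lt_trans (ler_norm _) h2.
set U := y ^+ X.+1 / _; set V := _ / X.+2%:R; lra.
Qed.
End Nonvanishing.

(** * From ideals to the product of zeta(s) and L(s) *)

Section LevelSummation.
Variables (R : realType) (T : choiceType) (D : set T) (nrm : T -> nat).
Variables (l : nat -> seq T) (g : nat -> R[i]).
Hypothesis l_uniq : forall n, (0 < n)%N -> uniq (l n).
Hypothesis lP : forall n t, (0 < n)%N -> t \in l n <-> D t /\ nrm t = n.
Hypothesis nrm_gt0 : forall t, D t -> (0 < nrm t)%N.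

Let lev m n := [seq t | k <- index_iota m n, t <- l k].

Let levP m n t : (0 < m)%N -> t \in lev m n <-> D t /\ (m <= nrm t < n)%N.
Proof.
move=> m0; split=> [/allpairsPdep[k [t' [hk ht ->]]]|[Dt ht]].
  move: hk; rewrite mem_index_iota => hk; have k0 : (0 < k)%N by case/andP: hk => /(leq_trans m0).
  by have [Dt tk] := (lP t' k0).1 ht; rewrite tk.
by apply/allpairsPdep; exists (nrm t), t; rewrite mem_index_iota ht; split=> //; apply/lP => //; exact: nrm_gt0.
Qed.

Let lev_uniq m n : (0 < m)%N -> uniq (lev m n).
Proof.
move=> m0; have pos k : k \in index_iota m n -> (0 < k)%N.
  by rewrite mem_index_iota => /andP[/(leq_trans m0)].
apply: allpairs_uniq_dep; first exact: iota_uniq.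
  by move=> k /pos; exact: l_uniq.
move=> [k t] [k' t'] /allpairsPdep[a [u [ha hu [ka tu]]]] /allpairsPdep[b [v [hb hv [kb tv]]]] /= tt.
have [_ e1] := (lP u (pos _ ha)).1 hu; have [_ e2] := (lP v (pos _ hb)).1 hv.
have e3 : k = k' by rewrite ka kb -e1 -e2 -tu -tv tt.
by rewrite tt e3.
Qed.

Let sum_lev (V : nmodType) (F : nat -> V) m n : (0 < m)%N ->
  \sum_(t <- lev m n) F (nrm t) = \sum_(m <= k < n) F k *+ size (l k).
Proof.
move=> m0; rewrite big_allpairs_dep /= big_nat [RHS]big_nat; apply: eq_bigr => k /andP[mk _].
have k0 := leq_trans m0 mk.
rewrite big_seq (eq_bigr (fun=> F k)) => [|t /(lP t k0).1[_ ->] //].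
by rewrite -big_seq big_const_seq count_predT iter_addr addr0.
Qed.

(** The finite set consists of all elements of norm at most N. Any larger finite set contains these
    levels completely, and the rest of it is controlled by the tail of the absolute series. *)
Lemma has_sum_levels (L : R[i]) :
  cconv (fun X => \sum_(1 <= k < X.+1) g k *+ size (l k)) L ->
  (forall e : R, 0 < e -> exists N : nat, forall n m, (N <= n)%N ->
    \sum_(n <= k < m) cmod (g k) *+ size (l k) <= e) ->
  has_sum D (fun t => g (nrm t) : CC R) L.
Proof.
move=> hL hC e e0; have e3 : 0 < e / 3 by rewrite divr_gt0.
have [N1 h1] := hL _ e3; have [N2 h2] := hC _ e3.
set N := maxn N1 N2; exists [fset x in lev 1 N.+1]%fset.
  by move=> t /=; rewrite !inE => /levP[].
move=> B AB BD; rewrite cmodE ltcR.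
have AB' t : D t -> (nrm t <= N)%N -> t \in B.
  move=> Dt tN; apply: (AB t); rewrite /= !inE; apply/levP => //; split=> //.
  by rewrite ltnS tN nrm_gt0.
rewrite (bigID (fun t => nrm t <= N)%N) /= addrAC.
have E1 : \sum_(i <- B | (nrm i <= N)%N) g (nrm i) = \sum_(1 <= k < N.+1) g k *+ size (l k).
  rewrite -sum_lev // -big_filter; apply: perm_big; apply: uniq_perm.
  - by rewrite filter_uniq // fset_uniq.
  - exact: lev_uniq.
  move=> t; rewrite mem_filter; apply/andP/idP => [[tN tB]|/levP[] // Dt].
    by apply/levP => //; split; [exact: BD|rewrite ltnS tN nrm_gt0 //; exact: BD].
  by rewrite ltnS => /andP[_ tN]; split=> //; exact: AB'.
have E2 : cmod (\sum_(i <- B | ~~ (nrm i <= N)%N) g (nrm i)) <= e / 3.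
  rewrite (le_trans (cmod_sum _ _ _)) // -big_filter.
  set M := (\max_(t <- B) nrm t)%N.
  apply: le_trans (h2 N.+1 M.+1 _); last by rewrite leqW // leq_maxr.
  rewrite -(sum_lev (fun k => cmod (g k))) //.
  apply: ler_sum_subset; first by rewrite filter_uniq // fset_uniq.
  - exact: lev_uniq.
  - move=> t; rewrite mem_filter -ltnNge => /andP[Nt tB].
    by apply/levP => //; split; [exact: BD|rewrite Nt ltnS; exact: leq_bigmax_seq].
  - by move=> t _; exact: cmod_ge0.
have E3 := h1 N (leq_maxl _ _); rewrite E1.
rewrite (le_lt_trans (cmodD _ _)) // (le_lt_trans (lerD E3 E2)) //; lra.
Qed.
End LevelSummation.

Section IdealSeries.
Variables (R : realType) (d : nat).
Hypotheses (d_odd : odd d) (d_sf : squarefree d).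
Let q := (8 * d)%N.
Let d0 : (0 < d)%N. Proof. by case/andP: d_sf. Qed.
Implicit Types s : R[i].

Let Z s Y : R[i] := \sum_(0 <= i < Y) npw i.+1 s.

Let Z_diff s (sg : R) X Y : re s = sg -> (Y <= X)%N ->
  cmod (Z s X - Z s Y) <= \sum_(Y <= i < X) i.+1%:R `^ (- sg).
Proof.
move=> <- YX; rewrite /Z (big_cat_nat (leq0n Y) YX) /= addrAC subrr add0r.
rewrite (le_trans (cmod_sum _ _ _)) // ler_sum // => i _.
by rewrite cmod_npw.
Qed.

(** A Dirichlet product: the partial sum up to X is the sum of a_i Z(X / (i + 1)), which is compared
    with the product of the two partial sums. *)
Lemma rdiv_series s : 1 < re s ->
  cconv (fun X => \sum_(1 <= n < X.+1) (rdiv d n)%:~R * npw n s) (dirL d s * zseries s).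
Proof.
move=> s1; set sg := re s; pose dl := sg - 1.
have dl0 : 0 < dl by rewrite subr_gt0.
have sgE : sg = 1 + dl by rewrite /dl; ring.
pose p i : R := i.+1%:R `^ (- sg).
have p0 i : 0 <= p i by exact: powR_ge0.
have tail (e : R) : 0 < e -> exists N, forall n m, (N <= n)%N -> \sum_(n <= i < m) p i <= e.
  by move=> e0; have := pseries_tail0 dl0 e0; rewrite /p sgE.
have [B B0 hB] : exists2 B : R, 0 < B & forall n m, \sum_(n <= i < m) p i <= B.
  have [N hN] := tail 1 ltr01; exists (\sum_(0 <= i < N) p i + 1).
    by rewrite ltr_wpDl // sumr_ge0.
  have full m : \sum_(0 <= i < m) p i <= \sum_(0 <= i < N) p i + 1.
    have [mN|Nm] := leqP m N.
      rewrite (big_cat_nat (leq0n m) mN) /= -addrA lerDl addr_ge0 // sumr_ge0 //.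
    rewrite (big_cat_nat (leq0n N) (ltnW Nm)) /= lerD2l; exact: hN.
  move=> n m; apply: le_trans (full m); have [mn|nm] := leqP m n.
    by rewrite big_geq // sumr_ge0.
  by rewrite (big_cat_nat (leq0n n) (ltnW nm)) /= lerDr sumr_ge0.
pose a i : R[i] := psiC R d i.+1 * npw i.+1 s.
have a_le i : cmod (a i) <= p i.
  by rewrite cmodM cmod_npw cmod_real -[leRHS]mul1r ler_wpM2r ?powR_ge0 // normr_psiR.
have E X : \sum_(1 <= n < X.+1) (rdiv d n)%:~R * npw n s =
    \sum_(0 <= i < X) a i * Z s (X %/ i.+1).
  have -> : \sum_(1 <= n < X.+1) (rdiv d n)%:~R * npw n s =
      \sum_(1 <= n < X.+1) \sum_(k <- divisors n) psiC R d k * npw k s * npw (n %/ k) s.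
    apply: eq_big_nat => n /andP[n0 _]; rewrite /rdiv rmorph_sum mulr_suml.
    rewrite big_seq [RHS]big_seq; apply: eq_bigr => k; rewrite -dvdn_divisors // => kn.
    have k0 := dvdn_gt0 n0 kn.
    rewrite -mulrA -npwM // ?divn_gt0 ?(dvdn_leq n0 kn) // mulnC divnK //.
    by rewrite /psiC /psiR rmorph_int.
  rewrite (sum_divisors_exchange (fun k m => psiC R d k * npw k s * npw m s)) big_add1 /=.
  by apply: eq_bigr => i _; rewrite -mulr_sumr /Z; congr (_ * _); rewrite big_add1.
have hP : cconv (fun X => (\sum_(0 <= i < X) a i) * Z s X) (dirL d s * zseries s).
  apply: cconvM.
    have := dirL_cconv d_odd d_sf (lt_trans ltr01 s1); congr cconv; apply/funext => N.
    by rewrite big_mkord.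
  by have := zseries_conv s1; congr cconv; apply/funext => N; rewrite /Z big_mkord.
rewrite -[X in cconv _ X]subr0.
have hD : cconv (fun X => \sum_(0 <= i < X) a i * (Z s X - Z s (X %/ i.+1))) 0.
  move=> e e0; pose e' := e / (2 * B); have e'0 : 0 < e' by rewrite divr_gt0 // mulr_gt0.
  (* For i <= N the quotient X / (i + 1) is still at least N, so the zeta sums are close; for i > N
     the coefficients have a small tail and the zeta sums differ by at most B. *)
  have [N hN] := tail e' e'0; exists (N.+1 ^ 2)%N => X XN; rewrite subr0.
  have NX : (N.+1 <= X)%N by apply: leq_trans XN; rewrite expnS expn1 leq_pmulr.
  rewrite (le_trans (cmod_sum _ _ _)) // (big_cat_nat (leq0n N.+1) NX) /=.
  apply: (@le_trans _ _ (\sum_(0 <= i < N.+1) p i * e' + \sum_(N.+1 <= i < X) p i * B)).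
    apply: lerD; rewrite big_nat [leRHS]big_nat; apply: ler_sum => i /andP[i1 i2].
      rewrite cmodM ler_pM ?cmod_ge0 //.
      rewrite (le_trans (Z_diff erefl (leq_div _ _))) // hN //.
      by rewrite leq_divRL // (leq_trans _ XN) // expnS expn1 leq_mul.
    rewrite cmodM ler_pM ?cmod_ge0 //.
    by rewrite (le_trans (Z_diff erefl (leq_div _ _))).
  rewrite -!mulr_suml; have t1 := hB 0%N N.+1; have t2 := hN N.+1 X (leqnSn N).
  have -> : e = B * e' + e' * B by rewrite /e'; field; rewrite gt_eqF.
  by apply: lerD; apply: ler_wpM2r => //; exact: ltW.
have := cconvB hP hD; congr cconv; apply/funext => X; rewrite E mulr_suml -sumrB.
by apply: eq_bigr => i _; ring.
Qed.

(** At a real argument the terms are nonnegative, so absolute convergence is the Cauchy criterion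
    for [rdiv_series]. *)
Lemma rdiv_abs_series (x : R) : 1 < x -> forall e : R, 0 < e -> exists N : nat, forall n m, (N <= n)%N ->
  \sum_(n <= k < m) (rdiv d k)%:~R * k%:R `^ (- x) <= e.
Proof.
move=> x1 e e0; have e2 : 0 < e / 2 by rewrite divr_gt0.
have [N hN] := rdiv_series (s := x%:C) x1 e2; exists N.+1 => n m.
have E X : \sum_(1 <= n < X.+1) (rdiv d n)%:~R * npw n x%:C =
    (\sum_(1 <= k < X.+1) (rdiv d k)%:~R * k%:R `^ (- x))%:C.
  rewrite rmorph_sum; apply: eq_big_nat => -[//|k] _.
  by rewrite rmorphM rmorph_int npw_real.
case: n => // n Nn; have [mn|nm] := leqP m n.+1; first by rewrite big_geq // ltW.
case: m nm => // m nm; have h1 := hN n Nn; have h2 := hN m (leq_trans Nn (ltnW nm)).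
rewrite !E in h1 h2; rewrite (big_cat_nat (ltn0Sn n) (ltnW nm)) /= rmorphD in h2.
set S := \sum_(n.+1 <= k < m.+1) _ in h2 *.
have : cmod S%:C <= e.
  set u := (\sum_(1 <= i < n.+1) _)%:C in h1 h2; set L := _ * _ in h1 h2.
  rewrite (_ : S%:C = (u + S%:C - L) - (u - L)); last by ring.
  by rewrite (le_trans (cmodB _ _)) // (splitr e) lerD.
by rewrite cmod_real => /(le_trans (ler_norm _)).
Qed.

Section Ideals.
Variables (K : fieldExtType rat) (w : K).
Hypothesis w2 : w ^+ 2 = (2 * d)%:R.
Hypothesis gen : forall x : K, exists a b : rat, x = a%:A + b%:A * w.

Lemma has_sum_ideals s : 1 < re s ->
  has_sum (nonzero_ideals (K := K)) (fun I => natcpow (ideal_norm I) (- (s : CC R)))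
    (dirL d s * zseries s).
Proof.
move=> s1.
have m4 := radicand_mod4 d_odd d_sf; have msf := radicand_squarefree d_odd d_sf.
have szE n : (0 < n)%N -> ((size (ideal_list w (2 * d) n))%:Z = rdiv d n).
  by move=> n0; rewrite size_ideal_list /rdiv (sum_psi d_odd d_sf n0).
have sumE (V : pzRingType) (F : nat -> V) m n : (0 < m)%N ->
    \sum_(m <= k < n) F k *+ size (ideal_list w (2 * d) k) = \sum_(m <= k < n) (rdiv d k)%:~R * F k.
  move=> m0; apply: eq_big_nat => k /andP[mk _]; rewrite -szE ?(leq_trans m0) //.
  by rewrite pmulrn mulr_natl.
have h : has_sum (nonzero_ideals (K := K)) (fun I => npw (ideal_norm I) s : CC R) (dirL d s * zseries s).
  apply: (@has_sum_levels R _ _ (@ideal_norm K) (ideal_list w (2 * d)) (fun n => npw n s)).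
  - by move=> n; exact: ideal_list_uniq.
  - by move=> n I; exact: ideal_listP.
  - by move=> I; exact: (ideal_norm_gt0 w2).
  - by under eq_fun do rewrite sumE //; exact: rdiv_series.
  - move=> e e0; have [N hN] := rdiv_abs_series s1 e0; exists N.+1 => n m Nn.
    rewrite sumE; last by apply: leq_trans Nn.
    apply: le_trans (hN n m (ltnW Nn)); rewrite le_eqVlt; apply/orP; left; apply/eqP.
    by apply: eq_big_nat => -[|k] /andP[nk _]; [move: nk Nn; case: n|rewrite cmod_npw].
move=> e e0; have [A hA hB] := h e e0; exists A => // B AB BD.
rewrite (_ : \sum_(I <- B) natcpow (ideal_norm I) (- s) = \sum_(I <- B) npw (ideal_norm I) s).
  exact: hB.
apply: eq_big_seq => I IB; apply: natcpow_npw; apply: (ideal_norm_gt0 w2) => //; exact: BD.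
Qed.
End Ideals.
End IdealSeries.

(** * Dedekind zeta functions *)

Section DedekindZeta.
Variables (R : realType).
Implicit Types s z : R[i].

Lemma has_sum_unique (T : choiceType) (D : set T) (f : T -> CC R) (l l' : CC R) :
  has_sum D f l -> has_sum D f l' -> l = l'.
Proof.
move=> h h'; apply/eqP; rewrite -subr_eq0 -cmod_eq0 eq_le cmod_ge0 andbT leNgt; apply/negP => e0.
have e2 : 0 < cmod (l - l') / 2 by rewrite divr_gt0.
have [A AD hA] := h _ e2; have [A' AD' hA'] := h' _ e2.
pose B := (A `|` A')%fset.
have AB : [set` A] `<=` [set` B] by move=> t /= tA; rewrite inE tA.
have AB' : [set` A'] `<=` [set` B] by move=> t /= tA; rewrite inE tA orbT.
have BD : [set` B] `<=` D by move=> t /=; rewrite inE => /orP[/AD|/AD'].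
have := hA B AB BD; have := hA' B AB' BD; rewrite !cmodE !ltcR.
set S := \sum_(i <- B) f i => h1 h2.
have : cmod (l - l') < cmod (l - l') / 2 + cmod (l - l') / 2.
  rewrite {1}(_ : l - l' = (S - l') - (S - l)); last by ring.
  by rewrite (le_lt_trans (cmodB _ _)) // ltrD.
by rewrite -splitr ltxx.
Qed.

Variable K : fieldExtType rat.

(* The second factor s - 1 makes the value at the pole independent of the junk
   value f 1. *)
Lemma is_dedekind_zeta_holo (f : CC R -> CC R) z : is_dedekind_zeta K f ->
  exists l, cder (fun s => (s - 1) * ((s - 1) * f s)) z l.
Proof.
move=> [df [r r0 hr] _]; have [->|z1] := eqVneq z 1; last first.
  have d1 := cderB (cder_id z) (cder_cst 1 z).
  by eexists; apply: cderM d1 (cderM d1 (derivable_cder (df z z1))).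
exists r => e e0; have e0' : 0 < e%:C by rewrite ltcR.
move: hr => /cvgrPdist_lt /(_ _ e0') /nbhs_ballP[d d0 H].
have [d1 d2] := gt0_complex d0; exists (re d) => // h hd.
have [->|h0] := eqVneq h 0; first by rewrite addr0 !(subrr, mul0r, mulr0) cmod0 mulr0.
have /= := H (1 + h); rewrite -ball_normE /= opprD addrA subrr sub0r normrN d1 cmodE ltcR => /(_ hd).
rewrite -subr_eq0 addrAC subrr add0r cmodE ltcR => /(_ h0) k.
have -> : h * (h * f (1 + h)) - 0 * (0 * f 1) - r * h = h * - (r - h * f (1 + h)) by ring.
by rewrite cmodM cmodN mulrC ler_wpM2r ?cmod_ge0 // ltW.
Qed.

Lemma is_dedekind_zeta_unique (f g : CC R -> CC R) s : is_dedekind_zeta K f ->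
  is_dedekind_zeta K g -> 0 < re s -> s != 1 -> f s = g s.
Proof.
move=> hf hg s0 s1.
have := @identity_halfplane R _ _ 0 1 (fun z _ => is_dedekind_zeta_holo z hf)
  (fun z _ => is_dedekind_zeta_holo z hg) _ s s0.
move=> H; have {}H := H _; have sn : s - 1 != 0 by rewrite subr_eq0.
apply: (mulfI sn); apply: (mulfI sn); apply: H => z hz; congr (_ * (_ * _)).
by case: hf hg => _ _ h [_ _ h']; exact: has_sum_unique (h z hz) (h' z hz).
Qed.

(** By uniqueness the chosen function agrees with f on the open disc of radius 1/2 about 1/2, which
    avoids the pole and lies in Re s > 0. *)
Lemma dedekind_zeta_derive (f : CC R -> CC R) l : is_dedekind_zeta K f ->
  cder f 2^-1 l -> derive1 (dedekind_zeta K) (2^-1 : CC R) = l.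
Proof.
move=> hf hl; apply: cder_derive.
have hz : is_dedekind_zeta K (dedekind_zeta K : CC R -> CC R).
  by rewrite /dedekind_zeta; case: xgetP => [g -> //|/(_ f)].
have half : (2^-1 : R[i]) = (2^-1)%:C by rewrite fmorphV rmorph_nat.
apply: (@cder_near _ f _ _ _ (2^-1)) hl; first by rewrite invr_gt0.
move=> w hw; apply: (is_dedekind_zeta_unique hf hz).
  have := le_lt_trans (re_le_cmod _) hw; rewrite reB half /= ltr_norml => /andP[+ _]; lra.
apply/eqP => w1; move: hw; rewrite w1 half -[1]/((1 : R)%:C) -rmorphB cmod_real.
by rewrite ger0_norm; lra.
Qed.
End DedekindZeta.

Section QuadraticZeta.
Variables (R : realType) (d : nat).
Hypotheses (d_odd : odd d) (d_sf : squarefree d).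
Let q := (8 * d)%N.
Let d0 : (0 < d)%N. Proof. by case/andP: d_sf. Qed.

(** The residue at 1 is A(1) L(1) = L(1), and its nonvanishing is what [realL1_neq0] was proved for.
    For Re s > 1 the factor s - 1 cancels and the sum over ideals appears. *)
Lemma zeta_quadratic (A : R[i] -> R[i]) (L : CC R -> CC R) :
  (forall s, exists l, cder A s l) -> (forall s, 1 < re s -> A s = (s - 1) * zseries s) ->
  A 1 = 1 -> is_dirichletL (kronecker q%:Z) L ->
  is_dedekind_zeta (Qsqrt (2 * d)) (fun s : CC R => A s * L s / (s - 1)).
Proof.
move=> dA AE A1 hL; have [w [w2 gen]] := Qsqrt_gen (2 * d).
have dL s : exists l, cder L s l by exact: is_dirichletL_cder hL.
have L1 : L 1 = (realL d 1)%:C.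
  by rewrite (is_dirichletL_dirL d_odd d_sf hL) ?ltr01 // (@dirL_real R d d_odd d_sf 1 ltr01).
split.
- move=> s s1; have [a ha] := dA s; have [b hb] := dL s.
  have sn : s - 1 != 0 by rewrite subr_eq0.
  apply: cder_derivable; apply: cderM (cderM ha hb) _.
  by apply: cder_comp (cderB (cder_id s) (cder_cst 1 s)) (cder_inv sn).
- exists (L 1).
    by rewrite L1 eq_complex /= eqxx andbT realL1_neq0.
  have [a ha] := dA 1; have [b hb] := dL 1; have hAL := cderM ha hb.
  apply/cvgrPdist_le => e e0; have [e1 e2] := gt0_complex e0.
  have [r r0 hr] := cder_continuous hAL e2.
  apply/nbhs_ballP; exists r%:C; first by rewrite /= ltcR.
  move=> s; rewrite -ball_normE /= distrC cmodE ltcR => /hr; rewrite A1 mul1r => h s1.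
  rewrite mulrC divfK ?subr_eq0 // distrC cmodE e1 lecR; exact: ltW.
move=> s s1; rewrite AE // (is_dirichletL_dirL d_odd d_sf hL) ?(lt_trans ltr01) //.
have sn : s - 1 != 0.
  by rewrite subr_eq0; apply/eqP => h; move: s1; rewrite h /= ltxx.
have -> : (s - 1) * zseries s * dirL d s / (s - 1) = dirL d s * zseries s by field.
exact: (@has_sum_ideals R d d_odd d_sf (Qsqrt (2 * d)) w w2 gen s s1).
Qed.

End QuadraticZeta.

(** * Uniqueness of the exceptional d *)

Section AtMostOne.
Variable R : realType.

(** Real increments alone determine a complex derivative; the functional equation is known only on
    the real segment. *)
Lemma cder_real_eq (F G : R[i] -> R[i]) (x : R) (e : R) l l' : 0 < e ->
  (forall h : R, `|h| < e -> F (x + h)%:C = G (x + h)%:C) ->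
  cder F x%:C l -> cder G x%:C l' -> l = l'.
Proof.
move=> e0 FG hF hG; have := cderB hF hG; set D := fun w => _ => hD.
apply/eqP; rewrite -subr_eq0 -cmod_eq0 eq_le cmod_ge0 andbT.
apply/ler_addgt0Pr => r r0; rewrite add0r; have [t t0 ht] := hD r r0.
pose h := Num.min e t / 2.
have m0 : 0 < Num.min e t by rewrite lt_min e0.
have h0 : 0 < h by rewrite divr_gt0.
have hm : h < Num.min e t by rewrite /h; lra.
move: hm; rewrite lt_min => /andP[h1 h2].
have Dz k : `|k| < e -> D (x + k)%:C = 0 by move=> /FG E; rewrite /D E subrr.
have := ht h%:C; rewrite cmod_real gtr0_norm // => /(_ h2).
rewrite -rmorphD Dz ?gtr0_norm // -[X in D X%:C]addr0 Dz ?normr0 // subrr sub0r cmodN cmodM.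
by rewrite cmod_real gtr0_norm // ler_pM2r.
Qed.

Lemma half_complex : (2^-1 : R[i]) = (2^-1 : R)%:C.
Proof. by rewrite fmorphV rmorph_nat. Qed.

Definition exceptional d := [/\ odd d, squarefree d,
  dirichletL (kronecker (8 * d)%N%:Z) (2^-1 : CC R) != 0 &
  derive1 (dedekind_zeta (Qsqrt (2 * d)%N)) (2^-1 : CC R) = 0].

Lemma exceptional_logarithmic_derivative : exists k : R[i], forall d, exceptional d ->
  dirL d (2^-1 : R[i]) != 0 /\ cder (dirL d) (2^-1 : R[i]) (k * dirL d 2^-1).
Proof.
have [A [dA AE A1 A2]] := zeta_entire R; have [a ha] := dA 2^-1.
(* The logarithmic derivative of A(s) L(s) / (s - 1) at 1/2 is A'/A + L'/L + 2, the 2 being -1 /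
   (1/2 - 1). Its vanishing gives L'/L. *)
exists (- (a / A 2^-1 + 2)) => d [d_odd d_sf].
rewrite /dirichletL; case: xgetP => [L _ hL|]; last by rewrite eqxx.
move=> Ln; have half0 : 0 < re (2^-1 : R[i]) by exact: re_half.
have LE := is_dirichletL_dirL d_odd d_sf hL.
have [b hb] := is_dirichletL_cder 2^-1 hL.
have sn : (2^-1 : R[i]) - 1 != 0.
  by rewrite half_complex -rmorphB eq_complex /= eqxx andbT; apply/eqP; lra.
have hf := cderM (cderM ha hb) (cder_comp (cderB (cder_id 2^-1) (cder_cst 1 2^-1)) (cder_inv sn)).
rewrite (dedekind_zeta_derive (zeta_quadratic d_odd d_sf dA AE A1 hL) hf) => E.
rewrite -LE //; split=> //.
have -> : - (a / A 2^-1 + 2) * L 2^-1 = b.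
  apply: (mulfI A2); move: E; rewrite (_ : 2^-1 - 1 = - 2^-1); last by field.
  rewrite invrN invrK => E.
  have -> : A 2^-1 * (- (a / A 2^-1 + 2) * L 2^-1) = - (a + 2 * A 2^-1) * L 2^-1 by field.
  apply/eqP; rewrite -subr_eq0 -[X in _ == X](mul0r (2^-1)) -E; apply/eqP.
  by field.
apply: (@cder_near _ L _ _ _ (2^-1)) hb; first by rewrite invr_gt0.
move=> w hw; apply: LE.
by have := le_lt_trans (re_le_cmod _) hw; rewrite reB half_complex /= ltr_norml => /andP[+ _]; lra.
Qed.

(** The functions F and G below agree on (0, 1). At 1/2 the factors L(s) and L(1 - s) contribute k
    and -k to either logarithmic derivative, so these are -ln (8 d2) and -ln (8 d1). *)
Lemma exceptional_unique d1 d2 : exceptional d1 -> exceptional d2 -> d1 = d2.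
Proof.
have [k hk] := exceptional_logarithmic_derivative => e1 e2.
have [n1 c1] := hk _ e1; have [n2 c2] := hk _ e2.
have [odd1 s1 _ _] := e1; have [odd2 s2 _ _] := e2.
have p1 : (0 < d1)%N by case/andP: s1.
have p2 : (0 < d2)%N by case/andP: s2.
pose t1 := tau R d1; pose t2 := tau R d2.
(* The functional equation of d1 times that of d2 with sides exchanged; A, B and (2 pi)^(s-1) occur
   on both sides, and only the conductors keep F and G apart. *)
pose F (s : R[i]) := (t1%:C * dirL d1 s) * (dirL d2 (1 - s) * npw (8 * d2) (s - 1)).
pose G (s : R[i]) := (t2%:C * dirL d2 s) * (dirL d1 (1 - s) * npw (8 * d1) (s - 1)).
have npwE n (x : R) : (0 < n)%N -> npw n (x%:C - 1) = (n%:R `^ (1 - x))%:C :> R[i].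
  by case: n => // n _; rewrite -[1]/((1 : R)%:C) -rmorphB npw_real opprB.
have FG (x : R) : 0 < x < 1 -> F x%:C = G x%:C.
  move=> hx; have /andP[x0 x1] := hx; have x1' : 0 < 1 - x by rewrite subr_gt0.
  have [a [b [a0 b0 FE]]] := real_functional_equation hx.
  have E1 := FE d1 odd1 s1; have E2 := FE d2 odd2 s2.
  rewrite /F /G !npwE ?muln_gt0 // -[1 - x%:C]/((1 : R)%:C - x%:C) -rmorphB.
  rewrite !dirL_real // -!rmorphM; congr (_%:C).
  have P n : (0 < n)%N -> (pi *+ 2 / n%:R) `^ (x - 1) = (pi *+ 2) `^ (x - 1) * n%:R `^ (1 - x) :> R.
    have pi2 : 0 <= pi *+ 2 :> R by rewrite mulrn_wge0 // ltW // pi_gt0.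
    move=> n0; rewrite (powRM _ pi2) ?invr_ge0 ?ler0n //.
    by rewrite -powR_inv1 ?ler0n // -powRrM; congr (_ * _ `^ _); ring.
  move: E1 E2; rewrite !P ?muln_gt0 //; set u1 := _ `^ (1 - x); set u2 := (8 * d2)%:R `^ (1 - x).
  set v := _ `^ (x - 1) => E1 E2.
  have v0 : 0 < v by rewrite powR_gt0 // pmulrn_lgt0 // pi_gt0.
  apply: (@mulIf _ (a * (v * b))); first by rewrite gt_eqF // !mulr_gt0.
  rewrite (_ : _ * _ * _ = (t1 * realL d1 x * a) * (v * u2 * realL d2 (1 - x) * b)); last by ring.
  by rewrite -E2 E1 /t2; ring.
have half0 : 0 < re (2^-1 : R[i]) by exact: re_half.
have hh : 1 - 2^-1 = 2^-1 :> R[i] by field.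
have dF (da db n : nat) (t : R) : cder (dirL da) 2^-1 (k * dirL da 2^-1) ->
    cder (dirL db) 2^-1 (k * dirL db 2^-1) ->
    cder (fun s : R[i] => (t%:C * dirL da s) * (dirL db (1 - s) * npw n (s - 1))) 2^-1
      (- (ln n%:R)%:C * ((t%:C * dirL da 2^-1) * (dirL db (1 - 2^-1) * npw n (2^-1 - 1)))).
  move=> h1 h2; have h3 := cderB (cder_cst 1 (2^-1 : R[i])) (cder_id 2^-1).
  have h2' : cder (dirL db) (1 - 2^-1) (k * dirL db 2^-1) by rewrite hh.
  have h4 := cder_comp h3 h2'.
  have h5 : cder (npw n) (2^-1 - 1) (- (ln n%:R)%:C * npw n (2^-1 - 1) :> R[i]).
    have := cder_comp (cderM (cderN (cder_id (2^-1 - 1 : R[i]))) (cder_cst (ln n%:R)%:C _)) (cder_cexp _).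
    by rewrite mulr0 add0r mulrN1 mulrC.
  have h6 := cder_comp (cderB (cder_id (2^-1 : R[i])) (cder_cst 1 _)) h5.
  have := cderM (cderM (cder_cst t%:C _) h1) (cderM h4 h6).
  by congr (cder _ _); rewrite !hh; ring.
have FGd : - (ln (8 * d2)%:R)%:C * F 2^-1 = - (ln (8 * d1)%:R)%:C * G 2^-1.
  have := dF d1 d2 (8 * d2)%N t1 c1 c2; have := dF d2 d1 (8 * d1)%N t2 c2 c1.
  rewrite half_complex => hG hF; apply: (@cder_real_eq F G 2^-1 2^-1 _ _ _ _ hF hG).
    by rewrite invr_gt0.
  by move=> h; rewrite ltr_norml => /andP[l1 l2]; apply: FG; lra.
have FG2 : F 2^-1 = G 2^-1.
  by rewrite half_complex; apply: FG; lra.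
have F0 : F 2^-1 != 0.
  have nz : npw (8 * d2) (2^-1 - 1) != 0 :> R[i].
    by rewrite -cmod_eq0 cmod_cexp gt_eqF // expR_gt0.
  have -> : F 2^-1 = t1%:C * dirL d1 2^-1 * (dirL d2 2^-1 * npw (8 * d2) (2^-1 - 1)) by rewrite /F hh.
  apply: mulf_neq0; last exact: mulf_neq0 n2 nz.
  (* The Gauss sum does not vanish: otherwise the functional equation at its fixed point 1/2 would
     give L(1/2) = 0. *)
  apply: (mulf_neq0 _ n1); rewrite eq_complex /= eqxx andbT; apply/eqP => t0.
  have [|a [b [a0 b0 FE]]] := @real_functional_equation R 2^-1; first by lra.
  have := FE d1 odd1 s1; rewrite -/t1 t0 !mul0r => /esym/eqP.
  rewrite !mulf_eq0 (gt_eqF b0) orbF; have -> : 1 - 2^-1 = 2^-1 :> R by field.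
  have q0 : 0 < (pi *+ 2 / (8 * d1)%:R) `^ (2^-1 - 1) :> R.
    by apply: powR_gt0; apply: divr_gt0; [rewrite pmulrn_lgt0 // pi_gt0|rewrite ltr0n muln_gt0].
  rewrite (gt_eqF q0) /= => /eqP L0; move: n1.
  by rewrite half_complex dirL_real ?invr_gt0 // L0 eqxx.
have : ln (8 * d2)%:R = ln (8 * d1)%:R :> R.
  move: FGd; rewrite -FG2 => /(mulIf F0) /oppr_inj h.
  by have := congr1 (fun z : R[i] => re z) h.
move=> /(@ln_inj R _ _) h; have {}h : (8 * d2)%:R = (8 * d1)%:R :> R.
  by apply: h; rewrite posrE ltr0n muln_gt0.
by move/eqP: h; rewrite eqr_nat eqn_mul2l /= => /eqP.
Qed.
End AtMostOne.

(** * Lower density *)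

Section Density.
Variable R : realType.

Lemma limf_einf_perturb (f g h : R -> R) (c : R) : (forall x, f x <= g x + h x) ->
  (forall e : R, 0 < e -> exists M : R, forall x, M < x -> h x <= e) ->
  (c%:E <= limf_einf (fun x => (f x)%:E) +oo%R)%E ->
  (c%:E <= limf_einf (fun x => (g x)%:E) +oo%R)%E.
Proof.
move=> fgh h0; rewrite !limf_einfE => cf; apply/lee_addgt0Pr => e e0.
have e2 : 0 < e / 2 by rewrite divr_gt0.
have [M hM] := h0 _ e2.
have : ((c - e / 2)%:E < ereal_sup [set ereal_inf [set (f x)%:E | x in V] | V in +oo%R])%E.
  by apply: lt_le_trans cf; rewrite lte_fin gtrBl.
move=> /ereal_sup_gt[_ [V FV <-]] cV.
have [M' [_ hM']] := FV.
have : (ereal_inf [set (g x)%:E | x in [set x | (Num.max M M' < x)%R]] <=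
    ereal_sup [set ereal_inf [set (g x)%:E | x in V] | V in +oo%R])%E.
  apply: ereal_sup_ubound; exists [set x | (Num.max M M' < x)%R] => //.
  by exists (Num.max M M'); split; first exact: num_real.
move=> le; rewrite -leeBlDr // -EFinB; apply: le_trans le.
apply: le_ereal_inf_tmp => y [x /=]; rewrite gt_max => /andP[Mx Mx'] <-.
rewrite lee_fin; have k1 := hM x Mx; have k2 := fgh x.
have : (ereal_inf [set (f x)%:E | x in V] <= (f x)%:E)%E.
  by apply: ereal_inf_lbound; exists x => //; exact: hM'.
move=> /(lt_le_trans cV); rewrite lte_fin; lra.
Qed.

Lemma odd_primes N : exists s : seq nat,
  [/\ size s = N, uniq s & forall p, p \in s -> prime p && odd p].
Proof.
elim: N => [|N [s [sz us ps]]]; first by exists [::].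
have [p pgt pp] := prime_above (maxn 2 (\max_(i <- s) i)).
move: pgt; rewrite gtn_max => /andP[p2 pgt]; exists (p :: s); split.
- by rewrite /= sz.
- rewrite /= us andbT; apply/negP => ps'; have := @leq_bigmax_seq _ s xpredT id p ps' isT.
  by rewrite leqNgt pgt.
- move=> r; rewrite inE => /orP[/eqP ->|/ps //]; rewrite pp /=.
  by case: (even_prime pp) => // e; rewrite e in p2.
Qed.

Lemma prime_squarefree p : prime p -> squarefree p.
Proof.
move=> pp; rewrite /squarefree prime_gt0 // primes_prime //= andbT.
apply/negP => /dvdn_leq; rewrite prime_gt0 // => /(_ isT).
by rewrite expnS expn1 -{3}[p]muln1 leq_pmul2l ?prime_gt0 // leqNgt prime_gt1.
Qed.

Let S (P : set nat) (x : R) := [set d : nat | [/\ d%:R <= x, odd d, squarefree d & P d]].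

Let finS P x : finite_set (S P x).
Proof.
apply: (@sub_finite_set _ _ `I_(Num.bound `|x|)); last exact: finite_II.
move=> d [dx _ _ _] /=; rewrite -(ltr_nat R).
by rewrite (le_lt_trans dx) // (le_lt_trans (ler_norm x)) // archi_boundP.
Qed.

Lemma count_le_add1 (P Q : set nat) d0 (x : R) :
  (forall d, odd d -> squarefree d -> P d -> ~ Q d -> d = d0) ->
  (count_odd_squarefree P x <= count_odd_squarefree Q x + 1)%N.
Proof.
move=> H; rewrite /count_odd_squarefree -/(S P x) -/(S Q x).
have sub : (fset_set (S P x) `<=` d0 |` fset_set (S Q x))%fset.
  apply/fsubsetP => d; rewrite in_fset_set // inE => -[dx od sd Pd].
  rewrite !inE in_fset_set //; apply/orP; have [Qd|nQ] := pselect (Q d).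
    by right; rewrite inE.
  by left; apply/eqP; exact: H.
rewrite (leq_trans (fsubset_leq_card sub)) // cardfsU1 addnC leq_add2l.
by case: (_ \notin _).
Qed.

(** Odd primes are odd and square-free, and there are arbitrarily many; hence the weight of one
    exception tends to 0. *)
Lemma count_unbounded N : exists M : R, forall x : R, M < x -> (N <= count_odd_squarefree setT x)%N.
Proof.
have [s [sz us ps]] := odd_primes N; exists (\max_(i <- s) i)%:R => x Mx.
rewrite /count_odd_squarefree -/(S setT x).
have sub : ([fset p in s] `<=` fset_set (S setT x))%fset.
  apply/fsubsetP => p; rewrite inE /= => p_s; have /andP[pp op] := ps p p_s.
  rewrite in_fset_set // inE; split=> //; last exact: prime_squarefree.
  by rewrite (le_trans _ (ltW Mx)) // ler_nat (@leq_bigmax_seq _ s xpredT id p p_s isT).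
by apply: leq_trans (fsubset_leq_card sub); rewrite card_fseq undup_id // sz.
Qed.

(** One exception changes the counts by at most 1, hence the proportion by at most the reciprocal of
    the total count, which [limf_einf_perturb] discards. *)
Lemma lower_density_exception (P Q : set nat) (c : R) :
  (forall d1 d2, [/\ odd d1, squarefree d1, P d1 & ~ Q d1] ->
    [/\ odd d2, squarefree d2, P d2 & ~ Q d2] -> d1 = d2) ->
  (c%:E <= lower_density_odd_squarefree R P)%E -> (c%:E <= lower_density_odd_squarefree R Q)%E.
Proof.
move=> H; have [d0 hd0] : exists d0, forall d, odd d -> squarefree d -> P d -> ~ Q d -> d = d0.
  have [[d0 h]|n] := pselect (exists d0, [/\ odd d0, squarefree d0, P d0 & ~ Q d0]).
    by exists d0 => d h1 h2 h3 h4; apply: H.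
  by exists 0%N => d h1 h2 h3 h4; case: n; exists d.
apply: (@limf_einf_perturb _ _ (fun x => (count_odd_squarefree setT x)%:R^-1)).
  move=> x; rewrite -[X in _ <= _ + X]mul1r -mulrDl ler_wpM2r ?invr_ge0 //.
  by have := count_le_add1 x hd0; rewrite -(ler_nat R) natrD.
move=> e e0; have [M hM] := count_unbounded (Num.bound e^-1); exists M => x /hM h.
have ie : 0 < e^-1 by rewrite invr_gt0.
have b : e^-1 <= (count_odd_squarefree setT x)%:R.
  by rewrite (le_trans (ltW (archi_boundP (ltW ie)))) // ler_nat.
by rewrite -[leRHS]invrK lef_pV2 ?posrE // (lt_le_trans ie).
Qed.
End Density.

(* The hypothesis is the known theorem from which the result is deduced. *)
Theorem corollary3 (R : realType)
  (soundararajan :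
    ((7 / 8)%R%:E <= lower_density_odd_squarefree R
      [set d : nat |
        (dirichletL (kronecker (8 * d)%N%:Z) (2^-1 : CC R) != 0)%R])%E) :
  ((7 / 8)%R%:E <= lower_density_odd_squarefree R
    [set d : nat |
      (derive1 (dedekind_zeta (Qsqrt (2 * d)%N)) (2^-1 : CC R) != 0)%R])%E.
Proof.
apply: lower_density_exception soundararajan => d1 d2 [od1 s1 P1 Q1] [od2 s2 P2 Q2].
have E d : ~ derive1 (dedekind_zeta (Qsqrt (2 * d)%N)) (2^-1 : CC R) != 0 ->
    derive1 (dedekind_zeta (Qsqrt (2 * d)%N)) (2^-1 : CC R) = 0 by move=> /negP; rewrite negbK => /eqP.
exact: (@exceptional_unique R d1 d2 (And4 od1 s1 P1 (E _ Q1)) (And4 od2 s2 P2 (E _ Q2))).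
Qed.
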